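(* Suppose that $\mathcal{H}_k$ is an admissible space of Dirichlet series that enjoys the complete Pick property, with abscissa $\sigma_{\mathrm{a}}$ and multiplier algebra $\mathcal{M}_k$. If there is a (necessarily unique) real number $\varsigma$ with $\sigma_{\mathrm{a}}<\varsigma\le\sigma_{\mathrm{a}}+\log3/\log2$ such that $k(\varsigma,\varsigma)=9/8$, then \[\mathcal{B}(\mathcal{M}_k)=\{s\in\mathbb{C}_{\sigma_{\mathrm{a}}}\cup\{+\infty\}\,:\,\operatorname{Re}s\ge\varsigma\}.\] Otherwise, $\mathcal{B}(\mathcal{M}_k)=\mathbb{C}_{\sigma_{\mathrm{a}}}\cup\{+\infty\}$. Moreover, $\varsigma=\sigma_{\mathrm{a}}+\log3/\log2$ (that is, such a $\varsigma$ exists and equals this number) if and only if \[k(s,w)=\frac{1}{1-2^{2\sigma_{\mathrm{a}}-s-\overline{w}}}.\]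
   Context: Let $\mathcal{N}\ne\{1\}$ be a sub-semigroup of the positive integers $(\mathbb{N},\cdot)$ under multiplication with $1\in\mathcal{N}$, and let $(b_n)_{n\in\mathcal{N}}$ satisfy $b_1=1$ and $b_n>0$ for every $n\in\mathcal{N}$. Set \[\sigma_{\mathrm{a}}=\inf\Big\{\sigma\in\mathbb{R}:\sum_{n\in\mathcal{N}}b_nn^{-2\sigma}<\infty\Big\},\] and assume $\sigma_{\mathrm{a}}<+\infty$. Put $\mathbb{C}_{\sigma_{\mathrm{a}}}=\{s\in\mathbb{C}:\operatorname{Re}s>\sigma_{\mathrm{a}}\}$ and $X=\mathbb{C}_{\sigma_{\mathrm{a}}}\cup\{+\infty\}$, with the conventions $\operatorname{Re}(+\infty)=+\infty$ and, at the point $s=+\infty$, $n^{-s}=0$ for $n\ge2$ and $1^{-s}=1$. The reproducing kernel Hilbert space $\mathcal{H}_k$ on $X$ with kernel \[k(s,w)=\sum_{n\in\mathcal{N}}b_nn^{-s-\overline{w}}\] (where $n^{-s-\overline{w}}$ means $n^{-s}\,\overline{n^{-w}}$) is called an admissible space of Dirichlet series. It consists precisely of the Dirichlet series $f(s)=\sum_{n\in\mathcal{N}}\widehat{f}(n)n^{-s}$ with $\sum_{n\in\mathcal{N}}|\widehat{f}(n)|^2/b_n<\infty$, and the functions $n^{-s}$, $n\in\mathcal{N}$, form an orthogonal basis. It is a known fact that if $\mathcal{H}_k$ has the complete Pick property then $\sigma_{\mathrm{a}}>-\infty$, so that $\mathbb{C}_{\sigma_{\mathrm{a}}}$ is a genuine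 half-plane. Multiplier algebra: $\mathcal{M}_k$ consists of the functions $\varphi$ on $X$ such that $M_\varphi:f\mapsto\varphi f$ is a bounded linear operator on $\mathcal{H}_k$, with $\|\varphi\|_{\mathcal{M}_k}=\|M_\varphi\|$; one has $\mathcal{M}_k\subseteq\mathcal{H}_k$, so each $\varphi\in\mathcal{M}_k$ has coefficients $\widehat{\varphi}(n)$. Its majorant is $M\varphi(s)=\sum_{n\in\mathcal{N}}|\widehat{\varphi}(n)n^{-s}|$, and the Bohr set is \[\mathcal{B}(\mathcal{M}_k)=\{s\in X: M\varphi(s)\le\|\varphi\|_{\mathcal{M}_k}\text{ for every }\varphi\in\mathcal{M}_k\}.\] Complete Pick property (standard notion): for all positive integers $n,m$, all points $x_1,\ldots,x_n\in X$ and all complex $m\times m$ matrices $W_1,\ldots,W_n$ such that the block matrix $\big[k(x_i,x_j)(I-W_iW_j^* )\big]_{i,j=1}^n$ is positive semi-definite, there is an $m\times m$ matrix-valued function $\Phi$ with entries in $\mathcal{M}_k$ such that $\Phi(x_i)=W_i$ for every $i$ and multiplication by $\Phi$ on $\mathcal{H}_k\otimes\mathbb{C}^m$ has operator norm at most $1$. *)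

(* Defs.v *)
From HB Require Import structures.
From mathcomp Require Import all_boot all_order all_algebra.
From mathcomp Require Import complex.
From mathcomp Require Import all_classical all_reals all_analysis.

Set Implicit Arguments.
Unset Strict Implicit.
Unset Printing Implicit Defensive.

Import Order.TTheory GRing.Theory Num.Theory.
Import numFieldNormedType.Exports.
Local Open Scope classical_set_scope.
Local Open Scope ring_scope.

Section RKHS.
Variables (R : realType) (T : Type).
Local Notation C := R[i].
Implicit Types (f g h phi : T -> C).

(* The inner product is a function on all of [T -> C], but it is only
   meaningful, and only constrained, on the carrier. *)
Record rkhs (k : T -> T -> C) := Rkhs {
  rkhs_mem : set (T -> C);
  rkhs_dot : (T -> C) -> (T -> C) -> C;
  rkhs_mem0 : rkhs_mem (fun=> 0);
  rkhs_memP : forall (a : C) f g, rkhs_mem f -> rkhs_mem g ->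
    rkhs_mem (fun x => a * f x + g x);
  rkhs_dotP : forall (a : C) f g h, rkhs_mem f -> rkhs_mem g -> rkhs_mem h ->
    rkhs_dot (fun x => a * f x + g x) h = a * rkhs_dot f h + rkhs_dot g h;
  rkhs_dotC : forall f g, rkhs_mem f -> rkhs_mem g ->
    rkhs_dot g f = (rkhs_dot f g)^*;
  rkhs_dot_gt0 : forall f, rkhs_mem f -> f <> (fun=> 0) -> 0 < rkhs_dot f f;
  rkhs_complete : forall u : nat -> T -> C, (forall n, rkhs_mem (u n)) ->
    (forall e : R, 0 < e -> exists K, forall m n, (K <= m)%N -> (K <= n)%N ->
       let d := fun x => u m x - u n x in
       Num.sqrt (complex.Re (rkhs_dot d d)) < e) ->
    exists2 f, rkhs_mem f &
      forall e : R, 0 < e -> exists K, forall n, (K <= n)%N ->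
        let d := fun x => u n x - f x in
        Num.sqrt (complex.Re (rkhs_dot d d)) < e;
  rkhs_kernel : forall w, rkhs_mem (k^~ w);
  rkhs_reproducing : forall f w, rkhs_mem f -> rkhs_dot f (k^~ w) = f w
}.

Variables (k : T -> T -> C) (H : rkhs k).

Definition hnorm f : R := Num.sqrt (complex.Re (rkhs_dot H f f)).

Definition mult_bound phi (c : R) :=
  0 <= c /\ forall f, rkhs_mem H f -> hnorm (phi \* f) <= c * hnorm f.

Definition multiplier : set (T -> C) := [set phi |
  (forall f, rkhs_mem H f -> rkhs_mem H (phi \* f)) /\
  exists c, mult_bound phi c].

Definition mult_norm phi : R := inf [set c | mult_bound phi c].

Definition adjmx m n (A : 'M[C]_(m, n)) : 'M[C]_(n, m) :=
  \matrix_(i, j) (A j i)^*.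

(* Positive semi-definiteness of the block matrix whose (i, j) block is
   [A i j]; the order on C makes [0 <= z] include that z is real. *)
Definition block_psd n m (A : 'I_n -> 'I_n -> 'M[C]_m) :=
  forall v : 'I_n -> 'cV[C]_m,
    0 <= (\sum_i \sum_j adjmx (v i) *m A i j *m v j) 0 0.

(* H tensor C^m is realised as the m-fold orthogonal sum of H. *)
Definition mx_mult_contraction m (Phi : T -> 'M[C]_m) :=
  forall F : 'I_m -> T -> C, (forall j, rkhs_mem H (F j)) ->
    \sum_i hnorm (fun x => \sum_j Phi x i j * F j x) ^+ 2
      <= \sum_j hnorm (F j) ^+ 2.

Definition complete_pick :=
  forall (n m : nat), (0 < n)%N -> (0 < m)%N ->
  forall (x : 'I_n -> T) (W : 'I_n -> 'M[C]_m),
    block_psd (fun i j => k (x i) (x j) *: (1%:M - W i *m adjmx (W j))) ->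
    exists Phi : T -> 'M[C]_m,
      [/\ forall i j, multiplier (fun x => Phi x i j),
          forall i, Phi (x i) = W i
        & mx_mult_contraction Phi].

End RKHS.

Section Dirichlet.
Variable R : realType.
Local Notation C := R[i].

(* [Some s] is the complex number s and [None] is the point +oo. *)
Definition cpoint := option C.

Definition re_point (s : cpoint) : \bar R :=
  if s is Some z then (complex.Re z)%:E else +oo%E.

(* n^{-s} for n >= 1. *)
Definition npow (n : nat) (s : cpoint) : C :=
  if s is Some z then
    (expR (- (complex.Re z * ln n%:R)))%:C%C *
    Complex (cos (complex.Im z * ln n%:R)) (- sin (complex.Im z * ln n%:R))
  else (n == 1%N)%:R.

Variables (N : set nat) (b : nat -> R).

Definition sigma_a : \bar R :=
  ereal_inf [set sigma%:E | sigma in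
    [set sigma : R |
      (\sum_(0 <= n <oo | n \in N) (b n * n%:R `^ (- (2 * sigma)))%:E
         < +oo)%E]].

Definition hplane : set cpoint :=
  [set Some z | z in [set z : C | (sigma_a < (complex.Re z)%:E)%E]]
    `|` [set None].

(* The sum over n in N of a convergent complex series, computed through its
   real and imaginary parts. *)
Definition csum (u : nat -> C) : C :=
  let S M := \sum_(0 <= n < M | n \in N) u n in
  Complex (limn (fun M => complex.Re (S M))) (limn (fun M => complex.Im (S M))).

(* The series converges (absolutely) when s and w belong to [hplane]. *)
Definition kernel_at (s w : cpoint) : C :=
  csum (fun n => (b n)%:C%C * (npow n s * (npow n w)^*)).

Definition kernelX (s w : hplane) : C := kernel_at (val s) (val w).

(* f is the Dirichlet series with coefficients a, and a is square summable
   with weight 1/b; by Cauchy-Schwarz the latter makes the series converge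
   absolutely at every point of [hplane]. *)
Definition dirichlet_coefs (f : hplane -> C) (a : nat -> C) :=
  [/\ forall n, ~ N n -> a n = 0,
      (\sum_(0 <= n <oo | n \in N) (Normc.normc (a n) ^+ 2 / b n)%:E < +oo)%E
    & forall s : hplane, f s = csum (fun n => a n * npow n (val s))].

(* Such a sequence is unique, and exists exactly when f is in the space. *)
Definition coef (f : hplane -> C) : nat -> C :=
  xget (fun=> 0) [set a | dirichlet_coefs f a].

Definition majorant (f : hplane -> C) (s : hplane) : \bar R :=
  (\sum_(0 <= n <oo | n \in N)
     (Normc.normc (coef f n * npow n (val s)))%:E)%E.

Definition bohr_set (H : rkhs kernelX) : set hplane :=
  [set s | forall phi, multiplier H phi ->
             (majorant phi s <= (mult_norm H phi)%:E)%E].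

Definition critical (sigma : R) :=
  [/\ (sigma_a < sigma%:E)%E,
      (sigma%:E <= sigma_a + (ln 3 / ln 2)%:E)%E
    & kernel_at (Some sigma%:C%C) (Some sigma%:C%C) = 9 / 8].

End Dirichlet.

(* Main.v *)
(** Write 1 - 1/k(s, w) = sum_n c_n n^{-s - conj w}. The complete Pick property
    forces 1 - 1/k to be positive semi-definite where k does not vanish
    (McCullough-Quiggin); testing this on the points sigma + j with polynomial
    weights in 1/n isolates the coefficients, so c_n >= 0, and k = 1 + (1 - 1/k) k
    says b = delta_1 + c * b for Dirichlet convolution.

    Put S(t) = sum_n c_n n^{-2t} = 1 - 1/k(t, t). A point s with real part t is
    in the Bohr set iff S(t) <= 1/9. For sufficiency, let phi have coefficients a_n and
    norm at most 1, choose p_n of modulus n^{-t} with a_n p_n = |a_n| n^{-t}, and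
    let T be the quadratic form of 1 - M_phi M_phi^*. As b = delta_1 + c * b,
      sum_d c_d T(q(d .)) = T(q) - |q_1|^2 + |sum_n a_n q_n|^2
    for finitely supported q. With q = p - p_1 delta_1, and with the dilates of
    p, it gives T(p(d .)) <= (9/4) d^{-2t} T(delta_1) by downward induction on d,
    and then T(p) >= T(delta_1)/4 >= sum_d c_d T(p(d .)). With q = p it now says
    |sum_n a_n p_n| <= 1. For necessity, g = S(t)^{-1/2} sum_n c_n n^{-t} n^{-s}
    is a contractive multiplier with g(t) = S(t)^{1/2}, and the multiplier
    (a - g)/(1 - a g) violates the Bohr inequality at t if S(t) > 1/9 and a is
    close to 1.

    Finally S <= 1 and c_1 = 0 give S(sigma_a + h) <= 4^{-h}, which is 1/9 for
    h = log 3/log 2, with equality only if c is concentrated at n = 2. *)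
Require Import Defs.
From HB Require Import structures.
From mathcomp Require Import all_boot all_order all_algebra.
From mathcomp Require Import complex.
From mathcomp Require Import all_classical all_reals all_analysis.
From mathcomp Require Import ring lra zify.
Import Order.TTheory GRing.Theory Num.Theory.
Import numFieldNormedType.Exports.
Local Open Scope classical_set_scope.
Local Open Scope ring_scope.

Set Implicit Arguments.
Unset Strict Implicit.
Unset Printing Implicit Defensive.

(** An [rkhs] supplies only the kernel functions; that the monomials lie in the space, are
    orthogonal and give back every coefficient has to be derived. One device serves there and for
    the sign of c_n: combining data at the points s0 + j with the coefficients of a polynomial p
    acts on the n-th coefficient through p(1/n), and powers of 1 - (x - 1/n0)^2 concentrate at x =
    1/n0. The McCullough-Quiggin matrix is taken with base point +oo, where k(., +oo) = 1, so that
    it becomes 1 - 1/k. Before c_n >= 0 is known, the c-series is controlled only far to the right,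
    which is why positivity is tested there; positivity then carries convergence to the whole
    half-plane. Adjoints of multiplication operators are not constructed: their action on kernels or
    coefficients is written down, and Cauchy-Schwarz does the rest. The threshold 1/9 is the square
    of Bohr's radius 1/3, to which g(t) = S(t)^{1/2} is compared. The constant 9/4 is the fixed
    point of B -> 3/2 + B/3, the recursion that T(x + y) <= (1 + 1/u) T(x) + (1 + u) T(y) gives at u
    = 2. *)

Local Notation normc := Normc.normc.

(** * Complex sequences and series *)

Section ComplexNorm.
Variable R : realType.
Local Notation C := R[i].
Implicit Types (x y z : C) (r : R).

Lemma normcE2 z : normc z ^+ 2 = complex.Re z ^+ 2 + complex.Im z ^+ 2.
Proof. by case: z => a b; rewrite sqr_sqrtr // addr_ge0 // sqr_ge0. Qed.

Lemma normc_ge0 z : 0 <= normc z.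
Proof. by case: z => a b; exact: sqrtr_ge0. Qed.

Lemma normc_real r : normc r%:C%C = `|r|.
Proof. by rewrite /= expr0n addr0 sqrtr_sqr. Qed.

Lemma normc_pos r : 0 <= r -> normc r%:C%C = r.
Proof. by move=> r0; rewrite normc_real ger0_norm. Qed.

Lemma normcJ2 z : normc (z^*) = normc z.
Proof. by case: z => a b; rewrite /= sqrrN. Qed.

Lemma mulJc z : z * z^* = (normc z ^+ 2)%:C%C.
Proof.
by rewrite normcE2; case: z => a b; apply/eqP; rewrite eq_complex /=;
  apply/andP; split; apply/eqP; ring.
Qed.

Lemma ler_normcB x y : normc (x - y) <= normc x + normc y.
Proof. by rewrite (le_trans (le_normcD _ _))// normcN. Qed.

Lemma ler_normc_dist x y : normc x - normc y <= normc (x - y).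
Proof. by rewrite lerBlDr; rewrite -{1}(subrK y x) le_normcD. Qed.

Lemma normcBC x y : normc (x - y) = normc (y - x).
Proof. by rewrite -normcN opprB. Qed.

Lemma normc_sum (I : Type) (s : seq I) (P : pred I) (F : I -> C) :
  normc (\sum_(i <- s | P i) F i) <= \sum_(i <- s | P i) normc (F i).
Proof.
elim/big_rec2: _ => [|i y x _ h]; first by rewrite Normc.normc0.
by rewrite (le_trans (le_normcD _ _))// lerD2l.
Qed.

Lemma Re_le_normc z : `|complex.Re z| <= normc z.
Proof.
rewrite -(ler_pXn2r (n := 2)) ?nnegrE ?normc_ge0//.
by rewrite normcE2 real_normK ?num_real// lerDl sqr_ge0.
Qed.

Lemma Im_le_normc z : `|complex.Im z| <= normc z.
Proof.
rewrite -(ler_pXn2r (n := 2)) ?nnegrE ?normc_ge0//.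
by rewrite normcE2 real_normK ?num_real// lerDr sqr_ge0.
Qed.

Lemma normc_le_ReIm z : normc z <= `|complex.Re z| + `|complex.Im z|.
Proof.
rewrite {1}(complexE z) (le_trans (le_normcD _ _))// Normc.normcM !normc_real.
by rewrite /= expr0n expr1n /= add0r sqrtr1 mul1r.
Qed.

Lemma ReD x y : complex.Re (x + y) = complex.Re x + complex.Re y.
Proof. by case: x y => ? ? []. Qed.
Lemma ImD x y : complex.Im (x + y) = complex.Im x + complex.Im y.
Proof. by case: x y => ? ? []. Qed.
Lemma ReN x : complex.Re (- x) = - complex.Re x.
Proof. by case: x. Qed.
Lemma ImN x : complex.Im (- x) = - complex.Im x.
Proof. by case: x. Qed.
Lemma ReB x y : complex.Re (x - y) = complex.Re x - complex.Re y.
Proof. by rewrite ReD ReN. Qed.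
Lemma ReZ r z : complex.Re (r%:C%C * z) = r * complex.Re z.
Proof. by case: z => a b /=; rewrite mul0r subr0. Qed.
Lemma ImZ r z : complex.Im (r%:C%C * z) = r * complex.Im z.
Proof. by case: z => a b /=; rewrite mul0r addr0. Qed.
Lemma ImB x y : complex.Im (x - y) = complex.Im x - complex.Im y.
Proof. by rewrite ImD ImN. Qed.
Lemma ReJ z : complex.Re (z^*) = complex.Re z.
Proof. by case: z. Qed.

Lemma Re_sum (I : Type) (s : seq I) (P : pred I) (F : I -> C) :
  complex.Re (\sum_(i <- s | P i) F i) = \sum_(i <- s | P i) complex.Re (F i).
Proof. by apply: (big_morph _ ReD). Qed.
Lemma Im_sum (I : Type) (s : seq I) (P : pred I) (F : I -> C) :
  complex.Im (\sum_(i <- s | P i) F i) = \sum_(i <- s | P i) complex.Im (F i).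
Proof. by apply: (big_morph _ ImD). Qed.

Lemma realC_sum (I : Type) (s : seq I) (P : pred I) (F : I -> R) :
  (\sum_(i <- s | P i) F i)%:C%C = \sum_(i <- s | P i) (F i)%:C%C.
Proof. exact: rmorph_sum. Qed.

Lemma ge0_real z : 0 <= z -> z = (complex.Re z)%:C%C.
Proof. by case: z => a b; rewrite lecE /= => /andP[/eqP -> _]. Qed.

Lemma conjC_realC r : (r%:C%C)^* = r%:C%C :> C.
Proof. by apply/eqP; rewrite eq_complex /= oppr0 !eqxx. Qed.

End ComplexNorm.

(** Squaring gives [S ^+ 2 <= x ^+ 2 * S], and [S] cancels. In the uses the first bound comes from
    Cauchy-Schwarz and [S] is also a squared norm; this yields Bessel's inequality and the
    contractivity of adjoints. *)
Lemma sqr_le_of_le_mul (R : realType) (S x y : R) : 0 <= S -> 0 <= y -> S <= x * y ->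
  y ^+ 2 <= S -> S <= x ^+ 2.
Proof.
move=> S0 y0 Sxy yS; have [->|S1] := eqVneq S 0; first exact: sqr_ge0.
have Sp : 0 < S by rewrite lt_def S1.
rewrite -(ler_pM2l Sp) -expr2; apply: (@le_trans _ _ ((x * y) ^+ 2)).
  by rewrite lerXn2r ?nnegrE ?(le_trans S0).
by rewrite exprMn mulrC ler_wpM2r// sqr_ge0.
Qed.

Section ComplexLimit.
Variable R : realType.
Local Notation C := R[i].
Implicit Types (u v : nat -> C) (x y z : C).

(** Tolerance and modulus are taken in [R], whereas the norm that [R[i]] carries has its values in
    [R[i]]. *)
Definition Ccvg u z := forall e : R, 0 < e ->
  exists K, forall n, (K <= n)%N -> normc (u n - z) < e.

Lemma Ccvg_unique u x y : Ccvg u x -> Ccvg u y -> x = y.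
Proof.
move=> ux uy; apply/eqP; rewrite -subr_eq0; apply/eqP/Normc.eq0_normc/eqP.
rewrite eq_le normc_ge0 andbT leNgt; apply/negP => d0.
have d2 : 0 < normc (x - y) / 2 by rewrite divr_gt0.
have [K1 h1] := ux _ d2; have [K2 h2] := uy _ d2.
have := h1 _ (leq_maxl K1 K2); have := h2 _ (leq_maxr K1 K2).
set w := u _ => a b.
have : normc (x - y) <= normc (w - y) + normc (w - x).
  by rewrite (_ : x - y = (w - y) - (w - x)); [exact: ler_normcB | ring].
lra.
Qed.

Lemma eq_Ccvg u v z : u =1 v -> Ccvg u z -> Ccvg v z.
Proof. by move=> /funext ->. Qed.

Lemma Ccvg_cst z : Ccvg (fun=> z) z.
Proof. by move=> e e0; exists 0%N => n _; rewrite subrr Normc.normc0. Qed.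

Lemma Ccvg_le u z (v : nat -> R) :
  (forall n, normc (u n - z) <= v n) ->
  (forall e : R, 0 < e -> exists K, forall n, (K <= n)%N -> v n < e) ->
  Ccvg u z.
Proof.
move=> uv v0 e /v0[K hK]; exists K => n /hK; exact: le_lt_trans.
Qed.

Lemma CcvgD u v x y : Ccvg u x -> Ccvg v y -> Ccvg (fun n => u n + v n) (x + y).
Proof.
move=> ux vy e e0; have e2 : 0 < e / 2 by rewrite divr_gt0.
have [K1 h1] := ux _ e2; have [K2 h2] := vy _ e2.
exists (maxn K1 K2) => n; rewrite geq_max => /andP[/h1 a /h2 b].
rewrite opprD addrACA (le_lt_trans (le_normcD _ _))//; lra.
Qed.

Lemma CcvgZ u x z : Ccvg u x -> Ccvg (fun n => z * u n) (z * x).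
Proof.
move=> ux e e0.
have z1 : 0 < normc z + 1 by rewrite ltr_wpDl ?normc_ge0.
have [K h] := ux _ (divr_gt0 e0 z1).
exists K => n /h; rewrite -mulrBr Normc.normcM ltr_pdivlMr// => h'.
apply: le_lt_trans h'; rewrite mulrC ler_wpM2l ?normc_ge0//; lra.
Qed.

Lemma CcvgN u x : Ccvg u x -> Ccvg (fun n => - u n) (- x).
Proof.
by move=> /(CcvgZ (-1)); rewrite mulN1r; apply: eq_Ccvg => n; rewrite mulN1r.
Qed.

Lemma CcvgB u v x y : Ccvg u x -> Ccvg v y -> Ccvg (fun n => u n - v n) (x - y).
Proof. by move=> ux /CcvgN; exact: CcvgD. Qed.

Lemma Ccvg_sum (I : Type) (s : seq I) (F : I -> nat -> C) (f : I -> C) :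
  (forall i, Ccvg (F i) (f i)) ->
  Ccvg (fun n => \sum_(i <- s) F i n) (\sum_(i <- s) f i).
Proof.
move=> h; elim: s => [|i s IH].
  by rewrite big_nil; apply: eq_Ccvg (Ccvg_cst 0) => n; rewrite big_nil.
rewrite big_cons; apply: eq_Ccvg (CcvgD (h i) IH) => n.
by rewrite big_cons.
Qed.

Lemma Ccvg_normc_le u z (M : R) :
  (exists K, forall n, (K <= n)%N -> normc (u n) <= M) -> Ccvg u z -> normc z <= M.
Proof.
move=> [K uM] uz; apply/ler_addgt0Pr => e /uz[K' h].
have := h _ (leq_maxr K K'); have := uM _ (leq_maxl K K').
set w := u _ => a b.
by have := ler_normc_dist z w; rewrite normcBC; lra.
Qed.

Lemma Ccvg_real_le (v : nat -> R) z (M : R) :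
  (exists K, forall n, (K <= n)%N -> v n <= M) -> Ccvg (fun n => (v n)%:C%C) z ->
  complex.Re z <= M.
Proof.
move=> [K vM] vz; apply/ler_addgt0Pr => e /vz[K' h].
have := h _ (leq_maxr K K'); have := vM _ (leq_maxl K K').
set w := v _ => a b.
have := Re_le_normc (w%:C%C - z); rewrite ReB /= ler_norml; lra.
Qed.

Lemma Ccvg_real_ge (v : nat -> R) z (M : R) :
  (exists K, forall n, (K <= n)%N -> M <= v n) -> Ccvg (fun n => (v n)%:C%C) z ->
  M <= complex.Re z.
Proof.
move=> [K vM] vz; apply/ler_addgt0Pr => e /vz[K' h].
have := h _ (leq_maxr K K'); have := vM _ (leq_maxl K K').
set w := v _ => a b.
have := Re_le_normc (w%:C%C - z); rewrite ReB /= ler_norml; lra.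
Qed.

Lemma Ccvg_real (v : nat -> R) z : Ccvg (fun n => (v n)%:C%C) z ->
  z = (complex.Re z)%:C%C.
Proof.
move=> vz; suff: complex.Im z = 0 by case: z {vz} => a b /= ->.
apply/eqP; rewrite -normr_eq0 eq_le normr_ge0 andbT.
apply/ler_addgt0Pr => e /vz[K /(_ _ (leqnn _)) h].
have := Im_le_normc ((v K)%:C%C - z); rewrite ImB /= sub0r normrN; lra.
Qed.

Lemma Ccvg_sub (s : nat -> nat) u z : (forall n, (n <= s n)%N) ->
  Ccvg u z -> Ccvg (fun n => u (s n)) z.
Proof.
by move=> sn uz e /uz[K h]; exists K => n Kn; apply: h; exact: leq_trans (sn n).
Qed.

Lemma Ccvg_near u v z K : (forall n, (K <= n)%N -> u n = v n) -> Ccvg u z -> Ccvg v z.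
Proof.
move=> uv uz e /uz[K' h]; exists (maxn K K') => n.
by rewrite geq_max => /andP[/uv <- /h].
Qed.

Lemma Ccvg_bounded u z : Ccvg u z -> exists M, forall n, normc (u n) <= M.
Proof.
move=> /(_ 1 ltr01)[K h].
exists (normc z + 1 + \sum_(i < K) normc (u i)) => n.
case: (leqP K n) => nK.
  have := ler_normc_dist (u n) z; have := h _ nK.
  have : 0 <= \sum_(i < K) normc (u i) by apply: sumr_ge0 => i _; exact: normc_ge0.
  lra.
rewrite (bigD1 (Ordinal nK))//= addrCA lerDl.
by rewrite !addr_ge0 ?normc_ge0// sumr_ge0// => i _; exact: normc_ge0.
Qed.

Lemma CcvgM u v x y : Ccvg u x -> Ccvg v y -> Ccvg (fun n => u n * v n) (x * y).
Proof.
move=> ux vy; have [M hM] := Ccvg_bounded ux.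
have M0 : 0 <= M := le_trans (normc_ge0 _) (hM 0%N).
have h1 : Ccvg (fun n => u n * (v n - y)) 0.
  move=> e e0; have M1 : 0 < M + 1 by lra.
  have [K h] := vy _ (divr_gt0 e0 M1).
  exists K => n /h; rewrite subr0 Normc.normcM ltr_pdivlMr// => h'.
  apply: le_lt_trans h'; rewrite mulrC ler_wpM2l ?normc_ge0//.
  by rewrite (le_trans (hM n))//; lra.
have := CcvgD h1 (CcvgZ y ux); rewrite add0r (mulrC y).
by apply: eq_Ccvg => n; ring.
Qed.

End ComplexLimit.

Section NonnegSeries.
Variable R : realType.
Implicit Types (u : nat -> R) (a : nat -> R[i]).

Lemma nonneg_sum_le u m n : (forall i, 0 <= u i) -> (m <= n)%N ->
  \sum_(i < m) u i <= \sum_(i < n) u i.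
Proof.
move=> u0 mn; rewrite -(subnKC mn) big_split_ord /= lerDl.
by apply: sumr_ge0 => i _.
Qed.

Lemma nonneg_sum_cauchy u (A : R) : (forall i, 0 <= u i) ->
  (forall n, \sum_(i < n) u i <= A) ->
  forall e, 0 < e -> exists K, forall m n, (K <= m <= n)%N ->
    \sum_(i < n) u i - \sum_(i < m) u i < e.
Proof.
move=> u0 uA e e0; pose E := [set \sum_(i < n) u i | n in [set: nat]].
have hE : has_sup E.
  split; first by exists (\sum_(i < 0) u i), 0%N.
  by exists A => _ [n _ <-].
have [_ [K _ <-] hK] := sup_adherent e0 hE.
exists K => m n /andP[Km mn].
have h1 : \sum_(i < n) u i <= sup E by apply: ub_le_sup; [case: hE | exists n].
have := nonneg_sum_le u0 Km; lra.
Qed.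

Lemma abs_sum_Ccvg a (A : R) : (forall n, \sum_(i < n) normc (a i) <= A) ->
  exists z, Ccvg (fun n => \sum_(i < n) a i) z.
Proof.
move=> aA.
have cvgs (f : nat -> R) : (forall i, `|f i| <= normc (a i)) ->
    cvgn (fun n => \sum_(i < n) f i).
  move=> fa; have -> : (fun n => \sum_(i < n) f i) = series f.
    by apply/funext => n; rewrite seriesEord.
  apply: normed_cvg; apply: nondecreasing_is_cvgn.
    by apply: nondecreasing_series => n _ _; exact: normr_ge0.
  exists A => _ [n _ <-]; rewrite /normed_series_of /series /= big_mkord.
  by apply: le_trans (aA n); apply: ler_sum => i _; exact: fa.
have /cvg_ex[x /= hx] : cvgn (fun n => \sum_(i < n) complex.Re (a i)).
  exact: (cvgs (fun i => complex.Re (a i)) (fun i => Re_le_normc _)).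
have /cvg_ex[y /= hy] : cvgn (fun n => \sum_(i < n) complex.Im (a i)).
  exact: (cvgs (fun i => complex.Im (a i)) (fun i => Im_le_normc _)).
exists (Complex x y) => e e0; have e2 : 0 < e / 2 by rewrite divr_gt0.
move/cvgrPdist_lt: hx => /(_ _ e2)[K1 _ h1].
move/cvgrPdist_lt: hy => /(_ _ e2)[K2 _ h2].
exists (maxn K1 K2) => n; rewrite geq_max => /andP[/h1/= a1 /h2/= a2].
rewrite (le_lt_trans (normc_le_ReIm _))// ReB ImB Re_sum Im_sum /=.
by rewrite distrC (distrC _ y); lra.
Qed.

(** [csum] is built from [limn], which has a default value without convergence; the [Ccvg]
    hypothesis excludes that case. *)
Lemma csumP (N : set nat) a z :
  Ccvg (fun M => \sum_(n < M) (if (n : nat) \in N then a n else 0)) z ->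
  csum N a = z.
Proof.
move=> h; rewrite /csum.
have eqS M : \sum_(0 <= n < M | n \in N) a n =
    \sum_(n < M) (if (n : nat) \in N then a n else 0).
  by rewrite big_mkcond big_mkord.
case: z h => x y h; congr Complex; apply: cvg_lim => //;
  apply/cvgrPdist_lt => e /h[K hK]; exists K => // n /hK.
  apply: le_lt_trans; rewrite eqS distrC.
  set w := \sum_(_ < _) _.
  by have := Re_le_normc (w - Complex x y); rewrite ReB.
apply: le_lt_trans; rewrite eqS distrC.
set w := \sum_(_ < _) _.
by have := Im_le_normc (w - Complex x y); rewrite ImB.
Qed.

Lemma nneseries_le_bound (N : set nat) u (A : R) : (forall n, N n -> 0 <= u n) ->
  ((\sum_(0 <= n <oo | n \in N) (u n)%:E <= A%:E)%E <->
   forall M, \sum_(n < M) (if (n : nat) \in N then u n else 0) <= A).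
Proof.
move=> u0; have v0 n : 0 <= if n \in N then u n else 0.
  by case: ifPn => // /set_mem /u0.
have eqS M : (\sum_(0 <= n < M | n \in N) (u n)%:E =
    (\sum_(n < M) (if (n : nat) \in N then u n else 0))%:E)%E.
  by rewrite sumEFin big_mkcond big_mkord.
split=> [h M|h].
  rewrite -lee_fin -eqS; apply: le_trans h.
  by apply: nneseries_lim_ge => k _ /set_mem /u0; rewrite lee_fin.
apply: lime_le.
  by apply: is_cvg_nneseries => k _ /set_mem /u0; rewrite lee_fin.
by apply: nearW => M; rewrite eqS lee_fin.
Qed.

Lemma nneseries_lt_pinfty (N : set nat) u : (forall n, N n -> 0 <= u n) ->
  ((\sum_(0 <= n <oo | n \in N) (u n)%:E < +oo)%E <->
   exists A, forall M, \sum_(n < M) (if (n : nat) \in N then u n else 0) <= A).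
Proof.
move=> u0; split=> [h|[A h]].
  have h0 : (0 <= \sum_(0 <= n <oo | n \in N) (u n)%:E)%E.
    by apply: nneseries_ge0 => k _ /set_mem /u0; rewrite lee_fin.
  exists (fine (\sum_(0 <= n <oo | n \in N) (u n)%:E)%E).
  by apply/(nneseries_le_bound _ u0); rewrite fineK// ge0_fin_numE.
by apply: (le_lt_trans ((nneseries_le_bound A u0).2 h)); rewrite ltry.
Qed.

End NonnegSeries.

(** * Reproducing kernel Hilbert spaces *)

Section HilbertFunctionSpace.
Variables (R : realType) (T : Type).
Local Notation C := R[i].
Variables (k : T -> T -> C) (H : rkhs k).
Implicit Types (f g h : T -> C) (a t : C).
Local Notation mem := (rkhs_mem H).
Local Notation dot := (rkhs_dot H).
Local Notation hnorm := (hnorm H).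

Lemma memD f g : mem f -> mem g -> mem (fun x => f x + g x).
Proof.
move=> hf hg; have := rkhs_memP 1 hf hg; congr (mem _).
by apply/funext => x; rewrite mul1r.
Qed.

Lemma memZ a f : mem f -> mem (fun x => a * f x).
Proof.
move=> hf; have := rkhs_memP a hf (rkhs_mem0 H); congr (mem _).
by apply/funext => x; rewrite addr0.
Qed.

Lemma memB f g : mem f -> mem g -> mem (fun x => f x - g x).
Proof.
move=> hf hg; have := memD hf (memZ (-1) hg); congr (mem _).
by apply/funext => x; rewrite mulN1r.
Qed.

Lemma mem_sum (I : Type) (s : seq I) (P : pred I) (a : I -> C) (F : I -> T -> C) :
  (forall i, P i -> mem (F i)) -> mem (fun x => \sum_(i <- s | P i) a i * F i x).
Proof.
move=> hF; elim: s => [|i s IH].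
  by have := rkhs_mem0 H; congr (mem _); apply/funext => x; rewrite big_nil.
have [Pi|/negbTE nPi] := boolP (P i).
  have := rkhs_memP (a i) (hF _ Pi) IH; congr (mem _).
  by apply/funext => x; rewrite big_cons Pi.
by move: IH; congr (mem _); apply/funext => x; rewrite big_cons nPi.
Qed.

Lemma dotZl a f g : mem f -> mem g -> dot (fun x => a * f x) g = a * dot f g.
Proof.
move=> hf hg.
have h0 : dot (fun=> 0) g = 0.
  have := rkhs_dotP 1 (rkhs_mem0 H) (rkhs_mem0 H) hg; rewrite !mul1r addr0.
  by move/eqP; rewrite -subr_eq subrr => /eqP.
have := rkhs_dotP a hf (rkhs_mem0 H) hg; rewrite h0 addr0 => <-.
by congr (dot _ _); apply/funext => x; rewrite addr0.
Qed.

Lemma dot0l g : mem g -> dot (fun=> 0) g = 0.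
Proof.
move=> hg; rewrite -[RHS](mul0r (dot (fun=> 0) g)) -dotZl//; last exact: rkhs_mem0.
by congr (dot _ _); apply/funext => x; rewrite mul0r.
Qed.

Lemma dotDl f g h : mem f -> mem g -> mem h ->
  dot (fun x => f x + g x) h = dot f h + dot g h.
Proof.
move=> hf hg hh; rewrite -[dot f h]mul1r -rkhs_dotP//.
by congr (dot _ _); apply/funext => x; rewrite mul1r.
Qed.

Lemma dotBl f g h : mem f -> mem g -> mem h ->
  dot (fun x => f x - g x) h = dot f h - dot g h.
Proof.
move=> hf hg hh; rewrite -mulN1r addrC -rkhs_dotP//.
by congr (dot _ _); apply/funext => x; rewrite mulN1r addrC.
Qed.

Lemma dotZr a f g : mem f -> mem g -> dot f (fun x => a * g x) = a^* * dot f g.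
Proof.
move=> hf hg; have hag := memZ a hg.
by rewrite (rkhs_dotC hag hf) dotZl// rmorphM /= -(rkhs_dotC hg hf).
Qed.

Lemma dotDr f g h : mem f -> mem g -> mem h ->
  dot h (fun x => f x + g x) = dot h f + dot h g.
Proof.
move=> hf hg hh; have hfg := memD hf hg.
rewrite (rkhs_dotC hfg hh) dotDl// rmorphD /=.
by rewrite -(rkhs_dotC hf hh) -(rkhs_dotC hg hh).
Qed.

Lemma dotBr f g h : mem f -> mem g -> mem h ->
  dot h (fun x => f x - g x) = dot h f - dot h g.
Proof.
move=> hf hg hh; have hfg := memB hf hg.
rewrite (rkhs_dotC hfg hh) dotBl// rmorphB /=.
by rewrite -(rkhs_dotC hf hh) -(rkhs_dotC hg hh).
Qed.

Lemma dot_suml (I : Type) (s : seq I) (P : pred I) (a : I -> C) (F : I -> T -> C) g :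
  (forall i, P i -> mem (F i)) -> mem g ->
  dot (fun x => \sum_(i <- s | P i) a i * F i x) g =
  \sum_(i <- s | P i) a i * dot (F i) g.
Proof.
move=> hF hg; elim: s => [|i s IH].
  rewrite [RHS]big_nil -[RHS](dot0l hg); congr (rkhs_dot H _ _).
  by apply/funext => x; rewrite big_nil.
rewrite big_cons; have [Pi|/negbTE nPi] := boolP (P i).
  have hs := mem_sum s a hF.
  rewrite -IH -(rkhs_dotP (a i) (hF _ Pi) hs hg); congr (dot _ _).
  by apply/funext => x; rewrite big_cons Pi.
by rewrite -IH; congr (dot _ _); apply/funext => x; rewrite big_cons nPi.
Qed.

Lemma dot_sumr (I : Type) (s : seq I) (P : pred I) (a : I -> C) (F : I -> T -> C) g :
  (forall i, P i -> mem (F i)) -> mem g ->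
  dot g (fun x => \sum_(i <- s | P i) a i * F i x) =
  \sum_(i <- s | P i) (a i)^* * dot g (F i).
Proof.
move=> hF hg; rewrite (rkhs_dotC (mem_sum s a hF) hg) dot_suml// rmorph_sum.
by apply: eq_bigr => i /hF hi; rewrite rmorphM /= -(rkhs_dotC hi hg).
Qed.

Lemma dot_ge0 f : mem f -> 0 <= dot f f.
Proof.
move=> hf; have [->|f0] := pselect (f = (fun=> 0)).
  by rewrite dot0l//; exact: rkhs_mem0.
exact/ltW/rkhs_dot_gt0.
Qed.

Lemma hnorm_ge0 f : 0 <= hnorm f.
Proof. exact: sqrtr_ge0. Qed.

Lemma hnormE f : mem f -> dot f f = (hnorm f ^+ 2)%:C%C.
Proof.
move=> /dot_ge0 h; rewrite [LHS]ge0_real//; congr (_%:C%C).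
by rewrite sqr_sqrtr// -ler0c -ge0_real.
Qed.

Lemma hnorm_sqr f : mem f -> hnorm f ^+ 2 = complex.Re (dot f f).
Proof. by move=> /hnormE ->. Qed.

Lemma hnorm_eq0 f : mem f -> hnorm f = 0 -> f = (fun=> 0).
Proof.
move=> hf h0; apply: contrapT => f0.
by have := rkhs_dot_gt0 hf f0; rewrite hnormE// h0 expr0n /= ltxx.
Qed.

Lemma hnorm0 : hnorm (fun=> 0) = 0.
Proof. by rewrite /Defs.hnorm dot0l ?sqrtr0//; exact: rkhs_mem0. Qed.

Lemma hnormZ a f : mem f -> hnorm (fun x => a * f x) = normc a * hnorm f.
Proof.
move=> hf; have haf := memZ a hf.
apply/eqP; rewrite -(eqrXn2 (n := 2)) ?mulr_ge0 ?hnorm_ge0 ?normc_ge0//.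
apply/eqP/(@complexI R); rewrite -hnormE// dotZl// dotZr// mulrA mulJc.
by rewrite hnormE// -rmorphM exprMn.
Qed.

Lemma hnorm_opp f : mem f -> hnorm (fun x => - f x) = hnorm f.
Proof.
move=> hf; have := hnormZ (-1) hf; rewrite normcN Normc.normc1 mul1r => <-.
by congr hnorm; apply/funext => x; rewrite mulN1r.
Qed.

Lemma hnormBC f g : mem f -> mem g ->
  hnorm (fun x => f x - g x) = hnorm (fun x => g x - f x).
Proof.
move=> hf hg; rewrite -hnorm_opp; last exact: memB.
by congr hnorm; apply/funext => x; rewrite opprB.
Qed.

Lemma cauchy_schwarz f g : mem f -> mem g -> normc (dot f g) <= hnorm f * hnorm g.
Proof.
move=> hf hg; have [g0|g0] := eqVneq (hnorm g) 0.
  rewrite (hnorm_eq0 hg g0) (rkhs_dotC (rkhs_mem0 H) hf) dot0l// rmorph0.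
  by rewrite Normc.normc0 hnorm0 mulr0.
pose B := hnorm g ^+ 2; have B0 : 0 < B by rewrite exprn_gt0// lt_def g0 hnorm_ge0.
set d := dot f g.
pose u : T -> C := fun x => f x - (d / B%:C%C) * g x.
have hag := memZ (d / B%:C%C) hg.
have hu : mem u by exact: memB.
have bj : (d / B%:C%C)^* = d^* / B%:C%C.
  by rewrite rmorphM fmorphV /= conjC_realC.
have e : dot u u = (hnorm f ^+ 2 - normc d ^+ 2 / B)%:C%C.
  rewrite /u dotBl ?dotBr// ?dotZl// ?dotZr// ?hnormE// -/B bj.
  rewrite (rkhs_dotC hf hg) -/d.
  transitivity ((hnorm f ^+ 2)%:C%C - d * d^* / B%:C%C); last first.
    by rewrite mulJc -fmorphV -rmorphM -rmorphB.
  have : B%:C%C != 0 :> C by rewrite eq_complex /= eqxx andbT gt_eqF.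
  by set b : C := B%:C%C => b0; field.
have : (hnorm u ^+ 2)%:C%C = (hnorm f ^+ 2 - normc d ^+ 2 / B)%:C%C :> C.
  by rewrite -e hnormE.
move/complexI => e2.
have : 0 <= hnorm f ^+ 2 - normc d ^+ 2 / B by rewrite -e2 sqr_ge0.
rewrite subr_ge0 ler_pdivrMr// /B -exprMn ler_pXn2r ?nnegrE ?mulr_ge0 ?hnorm_ge0//.
exact: normc_ge0.
Qed.

Lemma ler_hnormD f g : mem f -> mem g ->
  hnorm (fun x => f x + g x) <= hnorm f + hnorm g.
Proof.
move=> hf hg; have hfg := memD hf hg.
rewrite -(ler_pXn2r (n := 2)) ?nnegrE ?addr_ge0 ?hnorm_ge0//.
rewrite hnorm_sqr// dotDl// !dotDr// !ReD -!hnorm_sqr// (rkhs_dotC hf hg) ReJ.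
have := cauchy_schwarz hf hg; have := Re_le_normc (dot f g); rewrite ler_norml.
rewrite sqrrD; lra.
Qed.

Lemma ler_hnormB f g : mem f -> mem g ->
  hnorm (fun x => f x - g x) <= hnorm f + hnorm g.
Proof.
move=> hf hg; have hg1 := memZ (-1) hg.
have := ler_hnormD hf hg1; rewrite hnormZ// normcN Normc.normc1 mul1r.
by congr (hnorm _ <= _); apply/funext => x; rewrite mulN1r.
Qed.

Lemma eval_le f w : mem f -> normc (f w) <= hnorm f * hnorm (k^~ w).
Proof.
move=> hf; rewrite -(rkhs_reproducing w hf).
by apply: cauchy_schwarz => //; exact: rkhs_kernel.
Qed.

Definition hcvg (u : nat -> T -> C) f := forall e : R, 0 < e ->
  exists K, forall n, (K <= n)%N -> hnorm (fun x => u n x - f x) < e.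

Lemma hcauchy_cvg (u : nat -> T -> C) : (forall n, mem (u n)) ->
  (forall e : R, 0 < e -> exists K, forall m n, (K <= m <= n)%N ->
     hnorm (fun x => u n x - u m x) < e) ->
  exists2 f, mem f & hcvg u f.
Proof.
move=> hu hc; apply: (rkhs_complete hu) => e /hc[K hK].
exists K => m n Km Kn; change (hnorm (fun x => u m x - u n x) < e).
have [mn|/ltnW nm] := leqP m n; last by apply: hK; rewrite Kn.
by rewrite hnormBC//; apply: hK; rewrite Km.
Qed.

Lemma hcvg_eval (u : nat -> T -> C) f w : (forall n, mem (u n)) -> mem f ->
  hcvg u f -> Ccvg (fun n => u n w) (f w).
Proof.
move=> hu hf uf e e0.
have w1 : 0 < hnorm (k^~ w) + 1 by rewrite ltr_wpDl ?hnorm_ge0.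
have [K h] := uf _ (divr_gt0 e0 w1); exists K => n /h.
rewrite ltr_pdivlMr//; apply: le_lt_trans.
have := eval_le w (memB (hu n) hf); move/le_trans; apply.
by rewrite ler_wpM2l ?hnorm_ge0//; lra.
Qed.

Lemma hcvg_dot (u : nat -> T -> C) f g : (forall n, mem (u n)) -> mem f -> mem g ->
  hcvg u f -> Ccvg (fun n => dot g (u n)) (dot g f).
Proof.
move=> hu hf hg uf e e0.
have w1 : 0 < hnorm g + 1 by rewrite ltr_wpDl ?hnorm_ge0.
have [K h] := uf _ (divr_gt0 e0 w1); exists K => n /h.
rewrite ltr_pdivlMr//; apply: le_lt_trans.
have hd := memB (hu n) hf.
rewrite -dotBr//; have := cauchy_schwarz hg hd; move/le_trans; apply.
by rewrite mulrC ler_wpM2l ?hnorm_ge0//; lra.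
Qed.

Lemma hcvg_norm_le (u : nat -> T -> C) f (M : R) :
  (forall n, mem (u n)) -> mem f -> hcvg u f ->
  (forall n, hnorm (u n) <= M) -> hnorm f <= M.
Proof.
move=> hu hf uf hM; apply/ler_addgt0Pr => e /uf[K /(_ _ (leqnn _)) h].
have := ler_hnormB (hu K) (memB (hu K) hf); have := hM K.
rewrite (_ : (fun x => u K x - (u K x - f x)) = f); first by lra.
by apply/funext => x; rewrite opprB addrC subrK.
Qed.

Lemma kernelC x y : k x y = (k y x)^*.
Proof.
have hk z : mem (k^~ z) by exact: rkhs_kernel.
rewrite -(rkhs_reproducing x (hk y)) -(rkhs_reproducing y (hk x)).
exact: rkhs_dotC.
Qed.

Lemma kernel_psd (I : Type) (s : seq I) (P : pred I) (v : I -> C) (x : I -> T) :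
  0 <= \sum_(i <- s | P i) \sum_(j <- s | P j) (v i)^* * k (x i) (x j) * v j.
Proof.
have hk i : P i -> mem (k^~ (x i)) by move=> _; exact: rkhs_kernel.
have hf := mem_sum s v hk.
have := dot_ge0 hf; rewrite dot_sumr//; congr (0 <= _).
apply: eq_bigr => i _; rewrite rkhs_reproducing// mulr_sumr.
by apply: eq_bigr => j _; rewrite -mulrA (mulrC (k _ _)).
Qed.

Lemma kernel_diag_ge0 x : 0 <= k x x.
Proof.
have := kernel_psd [:: tt] xpredT (fun=> 1) (fun=> x).
by rewrite !big_seq1 rmorph1 mul1r mulr1.
Qed.

(** A multiplier has some bound, so the infimum in [mult_norm] is not over the empty set. *)
Lemma mult_normP phi (c : R) : multiplier H phi ->
  (forall d, mult_bound H phi d -> c <= d) -> c <= mult_norm H phi.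
Proof.
move=> [_ [d hd]] h; apply: lb_le_inf; first by exists d.
by move=> x /h.
Qed.

Lemma mult_norm_le phi (d : R) : mult_bound H phi d -> mult_norm H phi <= d.
Proof.
by move=> hd; apply: ge_inf => //; exists 0 => x [].
Qed.

End HilbertFunctionSpace.

(** * Necessity in the McCullough-Quiggin theorem *)

Section McCulloughQuiggin.
Variable R : realType.
Local Notation C := R[i].

(** Spectral theorem: A = P^* D P with P unitary and D >= 0, and G = P^* D^{1/2}. *)
Lemma psd_gram n (A : 'M[C]_n) : (forall i j, A i j = (A j i)^*) ->
  (forall v : 'I_n -> C, 0 <= \sum_i \sum_j (v i)^* * A i j * v j) ->
  exists G : 'I_n -> 'I_n -> C, forall i j, A i j = \sum_l G i l * (G j l)^*.
Proof.
move=> hA psd.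
have herm : A \is hermsymmx.
  apply/is_hermitianmxP; rewrite expr0 scale1r; apply/matrixP => i j.
  by rewrite !mxE hA.
have eA := orthomx_spectralP (hermitian_normalmx herm).
set P := spectralmx A in eA; set D := spectral_diag A in eA.
have PU : P \is unitarymx by exact: spectral_unitarymx.
have PPh : P *m map_mx Num.Def.conjC P^T = 1%:M by apply/unitarymxP.
rewrite invmx_unitary// in eA.
have eD : diag_mx D = P *m A *m map_mx Num.Def.conjC P^T.
  by rewrite {1}eA !mulmxA PPh mul1mx -mulmxA PPh mulmx1.
(* The conjugate of row l of [P] is an eigenvector, and the form takes the value D_l on it. *)
have D0 l : 0 <= D 0 l.
  have := psd (fun i => (P l i)^*); congr (0 <= _).
  move/matrixP/(_ l l): eD; rewrite !mxE eqxx mulr1n => ->.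
  under [RHS]eq_bigr => i _ do rewrite !mxE mulr_suml.
  rewrite exchange_big /=; apply: eq_bigr => i _; apply: eq_bigr => j _.
  by rewrite conjCK.
exists (fun i l => (P l i)^* * sqrtC (D 0 l)) => i j.
rewrite {1}eA !mxE; apply: eq_bigr => l _.
rewrite !mxE (bigD1 l)//= !mxE eqxx mulr1n big1 ?addr0; last first.
  by move=> p pl; rewrite !mxE (negbTE pl) mulr0n mulr0.
rewrite rmorphM /= conjCK.
have -> : (sqrtC (D 0 l))^* = sqrtC (D 0 l).
  by apply/conj_Creal/ger0_real; rewrite sqrtC_ge0.
by rewrite -[in LHS](sqrtCK (D 0 l)); ring.
Qed.

Variables (T : Type) (k : T -> T -> C) (H : rkhs k).
Local Notation mem := (rkhs_mem H).
Local Notation dot := (rkhs_dot H).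
Local Notation hnorm := (hnorm H).

Definition kernel_off (y w : T) : T -> C :=
  fun x => k x w - k y w / k y y * k x y.

Lemma kernel_off_mem y w : mem (kernel_off y w).
Proof. by apply: memB; [|apply: memZ]; exact: rkhs_kernel. Qed.

Lemma kernel_off_base y w : k y y != 0 -> kernel_off y w y = 0.
Proof. by move=> y0; rewrite /kernel_off divfK// subrr. Qed.

Lemma dot_kernel_off y w f : mem f -> f y = 0 -> dot f (kernel_off y w) = f w.
Proof.
move=> hf fy; have hk z : mem (k^~ z) by exact: rkhs_kernel.
rewrite /kernel_off dotBr//; last exact: memZ.
by rewrite dotZr// !rkhs_reproducing// fy mulr0 subr0.
Qed.

(* A contractive multiplier preserves the subspace of functions vanishing at
   [y], whose kernel is [kernel_off y]. *)
Lemma contraction_kernel_off m (Phi : T -> 'M[C]_m.+1) :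
  (forall i j, multiplier H (fun x => Phi x i j)) -> mx_mult_contraction H Phi ->
  forall (y : T), k y y != 0 -> forall n (x : 'I_n -> T) (v : 'I_n -> C),
  0 <= \sum_i \sum_j (v i)^* * v j *
    (kernel_off y (x j) (x i) *
      (1 - \sum_l Phi (x i) 0 l * (Phi (x j) 0 l)^*)).
Proof.
move=> hPhi hc y y0 n x v.
have hk w : mem (kernel_off y w) by exact: kernel_off_mem.
pose f : T -> C := fun z => \sum_i v i * kernel_off y (x i) z.
have hf : mem f by apply: mem_sum => i _.
(* [F] is the adjoint of row 0 of [Phi] applied to [f]: it multiplies the kernel function at w by
   the conjugate entries at w. [M] is the row applied to [F], so [Z] is both the squared norm of [F]
   and the inner product of [M] with [f]. *)
pose F (l : 'I_m.+1) : T -> C :=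
  fun z => \sum_i (v i * (Phi (x i) 0 l)^*) * kernel_off y (x i) z.
have hF l : mem (F l) by apply: mem_sum => i _.
have Fy l : F l y = 0.
  by rewrite /F big1// => i _; rewrite kernel_off_base// mulr0.
have fy : f y = 0 by rewrite /f big1// => i _; rewrite kernel_off_base// mulr0.
pose M : T -> C := fun z => \sum_l Phi z 0 l * F l z.
have hM : mem M.
  have hl (l : 'I_m.+1) : true -> mem (fun z => Phi z 0 l * F l z).
    by move=> _; have [+ _] := hPhi 0 l; apply.
  have := mem_sum (index_enum 'I_m.+1) (fun=> 1) hl; congr (mem _).
  by apply/funext => z; apply: eq_bigr => l _; rewrite mul1r.
have My : M y = 0 by rewrite /M big1// => l _; rewrite Fy mulr0.
have dotg g : mem g -> g y = 0 -> dot g f = \sum_i (v i)^* * g (x i).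
  move=> hg gy; rewrite dot_sumr//; apply: eq_bigr => i _.
  by rewrite dot_kernel_off.
pose Z := \sum_l hnorm (F l) ^+ 2.
have Z0 : 0 <= Z by apply: sumr_ge0 => l _; exact: sqr_ge0.
have ZE : Z%:C%C = \sum_i (v i)^* * M (x i).
  rewrite realC_sum /M; under [RHS]eq_bigr => i _ do rewrite mulr_sumr.
  rewrite exchange_big /=; apply: eq_bigr => l _; rewrite -hnormE//.
  rewrite [X in dot _ X]/F dot_sumr//; apply: eq_bigr => i _.
  by rewrite dot_kernel_off// rmorphM /= conjCK mulrA.
(* The other rows of [Phi] only add squares on the smaller side of the contraction inequality. *)
have hMF : hnorm M ^+ 2 <= Z.
  apply: le_trans (hc F hF); rewrite (bigD1 ord0)//= lerDl.
  by apply: sumr_ge0 => l _; exact: sqr_ge0.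
have cs : Z <= hnorm M * hnorm f.
  have := cauchy_schwarz hM hf; rewrite dotg// -ZE normc_real ger0_norm//.
have Zf : Z <= hnorm f ^+ 2.
  by apply: (@sqr_le_of_le_mul _ _ _ (hnorm M)); rewrite ?hnorm_ge0// mulrC.
have : 0 <= (hnorm f ^+ 2 - Z)%:C%C :> C by rewrite ler0c subr_ge0.
rewrite rmorphB /= -hnormE// dotg// ZE -sumrB; congr (0 <= _).
apply: eq_bigr => i _; rewrite -mulrBr /f /M /F.
under [X in _ - X]eq_bigr => l _ do rewrite mulr_sumr.
rewrite exchange_big /= -sumrB mulr_sumr; apply: eq_bigr => j _.
rewrite -mulrA; congr (_ * _).
rewrite mulrA [RHS]mulrBr mulr1; congr (_ - _).
by rewrite mulr_sumr; apply: eq_bigr => l _; ring.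
Qed.

(** The Pick property interpolates square matrices, so the row G_i is put in row [i0] of a matrix
    that vanishes elsewhere. The form splits by coordinate: [i0] carries a rank-one matrix, every
    other coordinate the positive kernel matrix. *)
Lemma block_psd_rank_one n (x : 'I_n -> T) (G : 'I_n -> 'I_n -> C)
    (a : 'I_n -> C) (W : 'I_n -> 'M[C]_n) (i0 : 'I_n) :
  (forall i, W i = \matrix_(p, q) (if p == i0 then G i q else 0)) ->
  (forall i j, k (x i) (x j) * (1 - \sum_l G i l * (G j l)^*) = a i * (a j)^*) ->
  block_psd (fun i j => k (x i) (x j) *: (1%:M - W i *m adjmx (W j))).
Proof.
move=> hW ha v.
have e i j : (adjmx (v i) *m (k (x i) (x j) *: (1%:M - W i *m adjmx (W j)))
     *m v j) 0 0 =
    \sum_p (v i p 0)^* * v j p 0 *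
      (if p == i0 then a i * (a j)^* else k (x i) (x j)).
  rewrite -mulmxA !mxE; apply: eq_bigr => p _.
  rewrite !mxE -mulrA; congr (_ * _).
  under eq_bigr => q _.
    rewrite !mxE hW.
    under eq_bigr => l _ do rewrite !mxE hW !mxE.
    over.
  rewrite (bigD1 p)//= eqxx [X in _ + X = _]big1 ?addr0; last first.
    move=> q qp; rewrite eq_sym (negbTE qp) sub0r big1 ?oppr0 ?mulr0 ?mul0r//.
    move=> l _; case: ifPn => [/eqP pi|_]; last by rewrite mul0r.
    by rewrite ifN ?conjC0 ?mulr0// -pi.
  rewrite mulrC; congr (_ * _); case: ifPn => _; first by rewrite -ha.
  by rewrite big1 ?subr0 ?mulr1// => l _; rewrite mul0r.
rewrite summxE; under eq_bigr => i _.
  rewrite summxE; under eq_bigr => j _ do rewrite e.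
  rewrite exchange_big /=.
  over.
rewrite exchange_big /=; apply: sumr_ge0 => p _; have [_|_] := eqVneq p i0.
  have -> : \sum_i \sum_j (v i p 0)^* * v j p 0 * (a i * (a j)^*) =
      (\sum_i (v i p 0)^* * a i) * (\sum_i (v i p 0)^* * a i)^*.
    rewrite rmorph_sum mulr_suml; apply: eq_bigr => i _.
    rewrite mulr_sumr; apply: eq_bigr => j _.
    by rewrite rmorphM /= conjCK; ring.
  exact: mul_conjC_ge0.
have := kernel_psd H (index_enum 'I_n) xpredT (fun i => v i p 0) x.
congr (0 <= _); apply: eq_bigr => i _; apply: eq_bigr => j _; ring.
Qed.

(* Induction on the number of points. With one of the points [z] as the base,
   the matrix is positive by induction, hence the Gram matrix of some rows [G_i].
   Interpolating the [G_i] is solvable, because the Pick matrix then has rank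
   one, and the solution contracts the functions vanishing at the base [y]. *)
Theorem mccullough_quiggin (Y : T -> Prop) : complete_pick H ->
  (forall x y, Y x -> Y y -> k x y != 0) ->
  forall n (y : T) (x : 'I_n -> T), Y y -> (forall i, Y (x i)) ->
  forall v : 'I_n -> C,
  0 <= \sum_i \sum_j (v i)^* *
    (1 - k (x i) y * k y (x j) / (k (x i) (x j) * k y y)) * v j.
Proof.
move=> pick k0; elim=> [|n IH] y x Yy Yx v; first by rewrite big_ord0.
pose z := x ord_max.
have Yz : Y z by exact: Yx.
pose A : 'M[C]_n.+1 := \matrix_(i, j)
  (1 - k (x i) z * k z (x j) / (k (x i) (x j) * k z z)).
have [|w|G hG] := @psd_gram _ A.
- move=> i j; rewrite !mxE rmorphB rmorph1 fmorph_div !rmorphM /=.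
  by rewrite -!(kernelC H); congr (1 - _ / _); exact: mulrC.
(* Since [z] is both the base and the last point, the last row and column of [A] vanish, which
   leaves the n points of the induction hypothesis. *)
- have := IH z (fun i => x (widen_ord (leqnSn n) i)) Yz (fun i => Yx _)
    (fun i => w (widen_ord (leqnSn n) i)).
  have Amax i : A i ord_max = 0.
    by rewrite mxE -/z divff ?subrr// mulf_neq0// k0.
  have maxA j : A ord_max j = 0.
    by rewrite mxE -/z (mulrC (k z z)) divff ?subrr// mulf_neq0// k0.
  rewrite big_ord_recr /= [X in _ -> 0 <= _ + X]big1 ?addr0; last first.
    by move=> j _; rewrite maxA mulr0 mul0r.
  congr (0 <= _); apply: eq_bigr => i _.
  rewrite big_ord_recr /= Amax mulr0 mul0r addr0.
  by apply: eq_bigr => j _; rewrite mxE.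
(* The factor k(x_i, x_j) cancels the same factor in the denominator of 1 - A_ij, which leaves rank
   one; k(z, z) is shared evenly through its square root. *)
have hA i j : k (x i) (x j) * (1 - \sum_l G i l * (G j l)^*) =
    k (x i) z / sqrtC (k z z) * (k (x j) z / sqrtC (k z z))^*.
  rewrite -hG mxE opprB addrC subrK.
  have kzz : 0 <= k z z by exact: (kernel_diag_ge0 H).
  rewrite rmorphM /= -(kernelC H) fmorphV /=.
  have -> : (sqrtC (k z z))^* = sqrtC (k z z).
    by apply/conj_Creal/ger0_real; rewrite sqrtC_ge0.
  rewrite mulf_div -expr2 sqrtCK.
  have := k0 _ _ (Yx i) (Yx j); have := k0 _ _ Yz Yz.
  by set a := k z z; set b := k (x i) (x j) => a0 b0; field; rewrite a0 b0.
pose W i : 'M[C]_n.+1 := \matrix_(p, q) (if p == ord0 then G i q else 0).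
have psdW := @block_psd_rank_one _ x G _ W ord0 (fun i => erefl) hA.
have [Phi [mPhi vPhi cPhi]] := pick n.+1 n.+1 isT isT x W psdW.
(* After interpolation, 1 minus the product of the rows is k(x_i, z) k(z, x_j) / (k(x_i, x_j) k(z,
   z)). The weights cancel its numerator, k(z, z) > 0 is multiplied away, and [kernel_off] divided
   by k(x_i, x_j) is the wanted entry. *)
have := contraction_kernel_off mPhi cPhi (k0 _ _ Yy Yy) x
  (fun i => v i / k z (x i)).
have z0 : 0 < k z z by rewrite lt_def k0//=; exact: (kernel_diag_ge0 H).
rewrite -(pmulr_rge0 _ z0) mulr_sumr; congr (0 <= _).
apply: eq_bigr => i _; rewrite mulr_sumr; apply: eq_bigr => j _.
have -> : \sum_l Phi (x i) 0 l * (Phi (x j) 0 l)^* = A i j.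
  by rewrite hG; apply: eq_bigr => l _; rewrite !vPhi !mxE.
rewrite mxE opprB addrC subrK /kernel_off rmorphM fmorphV /= -(kernelC H).
have := k0 _ _ (Yx i) (Yx j); have := k0 _ _ Yz Yz.
have := k0 _ _ (Yx i) Yz; have := k0 _ _ Yz (Yx j); have := k0 _ _ Yy Yy.
set a := k z z; set b := k (x i) (x j); set c := k (x i) z; set d := k z (x j).
set e := k y y => e0 d0 c0 a0 b0.
by field; rewrite e0 d0 c0 a0 b0.
Qed.

End McCulloughQuiggin.

(** * The orthogonal basis of monomials *)

Section DirichletMonomials.
Variable R : realType.
Local Notation C := R[i].

(* n^{-t}, with the junk value 1 at n = 0. *)
Definition dn (n : nat) (t : R) : R := expR (- (t * ln n%:R)).

Lemma dn_gt0 n t : 0 < dn n t. Proof. exact: expR_gt0. Qed.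
Lemma dn_ge0 n t : 0 <= dn n t. Proof. exact: expR_ge0. Qed.

Lemma dnD n s t : dn n (s + t) = dn n s * dn n t.
Proof. by rewrite /dn -expRD mulrDl opprD. Qed.

Lemma dn0 n : dn n 0 = 1.
Proof. by rewrite /dn mul0r oppr0 expR0. Qed.

Lemma dn_mul2 n t : dn n (2 * t) = dn n t ^+ 2.
Proof. by rewrite mulr_natl mulr2n dnD -expr2. Qed.

Lemma dn_nat n j : (0 < n)%N -> dn n j%:R = (n%:R^-1) ^+ j.
Proof.
move=> n0; rewrite /dn -mulrN -lnV ?posrE ?ltr0n// expRM_natl.
by rewrite lnK// posrE invr_gt0 ltr0n.
Qed.

Lemma dnM m n t : (0 < m)%N -> (0 < n)%N -> dn (m * n) t = dn m t * dn n t.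
Proof.
by move=> m0 n0; rewrite /dn natrM lnM ?posrE ?ltr0n// mulrDr opprD expRD.
Qed.

Lemma ler_dn n s t : (0 < n)%N -> s <= t -> dn n t <= dn n s.
Proof.
by move=> n0 st; rewrite ler_expR lerN2 ler_wpM2r// ln_ge0// ler1n.
Qed.

Lemma ltr_dn n s t : (1 < n)%N -> s < t -> dn n t < dn n s.
Proof.
by move=> n0 st; rewrite ltr_expR ltrN2 ltr_pM2r// ln_gt0// ltr1n.
Qed.

Lemma dn_powR n t : (0 < n)%N -> n%:R `^ (- t) = dn n t.
Proof.
by move=> n0; rewrite /powR pnatr_eq0 -[n == 0]negbK -lt0n n0/= mulNr.
Qed.

Lemma npow_real n t : npow n (Some t%:C%C) = (dn n t)%:C%C :> C.
Proof. by rewrite /npow /= mul0r cos0 sin0 oppr0 mulr1. Qed.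

Lemma normc_npow n (z : C) : normc (npow n (Some z)) = dn n (complex.Re z).
Proof.
rewrite /npow Normc.normcM normc_pos ?expR_ge0// -[RHS]mulr1; congr (_ * _).
by rewrite /= sqrrN cos2Dsin2 sqrtr1.
Qed.

Lemma npow1 (s : Defs.cpoint R) : npow 1 s = 1.
Proof.
case: s => [z|]//=; rewrite ln1 !mulr0 oppr0 expR0 cos0 sin0 oppr0.
by rewrite mulr1.
Qed.

Lemma npowM m n (s : Defs.cpoint R) : (0 < m)%N -> (0 < n)%N ->
  npow (m * n) s = npow m s * npow n s.
Proof.
move=> m0 n0; case: s => [z|]; last by rewrite /= -natrM mulnb muln_eq1.
rewrite /npow natrM lnM ?posrE ?ltr0n// !mulrDr opprD expRD cosD sinD.
by apply/eqP; rewrite eq_complex /=; apply/andP; split; apply/eqP; ring.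
Qed.

Lemma exp_small (A rho : R) : 0 <= rho -> rho < 1 ->
  forall e, 0 < e -> exists K, forall J, (K <= J)%N -> A * rho ^+ J < e.
Proof.
move=> r0 r1 e e0; have A1 : 0 < `|A| + 1 by rewrite ltr_wpDl.
have /cvg_expr/cvgrPdist_lt/(_ _ (divr_gt0 e0 A1))[K _ hK] : `|rho| < 1.
  by rewrite ger0_norm.
exists K => J /hK /=; rewrite sub0r normrN ger0_norm ?exprn_ge0//.
rewrite ltr_pdivlMr//; apply: le_lt_trans; rewrite mulrC.
by rewrite ler_wpM2l ?exprn_ge0// (le_trans (ler_norm A))//; lra.
Qed.

End DirichletMonomials.

(** * Isolating one coefficient by polynomials in 1/n *)

Section PeakPolynomials.
Variable R : realType.
Local Notation C := R[i].

(* As J grows, the values at the points 1/n tend to the indicator of n = n0;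
   this isolates a single coefficient of a Dirichlet series. *)
Definition peak (n0 J : nat) : {poly R} := (1 - ('X - (n0%:R^-1)%:P) ^+ 2) ^+ J.

Lemma peakE n0 J x : (peak n0 J).[x] = (1 - (x - n0%:R^-1) ^+ 2) ^+ J.
Proof. by rewrite /peak !hornerE. Qed.

Lemma peak_self n0 J : (peak n0 J).[n0%:R^-1] = 1.
Proof. by rewrite peakE subrr expr0n /= subr0 expr1n. Qed.

(** 1/(n0 (n0 + 1)) is the distance from 1/n0 to the nearest other reciprocal, 1/(n0 + 1). *)
Definition peak_rate (n0 : nat) : R := 1 - (n0%:R * n0.+1%:R)^-1 ^+ 2.

Lemma peak_rate_ge0 n0 : (0 < n0)%N -> 0 <= peak_rate n0.
Proof.
move=> n0p; rewrite subr_ge0 exprn_ile1 ?invr_ge0 ?mulr_ge0//.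
by rewrite invf_le1 -natrM ?ltr0n ?ler1n muln_gt0 n0p.
Qed.

Lemma peak_rate_lt1 n0 : (0 < n0)%N -> peak_rate n0 < 1.
Proof.
by move=> n0p; rewrite ltrBlDr ltrDl exprn_gt0// invr_gt0 mulr_gt0 ?ltr0n.
Qed.

Lemma inv_nat_dist n0 n : (0 < n0)%N -> (0 < n)%N -> n != n0 ->
  (n0%:R * n0.+1%:R)^-1 <= `|n%:R^-1 - n0%:R^-1| :> R.
Proof.
move=> n00 n0p nn; have a0 : 0 < n0%:R :> R by rewrite ltr0n.
have b0 : 0 < n%:R :> R by rewrite ltr0n.
rewrite -natr1; have [lt|gt|/eqP] := ltngtP n n0; last by rewrite (negbTE nn).
- have ab : n%:R + 1 <= n0%:R :> R by rewrite natr1 ler_nat.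
  rewrite ger0_norm ?subr_ge0 ?lef_pV2 ?posrE//; last by lra.
  move: a0 b0 ab; set a : R := n0%:R; set b : R := n%:R => a0 b0 ab.
  have -> : b^-1 - a^-1 = (a - b) / (a * b) by field; rewrite !gt_eqF.
  rewrite ler_pdivlMr ?mulr_gt0// ler_pdivrMl ?mulr_gt0//; last by lra.
  apply: (@le_trans _ _ (a * (a + 1) * 1)); first by nra.
  by rewrite ler_wpM2l//; [rewrite mulr_ge0; lra | lra].
- have ab : n0%:R + 1 <= n%:R :> R by rewrite natr1 ler_nat.
  rewrite ler0_norm ?subr_le0 ?lef_pV2 ?posrE//; last by lra.
  move: a0 b0 ab; set a : R := n0%:R; set b : R := n%:R => a0 b0 ab.
  have -> : - (b^-1 - a^-1) = (b - a) / (a * b) by field; rewrite !gt_eqF.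
  rewrite ler_pdivlMr ?mulr_gt0// ler_pdivrMl ?mulr_gt0//; last by lra.
  rewrite -mulrA ler_pM2l//; nra.
Qed.

Lemma peak_bound n0 J n : (0 < n0)%N -> (0 < n)%N -> n != n0 ->
  0 <= (peak n0 J).[n%:R^-1] <= peak_rate n0 ^+ J.
Proof.
move=> n00 n0p nn; rewrite peakE.
have h : (n0%:R * n0.+1%:R)^-1 ^+ 2 <= (n%:R^-1 - n0%:R^-1) ^+ 2 :> R.
  rewrite -[leRHS]real_normK ?num_real//; apply: lerXn2r.
  - by rewrite nnegrE invr_ge0 mulr_ge0.
  - by rewrite nnegrE.
  - exact: inv_nat_dist.
have h1 : (n%:R^-1 - n0%:R^-1) ^+ 2 <= 1 :> R.
  have a1 : 0 < n%:R^-1 :> R by rewrite invr_gt0 ltr0n.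
  have a2 : n%:R^-1 <= 1 :> R by rewrite invf_le1 ?ltr0n ?ler1n.
  have b1 : 0 < n0%:R^-1 :> R by rewrite invr_gt0 ltr0n.
  have b2 : n0%:R^-1 <= 1 :> R by rewrite invf_le1 ?ltr0n ?ler1n.
  nra.
rewrite exprn_ge0 ?subr_ge0//=; apply: lerXn2r.
- by rewrite nnegrE subr_ge0.
- by rewrite nnegrE peak_rate_ge0.
- by rewrite lerD2l lerN2.
Qed.

(** Every term but one carries at most the factor [peak_rate n0 ^+ J], uniformly in the truncation,
    so [L J] lies within [A * peak_rate n0 ^+ J] of [a n0]. The index 0, whose reciprocal is a
    default value, is removed by [a 0%N = 0]. *)
Lemma peak_limit (a : nat -> C) (A : R) n0 (L : nat -> C) : (0 < n0)%N ->
  a 0%N = 0 -> (forall M, \sum_(n < M) normc (a n) <= A) ->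
  (forall J, Ccvg (fun M => \sum_(n < M) a n * ((peak n0 J).[n%:R^-1])%:C%C) (L J)) ->
  Ccvg L (a n0).
Proof.
move=> n00 a0 aA hL.
apply: (@Ccvg_le _ _ _ (fun J => A * peak_rate n0 ^+ J)); last first.
  by apply: exp_small; [exact: peak_rate_ge0|exact: peak_rate_lt1].
move=> J; have h := CcvgB (hL J) (Ccvg_cst (a n0)).
apply: (Ccvg_normc_le _ h); exists n0.+1 => M nM.
rewrite (bigD1 (Ordinal nM))//= peak_self mulr1 addrAC subrr add0r.
rewrite (le_trans (normc_sum _ _ _))//.
apply: (@le_trans _ _ (\sum_(n < M) normc (a n) * peak_rate n0 ^+ J)); last first.
  by rewrite -mulr_suml ler_wpM2r ?exprn_ge0 ?peak_rate_ge0.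
rewrite [leRHS](bigD1 (Ordinal nM))//= ler_wpDl//.
  by rewrite mulr_ge0 ?normc_ge0 ?exprn_ge0 ?peak_rate_ge0.
apply: ler_sum => i iM; have [i0|i0] := eqVneq (i : nat) 0%N.
  by rewrite i0 a0 mul0r Normc.normc0 mul0r.
rewrite Normc.normcM ler_wpM2l ?normc_ge0//.
have /andP[p0 p1] : 0 <= (peak n0 J).[i%:R^-1] <= peak_rate n0 ^+ J.
  by apply: peak_bound => //; rewrite lt0n.
by rewrite normc_pos.
Qed.

Lemma Ccvg_horner (a : nat -> C) (F : nat -> C) (p : {poly R}) :
  (forall j, Ccvg (fun M => \sum_(n < M) a n * (n%:R^-1 ^+ j)%:C%C) (F j)) ->
  Ccvg (fun M => \sum_(n < M) a n * (p.[n%:R^-1])%:C%C)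
    (\sum_(j < size p) (p`_j)%:C%C * F j).
Proof.
move=> h; have := Ccvg_sum (index_enum 'I_(size p)) (fun j : 'I__ => CcvgZ (p`_j)%:C%C (h j)).
apply: eq_Ccvg => M; under eq_bigr => j _ do rewrite mulr_sumr.
rewrite exchange_big /=; apply: eq_bigr => n _.
rewrite horner_coef rmorph_sum mulr_sumr; apply: eq_bigr => j _.
by rewrite rmorphM /= mulrCA.
Qed.

End PeakPolynomials.

Structure admissible (R : realType) (N : set nat) (b : nat -> R) : Prop :=
  Admissible {
    adm_pos : forall n, N n -> (0 < n)%N;
    adm_one : N 1%N;
    adm_mul : forall m n, N m -> N n -> N (m * n)%N;
    adm_neq : N <> [set 1%N];
    adm_b1 : b 1%N = 1;
    adm_bpos : forall n, N n -> 0 < b n;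
    adm_sigma : (sigma_a N b < +oo)%E
  }.

Section Weights.
Variables (R : realType) (N : set nat) (b : nat -> R) (adm : admissible N b).
Local Notation C := R[i].
Local Notation X := (hplane N b).

(** Extending [b] by zero turns sums over [N] into sums over initial segments and lets Dirichlet
    convolution ignore [N]. *)
Definition wt (n : nat) : R := if n \in N then b n else 0.

Lemma wt_ge0 n : 0 <= wt n.
Proof. by rewrite /wt; case: ifPn => // /set_mem /(adm_bpos adm)/ltW. Qed.

Lemma wt0 : wt 0 = 0.
Proof. by rewrite /wt; case: ifPn => // /set_mem /(adm_pos adm). Qed.

Lemma wt1 : wt 1 = 1.
Proof. by rewrite /wt mem_set ?(adm_b1 adm)//; exact: (adm_one adm). Qed.

Lemma wtE n : N n -> wt n = b n.
Proof. by move=> Nn; rewrite /wt mem_set. Qed.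

Lemma wt_gt0 n : N n -> 0 < wt n.
Proof. by move=> Nn; rewrite wtE//; exact: (adm_bpos adm). Qed.

Lemma wt_notin n : ~ N n -> wt n = 0.
Proof. by move=> Nn; rewrite /wt memNset. Qed.

Lemma wt_memN n : n \notin N -> wt n = 0.
Proof. by rewrite /wt => /negbTE ->. Qed.

Lemma hplane_cases (s : X) : (val s = None) \/
  exists2 z, val s = Some z & (sigma_a N b < (complex.Re z)%:E)%E.
Proof.
case: s => s hs /=; case: (set_mem hs) => [[z hz <-]|->]; last by left.
by right; exists z.
Qed.

Lemma hplane_real_subproof (t : R) : (sigma_a N b < t%:E)%E -> Some t%:C%C \in X.
Proof. by move=> h; apply: mem_set; left; exists t%:C%C. Qed.

Definition rpoint (t : R) (h : (sigma_a N b < t%:E)%E) : X :=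
  exist _ (Some t%:C%C) (hplane_real_subproof h).

Lemma infty_subproof : None \in X.
Proof. by apply: mem_set; right. Qed.

Definition ipoint : X := exist _ None infty_subproof.

Lemma wt_dn_bounded (t : R) : (sigma_a N b < t%:E)%E ->
  exists A, forall M, \sum_(n < M) wt n * dn n t ^+ 2 <= A.
Proof.
move=> /ereal_inf_lt[_ [s hs <-]]; rewrite lte_fin => st.
have [|A hA] := (@nneseries_lt_pinfty _ N
  (fun n => b n * n%:R `^ (- (2 * s))) _).1 hs.
  by move=> n Nn; rewrite mulr_ge0 ?powR_ge0// ltW// (adm_bpos adm).
exists A => M; apply: le_trans (hA M); apply: ler_sum => n _.
rewrite /wt; case: ifPn => [/set_mem Nn|_]; last by rewrite mul0r.
have n0 := adm_pos adm Nn.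
rewrite ler_wpM2l ?(ltW (adm_bpos adm _))// -dn_mul2 dn_powR//.
by rewrite ler_dn// ler_pM2l// ltW.
Qed.

Lemma wt_npow_bounded (s : X) :
  exists A, forall M, \sum_(n < M) wt n * normc (npow n (val s)) ^+ 2 <= A.
Proof.
have [->|[z -> hz]] := hplane_cases s; last first.
  by under eq_exists => A do under eq_forall => M do
    under eq_bigr => n _ do rewrite normc_npow; exact: wt_dn_bounded.
exists 1 => M; have [M1|M1] := ltnP 1 M; last first.
  rewrite big1// => i _; have [i0|i0] := posnP i; first by rewrite i0 wt0 mul0r.
  have : (i < 1)%N by apply: leq_trans M1.
  by rewrite ltnS leqNgt i0.
rewrite (bigD1 (Ordinal M1))//= wt1 mul1r expr1n expr0n addr0 sqrtr1 expr1n.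
rewrite big1 ?addr0// => i; rewrite -val_eqE /= => /negbTE ->.
by rewrite Normc.normc0 expr0n /= mulr0.
Qed.

Lemma wt_npow2_bounded (s w : X) : exists A, forall M,
  \sum_(n < M) wt n * (normc (npow n (val s)) * normc (npow n (val w))) <= A.
Proof.
have [A hA] := wt_npow_bounded s; have [B hB] := wt_npow_bounded w.
exists (A + B) => M; apply: le_trans (lerD (hA M) (hB M)).
rewrite -big_split /=; apply: ler_sum => n _; rewrite -mulrDr.
rewrite ler_wpM2l ?wt_ge0//.
have := normc_ge0 (npow n (val s)); have := normc_ge0 (npow n (val w)).
by set x := normc _; set y := normc _; nra.
Qed.

Lemma kernelXP (s w : X) : Ccvg (fun M =>
  \sum_(n < M) (wt n)%:C%C * (npow n (val s) * (npow n (val w))^*)) (kernelX s w).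
Proof.
have [A hA] := wt_npow2_bounded s w.
have [z hz] : exists z, Ccvg (fun M =>
    \sum_(n < M) (wt n)%:C%C * (npow n (val s) * (npow n (val w))^*)) z.
  apply: (@abs_sum_Ccvg _ (fun n => (wt n)%:C%C *
    (npow n (val s) * (npow n (val w))^*)) A) => M; apply: le_trans (hA M).
  apply: ler_sum => n _.
  by rewrite !Normc.normcM normc_pos ?wt_ge0// normcJ2.
rewrite /kernelX /kernel_at (@csumP _ N _ z)//.
apply: eq_Ccvg hz => M; apply: eq_bigr => n _; rewrite /wt.
by case: ifPn; rewrite ?mul0r.
Qed.

(** Only n = 1 survives at +oo. Hence the constant 1 is a kernel function, and +oo is the base point
    that turns the McCullough-Quiggin expression into 1 - 1/k. *)
Lemma kernel_ipoint (s : X) : kernelX s ipoint = 1.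
Proof.
apply: Ccvg_unique (kernelXP s ipoint) _.
apply: (@Ccvg_near _ (fun=> 1) _ _ 2); last exact: Ccvg_cst.
move=> M M1; rewrite (bigD1 (Ordinal M1))//= wt1 npow1 conjC1 !mulr1.
rewrite big1 ?addr0// => i; rewrite -val_eqE /= => /negbTE ->.
by rewrite rmorph0 !mulr0.
Qed.

End Weights.

(** * Monomials as limits of combinations of kernel functions *)

Section DirichletSpace.
Variables (R : realType) (N : set nat) (b : nat -> R) (adm : admissible N b).
Local Notation C := R[i].
Local Notation X := (hplane N b).
Local Notation wt := (wt N b).
Variable (H : rkhs (@kernelX R N b)).
Local Notation mem := (rkhs_mem H).
Local Notation dot := (rkhs_dot H).
Local Notation hnorm := (hnorm H).

Definition monomial (n : nat) : X -> C := fun s => npow n (val s).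

Lemma monomialE n s : monomial n s = npow n (val s).
Proof. by []. Qed.

Section CoefficientIsolation.
Variables (s0 : R) (h0 : (sigma_a N b < s0%:E)%E).

Lemma shift_subproof (j : nat) : (sigma_a N b < (s0 + j%:R)%:E)%E.
Proof. by apply: (lt_le_trans h0); rewrite lee_fin lerDl. Qed.

Definition shift_point (j : nat) : X := rpoint (shift_subproof j).

Lemma npow_shift j n : (0 < n)%N ->
  npow n (val (shift_point j)) = (dn n s0 * n%:R^-1 ^+ j)%:C%C.
Proof. by move=> n0; rewrite npow_real dnD dn_nat. Qed.

(* A finite combination of kernels at the points [s0 + j] acts on coefficients
   as multiplication by [n^{-s0} p(1/n)]. *)
Definition kernel_comb (p : {poly R}) : X -> C :=
  fun x => \sum_(j < size p) (p`_j)%:C%C * kernelX x (shift_point j).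

Lemma kernel_comb_mem p : mem (kernel_comb p).
Proof. by apply: mem_sum => i _; exact: rkhs_kernel. Qed.

Lemma dot_kernel_comb p f : mem f ->
  dot f (kernel_comb p) = \sum_(j < size p) (p`_j)%:C%C * f (shift_point j).
Proof.
move=> hf; rewrite /kernel_comb dot_sumr//; last by move=> i _; exact: rkhs_kernel.
by apply: eq_bigr => i _; rewrite conjC_realC rkhs_reproducing.
Qed.

Lemma dot_kernel_combP p f (a : nat -> C) : mem f -> a 0%N = 0 ->
  (forall j, Ccvg (fun M => \sum_(n < M) a n * npow n (val (shift_point j)))
     (f (shift_point j))) ->
  Ccvg (fun M => \sum_(n < M) a n * (dn n s0)%:C%C * (p.[n%:R^-1])%:C%C)
    (dot f (kernel_comb p)).
Proof.
move=> hf a0 ha; rewrite dot_kernel_comb//.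
apply: (Ccvg_horner (a := fun n => a n * (dn n s0)%:C%C)
  (F := fun j => f (shift_point j))) => j.
apply: eq_Ccvg (ha j) => M; apply: eq_bigr => n _.
have [n0|n0] := posnP n; first by rewrite n0 a0 !mul0r.
by rewrite npow_shift// rmorphM /= mulrA.
Qed.

Lemma kernel_combP p x : Ccvg (fun M => \sum_(n < M)
    (wt n)%:C%C * npow n (val x) * (dn n s0)%:C%C * (p.[n%:R^-1])%:C%C)
  (kernel_comb p x).
Proof.
apply: (Ccvg_horner (a := fun n => (wt n)%:C%C * npow n (val x) *
  (dn n s0)%:C%C) (F := fun j => kernelX x (shift_point j))) => j.
apply: eq_Ccvg (kernelXP adm x (shift_point j)) => M.
apply: eq_bigr => n _; have [n0|n0] := posnP n.
  by rewrite n0 (wt0 adm) rmorph0 !mul0r.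
by rewrite npow_shift// conjC_realC rmorphM /= !mulrA.
Qed.

(** In coefficients the squared norm is sum_n wt_n n^{-2 s0} p(1/n)^2, so [p] enters only through
    its values at reciprocals. *)
Lemma hnorm_kernel_comb (A eta : R) p : 0 <= eta ->
  (forall M, \sum_(n < M) wt n * dn n s0 ^+ 2 <= A) ->
  (forall n, (0 < n)%N -> `|p.[n%:R^-1]| <= eta) ->
  hnorm (kernel_comb p) ^+ 2 <= A * eta ^+ 2.
Proof.
move=> eta0 hA hp; have hm := kernel_comb_mem p.
have h : Ccvg (fun M => \sum_(n < M) (wt n)%:C%C * (dn n s0)%:C%C *
    (p.[n%:R^-1])%:C%C * (dn n s0)%:C%C * (p.[n%:R^-1])%:C%C)
  (dot (kernel_comb p) (kernel_comb p)).
  apply: (dot_kernel_combP p (a := fun n => (wt n)%:C%C * (dn n s0)%:C%C *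
    (p.[n%:R^-1])%:C%C)) => //; first by rewrite (wt0 adm) rmorph0 !mul0r.
  move=> j; apply: eq_Ccvg (kernel_combP p (shift_point j)) => M.
  by apply: eq_bigr => n _; ring.
rewrite hnorm_sqr//; apply: (Ccvg_real_le (v := fun M => \sum_(n < M)
  wt n * dn n s0 ^+ 2 * p.[n%:R^-1] ^+ 2)).
  exists 0%N => M _; apply: le_trans (ler_wpM2r (sqr_ge0 _) (hA M)).
  rewrite mulr_suml; apply: ler_sum => n _.
  have [n0|n0] := posnP n; first by rewrite n0 (wt0 adm) !mul0r.
  apply: ler_wpM2l; first exact: (mulr_ge0 (wt_ge0 adm _) (sqr_ge0 _)).
  by rewrite -[leLHS]real_normK ?num_real// lerXn2r ?nnegrE ?hp.
apply: eq_Ccvg h => M; rewrite realC_sum; apply: eq_bigr => n _.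
by rewrite !rmorphM /=; ring.
Qed.

Lemma kernel_combB p q x :
  kernel_comb p x - kernel_comb q x = kernel_comb (p - q) x.
Proof.
apply: Ccvg_unique (CcvgB (kernel_combP p x) (kernel_combP q x)) _.
apply: eq_Ccvg (kernel_combP (p - q) x) => M; rewrite -sumrB.
by apply: eq_bigr => n _; rewrite hornerD hornerN rmorphB /= mulrBr.
Qed.

(** Two peaks agree at 1/n0, and at the other reciprocals both are at most a power of [peak_rate];
    [hnorm_kernel_comb] makes this a Cauchy estimate in norm. *)
Lemma peak_hcvg n0 : (0 < n0)%N ->
  exists2 f, mem f & hcvg H (fun J => kernel_comb (peak R n0 J)) f.
Proof.
move=> n00; have [A hA] := wt_dn_bounded adm h0.
have A0 : 0 <= A by have := hA 0%N; rewrite big_ord0.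
pose rho := peak_rate R n0.
apply: hcauchy_cvg => [J|e e0]; first exact: kernel_comb_mem.
have r0 : 0 <= rho by exact: peak_rate_ge0.
have r1 : rho < 1 by exact: peak_rate_lt1.
have [K hK] := exp_small (Num.sqrt A) r0 r1 e0.
exists K => m n /andP[Km mn].
have -> : (fun x => kernel_comb (peak R n0 n) x - kernel_comb (peak R n0 m) x) =
    kernel_comb (peak R n0 n - peak R n0 m).
  by apply/funext => x; exact: kernel_combB.
apply: le_lt_trans (hK m Km).
rewrite -(ler_pXn2r (n := 2)) ?nnegrE ?hnorm_ge0 ?mulr_ge0 ?sqrtr_ge0 ?exprn_ge0//.
rewrite exprMn (sqr_sqrtr A0); apply: hnorm_kernel_comb => //; first exact: exprn_ge0.
move=> i i0; rewrite hornerD hornerN; have [->|i1] := eqVneq i n0.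
  by rewrite !peak_self subrr normr0 exprn_ge0.
have /andP[a0 a1] := peak_bound R n n00 i0 i1.
have /andP[b0 b1] := peak_bound R m n00 i0 i1.
have : peak_rate R n0 ^+ n <= peak_rate R n0 ^+ m.
  by rewrite ler_wiXn2l// ltW.
rewrite /rho ler_norml; lra.
Qed.

(** The norm limit must agree with the pointwise limit, which [peak_limit] computes. This puts the
    monomials with nonzero weight into the space. *)
Lemma peak_hcvg_monomial n0 : (0 < n0)%N ->
  hcvg H (fun J => kernel_comb (peak R n0 J))
    (fun s => (wt n0 * dn n0 s0)%:C%C * monomial n0 s) /\
  mem (fun s => (wt n0 * dn n0 s0)%:C%C * monomial n0 s).
Proof.
move=> n00; have [f hf cf] := peak_hcvg n00.
suff <- : f = (fun s => (wt n0 * dn n0 s0)%:C%C * monomial n0 s) by split.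
apply/funext => x; apply: Ccvg_unique.
  by apply: hcvg_eval cf => // J; exact: kernel_comb_mem.
have [A hA] := wt_npow2_bounded adm x (shift_point 0).
have -> : (wt n0 * dn n0 s0)%:C%C * monomial n0 x =
    (wt n0)%:C%C * npow n0 (val x) * (dn n0 s0)%:C%C.
  by rewrite rmorphM /= /monomial; ring.
apply: (peak_limit (a := fun n => (wt n)%:C%C * npow n (val x) * (dn n s0)%:C%C)
    (A := A)) => //.
- by rewrite (wt0 adm) rmorph0 !mul0r.
- move=> M; apply: le_trans (hA M); apply: ler_sum => n _.
  have [n0'|n0'] := posnP n; first by rewrite n0' (wt0 adm) rmorph0 !mul0r Normc.normc0.
  rewrite npow_shift// expr0 mulr1 !Normc.normcM !normc_pos ?(wt_ge0 adm) ?dn_ge0//.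
  by rewrite mulrA.
- by move=> J; exact: kernel_combP.
Qed.

(** Pairing with [kernel_comb] only evaluates g at the points s0 + j, and in the limit the peaks
    select one coefficient; so the values at these points determine all coefficients. *)
Lemma coef_extraction (g : X -> C) (a : nat -> C) (A : R) : mem g -> a 0%N = 0 ->
  (forall M, \sum_(n < M) normc (a n) * dn n s0 <= A) ->
  (forall j, Ccvg (fun M => \sum_(n < M) a n * npow n (val (shift_point j)))
     (g (shift_point j))) ->
  forall n, (0 < n)%N -> dot g (fun s => (wt n)%:C%C * monomial n s) = a n.
Proof.
move=> hg a0 hA ha n n0; have [cf hf] := peak_hcvg_monomial n0.
have d0 : (dn n s0)%:C%C != 0 :> C by rewrite eq_complex /= eqxx andbT gt_eqF ?dn_gt0.
have hm : mem (fun s => (wt n)%:C%C * monomial n s).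
  have := memZ (dn n s0)%:C%C^-1 hf; congr (mem _); apply/funext => s.
  by rewrite rmorphM /=; field.
apply: (mulfI d0); rewrite -[X in X * dot _ _](conjC_realC (dn n s0)) -dotZr//.
have -> : (fun x => (dn n s0)%:C%C * ((wt n)%:C%C * monomial n x)) =
    (fun s => (wt n * dn n s0)%:C%C * monomial n s).
  by apply/funext => s; rewrite rmorphM /=; ring.
rewrite [RHS]mulrC; apply: Ccvg_unique (hcvg_dot _ hf hg cf) _.
  by move=> J; exact: kernel_comb_mem.
apply: (peak_limit (a := fun n => a n * (dn n s0)%:C%C) (A := A)) => //.
- by rewrite a0 mul0r.
- move=> M; apply: le_trans (hA M); apply: ler_sum => i _.
  by rewrite Normc.normcM (normc_pos (dn_ge0 _ _)).
- by move=> J; exact: dot_kernel_combP.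
Qed.

End CoefficientIsolation.

Lemma real_point_exists : exists s0 : R, (sigma_a N b < s0%:E)%E.
Proof.
have := adm_sigma adm; case: (sigma_a N b) => [r _| |_] //.
  by exists (r + 1); rewrite lte_fin ltrDl.
by exists 0; rewrite ltNyr.
Qed.

Lemma monomial_mem n : N n -> mem (monomial n).
Proof.
move=> Nn; have [s0 h0] := real_point_exists.
have [_ hf] := peak_hcvg_monomial h0 (adm_pos adm Nn).
have d0 : (wt n * dn n s0)%:C%C != 0 :> C.
  by rewrite eq_complex /= eqxx andbT gt_eqF// mulr_gt0 ?dn_gt0// (wt_gt0 adm).
have := memZ (wt n * dn n s0)%:C%C^-1 hf; congr (mem _); apply/funext => s.
by rewrite mulKf.
Qed.

(** The factor [wt n] is the inverse squared norm of the monomial. Outside [N] the value is set to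
    0, because there the monomial is not known to lie in the space and [dot] would be
    unconstrained. *)
Definition hcoef (f : X -> C) (n : nat) : C :=
  if n \in N then (wt n)%:C%C * dot f (monomial n) else 0.

Lemma hcoefE f n : N n -> hcoef f n = (wt n)%:C%C * dot f (monomial n).
Proof. by move=> Nn; rewrite /hcoef mem_set. Qed.

Lemma hcoef_notin f n : ~ N n -> hcoef f n = 0.
Proof. by move=> Nn; rewrite /hcoef memNset. Qed.

Lemma hcoef_memN f n : n \notin N -> hcoef f n = 0.
Proof. by rewrite /hcoef => /negbTE ->. Qed.

Lemma hcoef_unique s0 (h0 : (sigma_a N b < s0%:E)%E) (g : X -> C) (a : nat -> C)
    (A : R) : mem g -> (forall n, ~ N n -> a n = 0) ->
  (forall M, \sum_(n < M) normc (a n) * dn n s0 <= A) ->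
  (forall j, Ccvg (fun M => \sum_(n < M) a n * npow n (val (shift_point h0 j)))
     (g (shift_point h0 j))) ->
  hcoef g =1 a.
Proof.
move=> hg aN hA ha n; have [Nn|Nn] := pselect (N n); last first.
  by rewrite hcoef_notin// aN.
have a0 : a 0%N = 0 by apply: aN => /(adm_pos adm).
rewrite hcoefE// -[X in X * _]conjC_realC -dotZr//; last exact: monomial_mem.
by apply: (coef_extraction hg a0 hA ha); exact: (adm_pos adm Nn).
Qed.

(** Orthogonality is uniqueness of coefficients, applied to the series whose only coefficient is 1
    at m. *)
Lemma dot_monomial m n : N m -> N n ->
  dot (monomial m) (monomial n) = if m == n then ((wt n)^-1)%:C%C else 0.
Proof.
move=> Nm Nn; have [s0 h0] := real_point_exists.
have w0 : (wt n)%:C%C != 0 :> C.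
  by rewrite eq_complex /= eqxx andbT gt_eqF// (wt_gt0 adm).
apply: (mulfI w0); rewrite -hcoefE//.
rewrite (hcoef_unique (h0 := h0) (a := fun i => if m == i then 1 else 0)
    (A := dn m s0)).
- by case: ifPn => _; rewrite ?mulr0// -rmorphM mulfV ?rmorph1// gt_eqF// (wt_gt0 adm).
- exact: monomial_mem.
- by move=> i Ni; case: eqP => // mi; rewrite -mi in Ni.
- move=> M; have [mM|Mm] := ltnP m M.
    rewrite (bigD1 (Ordinal mM))//= eqxx Normc.normc1 mul1r big1 ?addr0//.
    move=> i; rewrite -val_eqE /= eq_sym => /negbTE ->.
    by rewrite Normc.normc0 mul0r.
  rewrite big1 ?dn_ge0// => i _; rewrite ifN ?Normc.normc0 ?mul0r//.
  by rewrite neq_ltn (leq_trans (ltn_ord i) Mm) orbT.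
- move=> j; apply: (@Ccvg_near _ (fun=> monomial m (shift_point h0 j)) _ _ m.+1); last exact: Ccvg_cst.
  move=> M mM; rewrite (bigD1 (Ordinal mM))//= eqxx mul1r big1 ?addr0//.
  by move=> i; rewrite -val_eqE /= eq_sym => /negbTE ->; rewrite mul0r.
Qed.

End DirichletSpace.

(** * Expansion in the monomial basis *)

Section CoefficientSpace.
Variables (R : realType) (N : set nat) (b : nat -> R) (adm : admissible N b).
Local Notation C := R[i].
Local Notation X := (hplane N b).
Local Notation wt := (wt N b).
Variable (H : rkhs (@kernelX R N b)).
Local Notation mem := (rkhs_mem H).
Local Notation dot := (rkhs_dot H).
Local Notation hnorm := (hnorm H).
Local Notation monomial := (@monomial R N b).
Local Notation hcoef := (hcoef H).

(** The predicate allows the difference of two partial sums to be written in the same form. *)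
Definition dpoly (P : pred nat) (a : nat -> C) (M : nat) : X -> C :=
  fun x => \sum_(i < M | P i) a i * monomial i x.

Section Polynomials.
Variable a : nat -> C.
Hypothesis aN : forall n, ~ N n -> a n = 0.

Lemma dpolyE P M : dpoly P a M =
  fun x => \sum_(i < M | P i && ((i : nat) \in N)) a i * monomial i x.
Proof.
apply/funext => x; rewrite [RHS]big_mkcondr; apply: eq_bigr => i _.
by case: ifPn => // /negP iN; rewrite aN ?mul0r// => Ni; apply: iN; rewrite mem_set.
Qed.

Lemma dpoly_mem P M : mem (dpoly P a M).
Proof.
rewrite dpolyE; apply: mem_sum => i /andP[_ /set_mem]; exact: monomial_mem.
Qed.

Lemma dot_dpoly P M f : mem f -> dot f (dpoly P a M) =
  \sum_(i < M | P i && ((i : nat) \in N)) (a i)^* * dot f (monomial i).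
Proof.
move=> hf; rewrite dpolyE dot_sumr// => i /andP[_ /set_mem]; exact: monomial_mem.
Qed.

Lemma dot_dpoly_monomial P M n : N n ->
  dot (dpoly P a M) (monomial n) = if P n && (n < M)%N then a n * ((wt n)^-1)%:C%C else 0.
Proof.
move=> Nn; have hn := monomial_mem adm H Nn.
rewrite dpolyE dot_suml//; last by move=> i /andP[_ /set_mem]; exact: monomial_mem.
have -> : \sum_(i < M | P i && ((i : nat) \in N)) a i * dot (monomial i) (monomial n) =
    \sum_(i < M | P i && ((i : nat) == n)) a i * ((wt i)^-1)%:C%C.
  rewrite [LHS]big_mkcond [RHS]big_mkcond; apply: eq_bigr => i _.
  have [Ni|Ni] := pselect (N i).
    rewrite mem_set// andbT dot_monomial//.
    by case: (P i) => //=; case: eqP => [->|_]; rewrite ?mulr0.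
  by rewrite memNset// andbF aN// mul0r; case: ifP.
case: ifPn => [/andP[Pn nM]|].
  rewrite (bigD1 (Ordinal nM)) ?Pn ?eqxx//= big1 ?addr0// => i.
  by move=> /andP[/andP[_ /eqP in_]]; rewrite -val_eqE /= in_ eqxx.
rewrite negb_and => h; rewrite big1// => i /andP[Pi /eqP in_].
by move: h; rewrite -in_ Pi ltn_ord.
Qed.

Lemma hnorm_dpoly P M :
  hnorm (dpoly P a M) ^+ 2 = \sum_(i < M | P i) normc (a i) ^+ 2 / wt i.
Proof.
have hD := dpoly_mem P M.
apply: (@complexI R); rewrite -hnormE// dot_dpoly// realC_sum.
rewrite big_mkcondr; apply: eq_bigr => i Pi; case: ifPn => [/set_mem Ni|iN].
  by rewrite dot_dpoly_monomial// Pi ltn_ord mulrA (mulrC (a i)^*) mulJc -rmorphM.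
by rewrite aN ?Normc.normc0 ?expr0n ?mul0r// => Ni; apply/negP: iN; rewrite mem_set.
Qed.

(** Riesz-Fischer: by orthogonality the differences of partial sums are blocks of a bounded
    nonnegative series. Where [wt i] is 0 the quotient is 0 by default, and [a] vanishes there. *)
Lemma synthesis (Z : R) : (forall M, \sum_(i < M) normc (a i) ^+ 2 / wt i <= Z) ->
  exists f, [/\ mem f, hcvg H (dpoly xpredT a) f, hnorm f ^+ 2 <= Z &
    forall x, Ccvg (fun M => \sum_(n < M) a n * monomial n x) (f x)].
Proof.
move=> hZ; have u0 i : 0 <= normc (a i) ^+ 2 / wt i.
  by rewrite mulr_ge0 ?sqr_ge0// invr_ge0 (wt_ge0 adm).
have Z0 : 0 <= Z by have := hZ 0%N; rewrite big_ord0.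
have [|e e0|f hf cf] := @hcauchy_cvg _ _ _ H (dpoly xpredT a).
- by move=> n; exact: dpoly_mem.
- have [K hK] := nonneg_sum_cauchy u0 hZ (exprn_gt0 2 e0).
  exists K => m n Kmn; have := hK _ _ Kmn; have /andP[_ mn] := Kmn.
  have -> : (fun x => dpoly xpredT a n x - dpoly xpredT a m x) =
      dpoly (fun i => (m <= i)%N) a n.
    apply/funext => x; rewrite /dpoly (big_ord_widen n (fun i => a i * monomial i x) mn).
    rewrite (bigID (fun i : 'I_n => (i < m)%N)) /= addrAC subrr add0r.
    by apply: eq_bigl => i; rewrite -leqNgt.
  move=> h; rewrite -(ltr_pXn2r (n := 2)) ?nnegrE ?hnorm_ge0 ?ltW//.
  rewrite hnorm_dpoly; apply: le_lt_trans h.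
  rewrite (big_ord_widen n (fun i => normc (a i) ^+ 2 / wt i) mn).
  rewrite [X in X - _](bigID (fun i : 'I_n => (i < m)%N)) /= addrAC subrr add0r.
  by rewrite le_eqVlt; apply/orP; left; apply/eqP; apply: eq_bigl => i; rewrite -leqNgt.
exists f; split => //.
- rewrite -(sqr_sqrtr Z0) lerXn2r ?nnegrE ?hnorm_ge0 ?sqrtr_ge0//.
  apply: (hcvg_norm_le _ hf cf) => n; first exact: dpoly_mem.
  rewrite -(ler_pXn2r (n := 2)) ?nnegrE ?hnorm_ge0 ?sqrtr_ge0//.
  by rewrite (sqr_sqrtr Z0) hnorm_dpoly.
- by move=> x; apply: hcvg_eval cf => // n; exact: dpoly_mem.
Qed.

Lemma coef_abs_bounded (Z : R) (x : X) :
  (forall M, \sum_(i < M) normc (a i) ^+ 2 / wt i <= Z) ->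
  exists A, forall M, \sum_(n < M) normc (a n) * normc (npow n (val x)) <= A.
Proof.
move=> hZ; have [A hA] := wt_npow_bounded adm x.
exists (Z + A) => M; apply: le_trans (lerD (hZ M) (hA M)).
rewrite -big_split /=; apply: ler_sum => n _.
have [Nn|Nn] := pselect (N n); last first.
  by rewrite aN// (wt_notin b Nn) Normc.normc0 expr0n /= !mul0r addr0.
have w0 : 0 < wt n by exact: (wt_gt0 adm).
have := normc_ge0 (npow n (val x)); have := normc_ge0 (a n).
set p := normc _; set q := normc _ => p0 q0.
have -> : p ^+ 2 / wt n + wt n * q ^+ 2 = (p ^+ 2 + (wt n * q) ^+ 2) / wt n.
  by field; rewrite gt_eqF.
rewrite ler_pdivlMr//; have := sqr_ge0 (p - wt n * q).
have : 0 <= p * q * wt n by rewrite !mulr_ge0// ltW.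
by nra.
Qed.

End Polynomials.

(** The kernel function at w is the norm limit of its own monomial series; pairing [f] with it and
    using the reproducing property expands f(w). This is completeness of the basis. *)
Lemma monomial_expansion f w : mem f ->
  Ccvg (fun M => \sum_(n < M) hcoef f n * npow n (val w)) (f w).
Proof.
move=> hf; pose a n := (wt n)%:C%C * (npow n (val w))^*.
have aN n : ~ N n -> a n = 0 by move=> Nn; rewrite /a (wt_notin b Nn) rmorph0 mul0r.
have [A hA] := wt_npow_bounded adm w.
have [|g [hg cg _ gx]] := synthesis aN (Z := A).
  move=> M; apply: le_trans (hA M); apply: ler_sum => n _.
  have [Nn|Nn] := pselect (N n); last by rewrite (wt_notin b Nn) invr0 mulr0 mul0r.
  rewrite /a Normc.normcM normcJ2 normc_pos ?(wt_ge0 adm)// exprMn mulrAC.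
  by rewrite expr2 mulfK// gt_eqF// (wt_gt0 adm).
have gk : g = (@kernelX R N b)^~ w.
  apply/funext => x; apply: Ccvg_unique (gx x) _.
  apply: eq_Ccvg (kernelXP adm x w) => M; apply: eq_bigr => n _.
  by rewrite /a monomialE; ring.
rewrite gk in hg cg.
rewrite -[f w](rkhs_reproducing w hf).
apply: eq_Ccvg (hcvg_dot _ hg hf cg) => M; last exact: dpoly_mem.
rewrite dot_dpoly//= big_mkcond; apply: eq_bigr => n _.
case: ifPn => [/set_mem Nn|nN]; last by rewrite (hcoef_memN H f nN) mul0r.
by rewrite hcoefE// /a rmorphM /= conjC_realC conjCK; ring.
Qed.

(** The sum is both the inner product of [f] with its partial sum and the squared norm of that
    partial sum, so [sqr_le_of_le_mul] applies. *)
Lemma bessel f M : mem f ->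
  \sum_(n < M) normc (hcoef f n) ^+ 2 / wt n <= hnorm f ^+ 2.
Proof.
move=> hf; have aN n : ~ N n -> hcoef f n = 0 by exact: hcoef_notin.
have hD := dpoly_mem aN xpredT M.
apply: (@sqr_le_of_le_mul _ _ _ (hnorm (dpoly xpredT (hcoef f) M))).
- by apply: sumr_ge0 => i _; rewrite mulr_ge0 ?sqr_ge0// invr_ge0 (wt_ge0 adm).
- exact: hnorm_ge0.
- apply: le_trans (cauchy_schwarz hf hD); apply: le_trans (Re_le_normc _).
  apply: le_trans (ler_norm _); rewrite dot_dpoly//= [X in complex.Re X]big_mkcond Re_sum.
  apply: ler_sum => i _; case: ifPn => [/set_mem Ni|nN]; last first.
    by rewrite (hcoef_memN H f nN) Normc.normc0 expr0n mul0r.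
  have w0 : wt i != 0 by rewrite gt_eqF// (wt_gt0 adm).
  have -> : dot f (monomial i) = ((wt i)^-1)%:C%C * hcoef f i.
    by rewrite hcoefE// mulrA -rmorphM mulVf// rmorph1 mul1r.
  by rewrite mulrCA (mulrC (hcoef f i)^*) mulJc ReZ /= mulrC.
- by rewrite hnorm_dpoly.
Qed.

Lemma synthesis_hcoef (a : nat -> C) (Z : R) : (forall n, ~ N n -> a n = 0) ->
  (forall M, \sum_(i < M) normc (a i) ^+ 2 / wt i <= Z) ->
  forall f, mem f ->
  (forall x, Ccvg (fun M => \sum_(n < M) a n * npow n (val x)) (f x)) -> hcoef f =1 a.
Proof.
move=> aN hZ f hf fx; have [s0 h0] := real_point_exists adm.
have [A hA] := coef_abs_bounded aN (shift_point h0 0) hZ.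
apply: (hcoef_unique adm (h0 := h0) (A := A)) => // M.
apply: le_trans (hA M); apply: ler_sum => n _.
have [n0|n0] := posnP n.
  by rewrite n0 aN ?Normc.normc0 ?mul0r// => /(adm_pos adm).
by rewrite npow_shift// expr0 mulr1 normc_pos ?dn_ge0.
Qed.

Lemma hcoef_dirichlet f : mem f -> dirichlet_coefs f (hcoef f).
Proof.
move=> hf; split; first exact: hcoef_notin.
- apply/nneseries_lt_pinfty => [n Nn|].
    by rewrite mulr_ge0 ?sqr_ge0// invr_ge0 ltW// (adm_bpos adm).
  exists (hnorm f ^+ 2) => M; apply: le_trans (bessel M hf).
  apply: ler_sum => n _; case: ifPn => [/set_mem Nn|nN]; first by rewrite wtE.
  by rewrite mulr_ge0 ?sqr_ge0// invr_ge0 (wt_ge0 adm).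
- move=> s; rewrite (@csumP _ N _ (f s))//.
  apply: eq_Ccvg (monomial_expansion s hf) => M; apply: eq_bigr => n _.
  by case: ifPn => // nN; rewrite (hcoef_memN H f nN) mul0r.
Qed.

(** [coef] is a choice among coefficient sequences; [hcoef f] is one of them, and [synthesis_hcoef]
    identifies any other with it. *)
Lemma coef_hcoef f : mem f -> coef f = hcoef f.
Proof.
move=> hf; rewrite /coef; case: xgetP => [a _ [aN aZ fa]|/(_ (hcoef f))]; last first.
  by move=> /(_ (hcoef_dirichlet hf)).
apply/funext => n; symmetry; move: n.
have b0 n : N n -> 0 <= normc (a n) ^+ 2 / b n.
  by move=> Nn; rewrite mulr_ge0 ?sqr_ge0// invr_ge0 ltW// (adm_bpos adm).
have [Z hZ] := (nneseries_lt_pinfty b0).1 aZ.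
have hZ' M : \sum_(i < M) normc (a i) ^+ 2 / wt i <= Z.
  apply: le_trans (hZ M); apply: ler_sum => n _.
  case: ifPn => [/set_mem Nn|nN]; first by rewrite wtE.
  by rewrite (wt_memN b nN) invr0 mulr0.
apply: (synthesis_hcoef aN hZ' hf) => x.
have [A hA] := coef_abs_bounded aN x hZ'.
have [|z hz] := @abs_sum_Ccvg _ (fun n => a n * npow n (val x)) A.
  by move=> M; apply: le_trans (hA M); apply: ler_sum => n _; rewrite Normc.normcM.
rewrite fa (@csumP _ N _ z)//; apply: eq_Ccvg hz => M; apply: eq_bigr => n _.
by case: ifPn => // nN; rewrite aN ?mul0r// => Nn; apply/negP: nN; rewrite mem_set.
Qed.

End CoefficientSpace.

(** * Dirichlet convolution and the Pick coefficients *)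

Section DirichletConvolution.
Variable K : comNzRingType.
Implicit Types (a b : nat -> K).

(** Summing over the square d, e <= n instead of over divisors lets the range be widened to any M >
    n. Since d * 0 = 0 for all d, this needs sequences that vanish at 0. *)
Definition dconv a b (n : nat) : K :=
  \sum_(d < n.+1) \sum_(e < n.+1) (if (d * e == n)%N then a d * b e else 0).

Lemma dconv_widen a b n M : a 0%N = 0 -> b 0%N = 0 -> (n < M)%N ->
  dconv a b n = \sum_(d < M) \sum_(e < M) (if (d * e == n)%N then a d * b e else 0).
Proof.
move=> a0 b0 nM; rewrite /dconv.
rewrite (big_ord_widen M (fun d => \sum_(e < n.+1)
  (if (d * e == n)%N then a d * b e else 0)) nM) big_mkcond.
apply: eq_bigr => d _.
rewrite (big_ord_widen M (fun e => (if (d * e == n)%N then a d * b e else 0)) nM).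
have [dn|nd] := leqP d n.
  rewrite ltnS dn big_mkcond; apply: eq_bigr => e _; rewrite ltnS.
  have [//|ne] := leqP e n; case: eqP => // de.
  have [d0|d0] := posnP d; first by rewrite d0 a0 mul0r.
  by have := leq_pmull e d0; rewrite de leqNgt ne.
rewrite ltnS leqNgt nd /= big1// => e _; case: eqP => // de.
have [e0|e0] := posnP e; first by rewrite e0 b0 mulr0.
by have := leq_pmulr d e0; rewrite de leqNgt nd.
Qed.

(** The support of [G] cuts the square of pairs down to d e < M, so the rearrangement is exact and
    leaves no remainder. *)
Lemma dconv_sum a b (G : nat -> K) M : a 0%N = 0 -> b 0%N = 0 ->
  (forall n, (M <= n)%N -> G n = 0) ->
  \sum_(n < M) dconv a b n * G n = \sum_(d < M) \sum_(e < M) a d * b e * G (d * e)%N.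
Proof.
move=> a0 b0 GM.
under eq_bigr => n _.
  rewrite (dconv_widen a0 b0 (ltn_ord n)) mulr_suml.
  under eq_bigr => d _ do rewrite mulr_suml.
  over.
rewrite exchange_big; apply: eq_bigr => d _ /=.
rewrite exchange_big; apply: eq_bigr => e _ /=.
have [deM|Mde] := ltnP (d * e) M; last first.
  rewrite (GM _ Mde) mulr0 big1// => n _; rewrite ifN ?mul0r//.
  by rewrite gtn_eqF// (leq_trans (ltn_ord n)).
rewrite (bigD1 (Ordinal deM))//= eqxx big1 ?addr0// => n.
by rewrite -val_eqE /= eq_sym => /negbTE ->; rewrite mul0r.
Qed.

Lemma dconv_delta a n : a 0%N = 0 -> dconv a (fun e => (e == 1%N)%:R) n = a n.
Proof.
move=> a0; rewrite /dconv (bigD1 ord_max)//= [X in _ + X]big1 ?addr0.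
  case: n => [|n]; first by rewrite big_ord1 /= a0 mul0r.
  rewrite (bigD1 (Ordinal (isT : (1 < n.+2)%N)))//= muln1 eqxx mulr1 big1 ?addr0//.
  by move=> e; rewrite -val_eqE /= => /negbTE ->; rewrite mulr0 if_same.
move=> d; rewrite -val_eqE /= => dn; rewrite big1// => e _.
case: eqP => // de; case: eqP => [e1|_]; last by rewrite mulr0.
by move/eqP: dn => []; rewrite -[RHS]de e1 muln1.
Qed.

Lemma dconvDr a b b' n : dconv a (fun e => b e + b' e) n = dconv a b n + dconv a b' n.
Proof.
rewrite /dconv -big_split; apply: eq_bigr => d _ /=.
rewrite -big_split; apply: eq_bigr => e _ /=.
by case: ifP => _; rewrite ?mulrDr ?addr0.
Qed.

Lemma dconv0 a b : a 0%N = 0 -> dconv a b 0 = 0.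
Proof. by move=> a0; rewrite /dconv !big_ord1 /= a0 mul0r. Qed.

Lemma dconv_mull (f a b : nat -> K) n : a 0%N = 0 -> b 0%N = 0 ->
  (forall m n, (0 < m)%N -> (0 < n)%N -> f (m * n)%N = f m * f n) ->
  dconv (fun d => a d * f d) (fun e => b e * f e) n = dconv a b n * f n.
Proof.
move=> a0 b0 fM; rewrite /dconv mulr_suml; apply: eq_bigr => d _.
rewrite mulr_suml; apply: eq_bigr => e _; case: eqP => [de|_]; last by rewrite mul0r.
rewrite -[in f n]de.
have [d0|d0] := posnP d; first by rewrite d0 a0 !mul0r.
have [e0|e0] := posnP e; first by rewrite e0 b0 !(mul0r, mulr0).
by rewrite fM//; ring.
Qed.

Section Inverse.
Variable b : nat -> K.

Definition inv_rest (c : nat -> K) (n : nat) : K :=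
  \sum_(d < n) \sum_(e < n.+1) (if (d * e == n)%N then c d * b e else 0).

(** Course-of-values recursion in structural form: [inv_table n] holds the coefficients below n and
    is 0 beyond. *)
Fixpoint inv_table (n : nat) : nat -> K :=
  if n is n'.+1 then fun m =>
    if m == n' then (if (n' < 2)%N then 0 else b n' - inv_rest (inv_table n') n')
    else inv_table n' m
  else fun=> 0.

(* The coefficients of [1 - 1 / sum_n b_n n^{-s}]. *)
Definition inv_coef (n : nat) : K := inv_table n.+1 n.

Lemma inv_tableE m d : (d < m)%N -> inv_table m d = inv_coef d.
Proof.
elim: m => // m IH; rewrite ltnS leq_eqVlt => /predU1P[->//|dm].
by rewrite /= ltn_eqF// IH.
Qed.

Lemma inv_coef0 : inv_coef 0 = 0.
Proof. by []. Qed.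

Lemma inv_coef1 : inv_coef 1 = 0.
Proof. by []. Qed.

(** For n >= 2 the divisor d = n contributes exactly c_n, because b_1 = 1, and [inv_rest] is the
    contribution of the smaller ones. *)
Lemma inv_coefP : b 0%N = 0 -> b 1%N = 1 ->
  forall n, b n = (n == 1%N)%:R + dconv inv_coef b n.
Proof.
move=> b0 b1 [|[|n]]; first by rewrite dconv0// b0 addr0.
  rewrite /dconv big_ord_recr big_ord1 /= !big1 ?addr0 ?b1//.
  by move=> e _; rewrite inv_coef1 mul0r if_same.
rewrite add0r /dconv big_ord_recr /=.
have -> : \sum_(e < n.+3) (if (n.+2 * e == n.+2)%N then inv_coef n.+2 * b e else 0)
    = inv_coef n.+2.
  rewrite (bigD1 (Ordinal (isT : (1 < n.+3)%N)))//= muln1 eqxx b1 mulr1 big1 ?addr0//.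
  move=> e; rewrite -val_eqE /= => e1; rewrite ifN// -[X in _ != X]muln1.
  by rewrite eqn_pmul2l.
rewrite [X in _ + X]/inv_coef [X in _ + X]/= eqxx /=.
have -> : inv_rest (inv_table n.+2) n.+2 = inv_rest inv_coef n.+2.
  by apply: eq_bigr => d _; apply: eq_bigr => e _; rewrite inv_tableE.
by rewrite addrC subrK.
Qed.

End Inverse.

End DirichletConvolution.

(** * Products of absolutely convergent Dirichlet series *)

Section DirichletProduct.
Variable R : realType.
Local Notation C := R[i].

Lemma sum_dconv_le (a b : nat -> R) M : (forall n, 0 <= a n) ->
  (forall n, 0 <= b n) -> a 0%N = 0 -> b 0%N = 0 ->
  \sum_(n < M) dconv a b n <= (\sum_(d < M) a d) * (\sum_(e < M) b e).
Proof.
move=> ap bp a0 b0.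
have := @dconv_sum _ a b (fun n => if (n < M)%N then 1 else 0) M a0 b0.
under eq_bigr => n _ do rewrite ltn_ord mulr1.
move=> ->; last by move=> n; rewrite leqNgt => /negbTE ->.
rewrite mulr_suml; apply: ler_sum => d _; rewrite mulr_sumr.
apply: ler_sum => e _; case: ifP => _; rewrite ?mulr1// mulr0.
exact: mulr_ge0.
Qed.

Lemma normc_dconv (a b : nat -> C) n :
  normc (dconv a b n) <= dconv (fun d => normc (a d)) (fun e => normc (b e)) n.
Proof.
apply: le_trans (normc_sum _ _ _) _; apply: ler_sum => d _.
apply: le_trans (normc_sum _ _ _) _; apply: ler_sum => e _.
by case: ifP => _; rewrite ?Normc.normcM ?Normc.normc0.
Qed.

(** The sum over d e < M is compared with the sum over the square d, e < m. In absolute value the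
    difference is at most the gap between two products of partial sums of moduli, which is small by
    the Cauchy criterion. *)
Lemma dirichlet_mul (a b : nat -> C) (A B : R) (x y : C) :
  a 0%N = 0 -> b 0%N = 0 ->
  (forall M, \sum_(n < M) normc (a n) <= A) ->
  (forall M, \sum_(n < M) normc (b n) <= B) ->
  Ccvg (fun M => \sum_(n < M) a n) x -> Ccvg (fun M => \sum_(n < M) b n) y ->
  Ccvg (fun M => \sum_(n < M) dconv a b n) (x * y).
Proof.
move=> a0 b0 hA hB ax by_ e e0.
have A0 : 0 <= A by have := hA 0%N; rewrite big_ord0.
have B0 : 0 <= B by have := hB 0%N; rewrite big_ord0.
pose e' := e / (2 * (A + B + 1)).
have e'0 : 0 < e' by rewrite divr_gt0// mulr_gt0//; lra.
have e2 : 0 < e / 2 by rewrite divr_gt0.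
have [K1 h1] := nonneg_sum_cauchy (fun n => normc_ge0 (a n)) hA e'0.
have [K2 h2] := nonneg_sum_cauchy (fun n => normc_ge0 (b n)) hB e'0.
have [K3 h3] := CcvgM ax by_ e2.
pose m := (K1 + K2 + K3).+1.
have K1m : (K1 <= m)%N by rewrite /m; lia.
have K2m : (K2 <= m)%N by rewrite /m; lia.
have K3m : (K3 <= m)%N by rewrite /m; lia.
(* If d, e < m then d e < m^2, so for M >= m^2 the square lies inside the region d e < M. *)
exists (m * m)%N => M mmM.
have mM : (m <= M)%N by apply: leq_trans mmM; rewrite leq_pmulr.
have eP : \sum_(n < M) dconv a b n =
    \sum_(d < M) \sum_(e < M) a d * b e * (if (d * e < M)%N then 1 else 0).
  have := @dconv_sum _ a b (fun n => if (n < M)%N then 1 else 0) M a0 b0.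
  under eq_bigr => n _ do rewrite ltn_ord mulr1.
  by apply=> n; rewrite leqNgt => /negbTE ->.
have eQ (u v : nat -> C) : (\sum_(d < m) u d) * (\sum_(e < m) v e) =
    \sum_(d < M) \sum_(e < M) u d * v e * (if (d < m)%N && (e < m)%N then 1 else 0).
  rewrite (big_ord_widen M u mM) (big_ord_widen M v mM) mulr_suml.
  rewrite big_mkcond; apply: eq_bigr => d _; case: ifP => _ /=.
    rewrite mulr_sumr big_mkcond; apply: eq_bigr => i _.
    by case: ifP; rewrite ?mulr1 ?mulr0.
  by rewrite big1// => i _; rewrite mulr0.
have eQR (u v : nat -> R) : (\sum_(d < m) u d) * (\sum_(e < m) v e) =
    \sum_(d < M) \sum_(e < M) u d * v e * (if (d < m)%N && (e < m)%N then 1 else 0).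
  rewrite (big_ord_widen M u mM) (big_ord_widen M v mM) mulr_suml.
  rewrite big_mkcond; apply: eq_bigr => d _; case: ifP => _ /=.
    rewrite mulr_sumr big_mkcond; apply: eq_bigr => i _.
    by case: ifP; rewrite ?mulr1 ?mulr0.
  by rewrite big1// => i _; rewrite mulr0.
have hPQ : normc (\sum_(n < M) dconv a b n -
      (\sum_(d < m) a d) * (\sum_(e < m) b e)) <=
    (\sum_(d < M) normc (a d)) * (\sum_(e < M) normc (b e)) -
    (\sum_(d < m) normc (a d)) * (\sum_(e < m) normc (b e)).
  rewrite eP eQ (eQR (fun d => normc (a d)) (fun e => normc (b e))).
  rewrite mulr_suml -!sumrB; apply: le_trans (normc_sum _ _ _) _.
  apply: ler_sum => d _; rewrite mulr_sumr -!sumrB.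
  apply: le_trans (normc_sum _ _ _) _; apply: ler_sum => i _.
  rewrite -mulrBr; have [/andP[dm im]|_] := boolP ((d < m)%N && (i < m)%N).
    rewrite (leq_trans _ mmM) ?subrr ?mulr0 ?Normc.normc0 ?mulr1 ?subrr//.
    by rewrite ltn_mul.
  rewrite subr0 mulr0 subr0 !Normc.normcM -[leRHS]mulr1.
  apply: ler_wpM2l; first by rewrite mulr_ge0 ?normc_ge0.
  by case: ifP => _; rewrite ?Normc.normc1 ?Normc.normc0.
have := h3 _ K3m; have := h1 m M; rewrite K1m mM => /(_ isT).
have := h2 m M; rewrite K2m mM => /(_ isT).
have := hA m; have := hB M.
have : 0 <= \sum_(i < m) normc (a i) by apply: sumr_ge0 => i _; exact: normc_ge0.
have : 0 <= \sum_(i < M) normc (b i) by apply: sumr_ge0 => i _; exact: normc_ge0.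
move: hPQ; set am := \sum_(d < m) normc (a d); set aM := \sum_(d < M) normc (a d).
set bm := \sum_(d < m) normc (b d); set bM := \sum_(d < M) normc (b d).
set P := \sum_(n < M) _; set Q := _ * _ => hPQ bM0 am0 bMB amA tb ta tQ.
have amM : am <= aM by apply: (nonneg_sum_le (u := fun i => normc (a i))) => // i; exact: normc_ge0.
have bmM : bm <= bM by apply: (nonneg_sum_le (u := fun i => normc (b i))) => // i; exact: normc_ge0.
have hs : aM * bM - am * bm <= e' * (A + B).
  have -> : aM * bM - am * bm = (aM - am) * bM + am * (bM - bm) by ring.
  apply: (@le_trans _ _ (e' * B + A * e')); last by rewrite mulrDr addrC (mulrC A).
  by apply: lerD; apply: ler_pM; rewrite ?subr_ge0//; exact: ltW.
have he : e' * (A + B) <= e / 2.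
  rewrite /e' mulrAC ler_pdivrMr ?mulr_gt0//; last by lra.
  by nra.
have -> : P - x * y = (P - Q) + (Q - x * y) by ring.
apply: le_lt_trans (le_normcD _ _) _.
move: hPQ tQ; set z1 := normc _; set z2 := normc _; lra.
Qed.

End DirichletProduct.

(** * Nonnegativity of the coefficients of 1 - 1/k *)

Section PickCoefficients.
Variables (R : realType) (N : set nat) (b : nat -> R) (adm : admissible N b).
Local Notation C := R[i].
Local Notation X := (hplane N b).
Local Notation wt := (wt N b).

Definition pc : nat -> R := inv_coef wt.

Lemma pc0 : pc 0 = 0. Proof. exact: inv_coef0. Qed.
Lemma pc1 : pc 1 = 0. Proof. exact: inv_coef1. Qed.

Lemma pcP n : wt n = (n == 1%N)%:R + dconv pc wt n.
Proof. by apply: inv_coefP; [exact: wt0 | exact: wt1]. Qed.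

Lemma dconv_realC (u v : nat -> R) n :
  (dconv u v n)%:C%C = dconv (fun d => (u d)%:C%C) (fun e => (v e)%:C%C) n.
Proof.
rewrite /dconv realC_sum; apply: eq_bigr => d _; rewrite realC_sum.
by apply: eq_bigr => e _; case: ifP => _; rewrite ?rmorphM ?rmorph0.
Qed.

(** This is b = delta_1 + c * b summed against a completely multiplicative function. It also shows
    that k does not vanish where the c-series converges absolutely. *)
Lemma kernel_pick (x y : X) (A : R) (S : C) :
  (forall M, \sum_(n < M) `|pc n| * (normc (npow n (val x)) * normc (npow n (val y))) <= A) ->
  Ccvg (fun M => \sum_(n < M) (pc n)%:C%C * (npow n (val x) * (npow n (val y))^*)) S ->
  kernelX x y = 1 + S * kernelX x y.
Proof.
move=> hA hS; pose f n : C := npow n (val x) * (npow n (val y))^*.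
have fM m n : (0 < m)%N -> (0 < n)%N -> f (m * n)%N = f m * f n.
  by move=> m0 n0; rewrite /f !npowM// rmorphM /=; ring.
have f1 : f 1%N = 1 by rewrite /f !npow1 rmorph1 mulr1.
have fabs n : normc (f n) = normc (npow n (val x)) * normc (npow n (val y)).
  by rewrite /f Normc.normcM normcJ2.
have [B hB] := wt_npow2_bounded adm x y.
have a0 : (pc 0)%:C%C * f 0%N = 0 by rewrite pc0 rmorph0 mul0r.
have b0 : (wt 0)%:C%C * f 0%N = 0 by rewrite (wt0 adm) rmorph0 mul0r.
have hA' M : \sum_(n < M) normc ((pc n)%:C%C * f n) <= A.
  apply: le_trans (hA M); apply: ler_sum => n _.
  by rewrite Normc.normcM fabs normc_real.
have hB' M : \sum_(n < M) normc ((wt n)%:C%C * f n) <= B.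
  apply: le_trans (hB M); apply: ler_sum => n _.
  by rewrite Normc.normcM fabs normc_pos ?(wt_ge0 adm).
have h := dirichlet_mul (a := fun n => (pc n)%:C%C * f n)
  (b := fun n => (wt n)%:C%C * f n) a0 b0 hA' hB' hS (kernelXP adm x y).
apply: Ccvg_unique (kernelXP adm x y) _.
apply: (@Ccvg_near _ _ _ _ 2) (CcvgD (Ccvg_cst 1) h) => M M1.
under [RHS]eq_bigr => n _ do rewrite -/(f n) pcP rmorphD /= mulrDl.
rewrite big_split /=; congr (_ + _).
  rewrite (bigD1 (Ordinal M1))//= rmorph1 f1 mulr1 big1 ?addr0// => i.
  by rewrite -val_eqE /= => /negbTE ->; rewrite rmorph0 mul0r.
apply: eq_bigr => n _; rewrite dconv_realC.
have [p0 w0] : (pc 0)%:C%C = 0 :> C /\ (wt 0)%:C%C = 0 :> C.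
  by rewrite pc0 (wt0 adm) rmorph0.
rewrite (dconv_mull (a := fun d => (pc d)%:C%C) (b := fun e => (wt e)%:C%C) n p0 w0 fM)//.
Qed.

(** With b' the weights without their value at 1, c = b' - c * b'. Far to the right b' has sum at
    most 1/2, so a partial sum D of the moduli satisfies D <= 1/2 + D/2, whatever the signs of c. *)
Lemma pc_abs_bounded : exists2 s1 : R, (sigma_a N b < s1%:E)%E &
  forall M, \sum_(n < M) `|pc n| * dn n s1 ^+ 2 <= 1.
Proof.
have [s0 h0] := real_point_exists adm.
have [A hA] := wt_dn_bounded adm h0.
(* [dn 2 2] is 1/4. Moving right by j multiplies the term of each n >= 2 by at most 4^{-j}; j is
   chosen so that the bound on their sum falls below 1/2. *)
have r1 : dn 2 2 < (1 : R) by rewrite -[X in _ < X](dn0 R 2) ltr_dn.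
have half0 : 0 < 1 / 2 :> R by rewrite divr_gt0.
have [j hj] := exp_small A (dn_ge0 2 2) r1 half0.
have {hj} hj : A * dn 2 (2 * j%:R) < 1 / 2.
  have -> : dn 2 (2 * j%:R) = dn 2 2 ^+ j :> R.
    by elim: j {hj} => [|j IH]; rewrite ?mulr0 ?dn0// -[j.+1%:R]natr1 mulrDr mulr1 dnD IH exprSr.
  exact: hj.
pose s1 := s0 + j%:R.
have h1 : (sigma_a N b < s1%:E)%E by exact: shift_subproof.
exists s1 => //.
pose wt' n := if (1 < n)%N then wt n else 0.
have wt'p n : 0 <= wt' n by rewrite /wt'; case: ifP => // _; exact: wt_ge0.
have wtE' n : wt n = (n == 1%N)%:R + wt' n.
  by case: n => [|[|n]]; rewrite /wt' ?(wt0 adm) ?(wt1 adm) /= ?add0r ?addr0.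
have pcE n : pc n = wt' n - dconv pc wt' n.
  have := pcP n; rewrite wtE' (_ : dconv pc wt n = dconv pc (fun e => (e == 1%N)%:R + wt' e) n).
    by rewrite dconvDr dconv_delta ?pc0// => /addrI ->; rewrite addrK.
  by rewrite /dconv; apply: eq_bigr => d _; apply: eq_bigr => e _; rewrite wtE'.
have half M : \sum_(n < M) wt' n * dn n s1 ^+ 2 <= 1 / 2.
  apply: le_trans (ltW hj).
  apply: le_trans (ler_wpM2r (dn_ge0 _ _) (hA M)).
  rewrite mulr_suml; apply: ler_sum => n _.
  rewrite /wt'; case: ifP => [n1|_]; last first.
    by rewrite mul0r !mulr_ge0 ?dn_ge0 ?(wt_ge0 adm)// sqr_ge0.
  rewrite -mulrA ler_wpM2l ?(wt_ge0 adm)//.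
  rewrite /s1 dnD exprMn ler_wpM2l ?sqr_ge0// -dn_mul2.
  rewrite /dn ler_expR lerN2 ler_wpM2l//.
  by rewrite ler_ln ?posrE ?ltr0n ?ler_nat// (ltn_trans _ n1).
move=> M; set D := \sum_(n < M) _.
have pcn0 : `|pc 0| = 0 by rewrite pc0 normr0.
have wt'0 : wt' 0%N = 0 by [].
suff : D <= 1 / 2 + D * (1 / 2) by lra.
have hd : D <= \sum_(n < M) wt' n * dn n s1 ^+ 2 +
    \sum_(n < M) dconv (fun d => `|pc d| * dn d s1 ^+ 2) (fun e => wt' e * dn e s1 ^+ 2) n.
  rewrite -big_split; apply: ler_sum => n _ /=.
  rewrite dconv_mull//; last by move=> m m' m0 m'0; rewrite dnM// exprMn.
  rewrite -mulrDl ler_wpM2r ?sqr_ge0// pcE (le_trans (ler_normB _ _))//.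
  rewrite (ger0_norm (wt'p _)) lerD2l /dconv.
  rewrite (le_trans (ler_norm_sum _ _ _))//; apply: ler_sum => d _.
  rewrite (le_trans (ler_norm_sum _ _ _))//; apply: ler_sum => e _.
  by case: ifP; rewrite ?normr0// normrM (ger0_norm (wt'p _)).
apply: le_trans hd _; apply: lerD => //.
apply: le_trans (sum_dconv_le _ _ _ _ _) _.
- by move=> n; rewrite mulr_ge0 ?sqr_ge0.
- by move=> n; rewrite mulr_ge0 ?sqr_ge0.
- by rewrite pcn0 mul0r.
- by rewrite wt'0 mul0r.
- apply: ler_wpM2l => //; apply: sumr_ge0 => n _.
  by rewrite mulr_ge0 ?sqr_ge0.
Qed.

Variable (H : rkhs (@kernelX R N b)).

Theorem pc_ge0 : complete_pick H -> forall n, 0 <= pc n.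
Proof.
move=> pick n; have [n0|n0] := posnP n; first by rewrite n0 pc0.
have [s1 h1 hA] := pc_abs_bounded.
pose a m : C := (pc m * dn m s1 ^+ 2)%:C%C.
have a0 : a 0%N = 0 by rewrite /a pc0 mul0r rmorph0.
have aabs m : normc (a m) = `|pc m| * dn m s1 ^+ 2.
  by rewrite /a normc_real normrM (ger0_norm (sqr_ge0 _)).
have inv1 m : (0 < m)%N -> m%:R^-1 <= 1 :> R.
  by move=> m0; rewrite invf_le1 ?ltr0n// ler1n.
have exS (j : nat) : exists S, Ccvg (fun M => \sum_(m < M) a m * (m%:R^-1 ^+ j)%:C%C) S.
  apply: (@abs_sum_Ccvg _ (fun m => a m * (m%:R^-1 ^+ j)%:C%C) 1) => M.
  apply: le_trans (hA M); apply: ler_sum => m _.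
  have [m0|m0] := posnP m.
    by rewrite m0 a0 mul0r Normc.normc0 pc0 normr0 mul0r.
  rewrite Normc.normcM aabs normc_pos ?exprn_ge0 ?invr_ge0//.
  apply: ler_piMr; first exact: (mulr_ge0 (normr_ge0 _) (sqr_ge0 _)).
  by rewrite exprn_ile1 ?invr_ge0// inv1.
have {exS} [S hS] := choice exS.
pose p j := shift_point h1 j.
(* At the points s1 + i and s1 + j, the entry 1 - 1/k depends on i + j alone: it is a moment of the
   weights a_m placed at 1/m. *)
have kS i j : kernelX (p i) (p j) = 1 + S (i + j)%N * kernelX (p i) (p j).
  apply: (kernel_pick (A := 1)).
    move=> M; apply: le_trans (hA M); apply: ler_sum => m _.
    have [m0|m0] := posnP m.
      by rewrite m0 pc0 normr0 !mul0r.
    rewrite ler_wpM2l// !npow_shift// !normc_pos ?mulr_ge0 ?dn_ge0 ?exprn_ge0 ?invr_ge0//.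
    rewrite mulrACA -expr2 -exprD; apply: ler_piMr; first exact: sqr_ge0.
    by rewrite exprn_ile1 ?invr_ge0// inv1.
  apply: eq_Ccvg (hS (i + j)%N) => M; apply: eq_bigr => m _.
  have [m0|m0] := posnP m; first by rewrite m0 a0 pc0 rmorph0 !mul0r.
  by rewrite !npow_shift// conjC_realC /a -!rmorphM exprD; congr (_%:C%C); ring.
have k1 i j : kernelX (p i) (p j) != 0.
  apply/eqP => k0; have := kS i j; rewrite k0 mulr0 addr0.
  by move/eqP; rewrite eq_sym oner_eq0.
pose Y x := x = ipoint N b \/ exists j, x = p j.
have Yk x y : Y x -> Y y -> kernelX x y != 0.
  move=> [->|[i ->]] [->|[j ->]]; rewrite ?kernel_ipoint ?oner_eq0//.
  by rewrite (kernelC H) kernel_ipoint// conjC1 oner_eq0.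
pose q J := peak R n J.
have pos J : 0 <= \sum_(i < size (q J)) ((q J)`_i)%:C%C *
    \sum_(j < size (q J)) ((q J)`_j)%:C%C * S (i + j)%N.
  have := @mccullough_quiggin _ _ _ H Y pick Yk (size (q J)) (ipoint N b)
    (fun i => p i) (or_introl erefl) (fun i => or_intror (ex_intro _ _ erefl))
    (fun i => ((q J)`_i)%:C%C).
  congr (0 <= _); apply: eq_bigr => i _; rewrite mulr_sumr; apply: eq_bigr => j _.
  rewrite conjC_realC -mulrA; congr (_ * _); rewrite mulrC; congr (_ * _).
  rewrite (kernel_ipoint adm) (kernelC H (ipoint N b) (p j)) !(kernel_ipoint adm).
  rewrite conjC1 !mulr1 div1r.
  have := k1 i j; have := kS i j; set k := kernelX _ _ => e k0.
  by apply: (mulIf k0); rewrite mulrBl mul1r mulVf// [X in X - 1]e addrAC subrr add0r.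
(* The quadratic form equals sum_m a_m q_J(1/m)^2, and the square of the peak of order J is the peak
   of order 2 J. Nonnegativity of the form therefore passes to the limit a_n. *)
have lim J : Ccvg (fun M => \sum_(m < M) a m * ((peak R n (J + J)).[m%:R^-1])%:C%C)
    (\sum_(i < size (q J)) ((q J)`_i)%:C%C *
      \sum_(j < size (q J)) ((q J)`_j)%:C%C * S (i + j)%N).
  have inner i : Ccvg (fun M => \sum_(m < M)
      a m * ((q J).[m%:R^-1])%:C%C * (m%:R^-1 ^+ i)%:C%C)
      (\sum_(j < size (q J)) ((q J)`_j)%:C%C * S (i + j)%N).
    have inner2 j : Ccvg (fun M => \sum_(m < M)
        a m * (m%:R^-1 ^+ i)%:C%C * (m%:R^-1 ^+ j)%:C%C) (S (i + j)%N).
      apply: eq_Ccvg (hS (i + j)%N) => M; apply: eq_bigr => m _.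
      by rewrite exprD rmorphM mulrA.
    have := Ccvg_horner (a := fun m => a m * (m%:R^-1 ^+ i)%:C%C)
      (F := fun j => S (i + j)%N) (q J) inner2.
    by apply: eq_Ccvg => M; apply: eq_bigr => m _; rewrite mulrAC.
  have := Ccvg_horner (a := fun m => a m * ((q J).[m%:R^-1])%:C%C)
    (F := fun i => \sum_(j < size (q J)) ((q J)`_j)%:C%C * S (i + j)%N) (q J) inner.
  apply: eq_Ccvg => M; apply: eq_bigr => m _.
  by rewrite -mulrA -rmorphM /q !peakE -exprD.
have lim1 J : Ccvg (fun M => \sum_(m < M) a m * ((peak R n J).[m%:R^-1])%:C%C)
    (\sum_(i < size (q J)) ((q J)`_i)%:C%C * S i) by exact: Ccvg_horner.
have lim2 := peak_limit n0 a0 (A := 1) _ lim1.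
have {}lim2 : Ccvg (fun J => \sum_(i < size (q J)) ((q J)`_i)%:C%C * S i) (a n).
  by apply: lim2 => M; under eq_bigr => m _ do rewrite aabs.
have d0 : 0 < dn n s1 ^+ 2 by rewrite exprn_gt0// dn_gt0.
rewrite -(pmulr_lge0 _ d0).
have lim3 := Ccvg_sub (s := fun J => (J + J)%N) (fun J => leq_addr J J) lim2.
apply: (Ccvg_real_ge (v := fun J => complex.Re (\sum_(i < size (q (J + J)%N))
  ((q (J + J)%N)`_i)%:C%C * S i)) (z := a n) (M := 0)).
  exists 0%N => J _; rewrite -(Ccvg_unique (lim J) (lim1 (J + J)%N)).
  by move: (pos J); rewrite lecE => /andP[].
apply: eq_Ccvg lim3 => J; rewrite -(Ccvg_unique (lim J) (lim1 (J + J)%N)).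
exact: ge0_real.
Qed.

End PickCoefficients.

(** * The function 1 - 1/k(t, t) *)

Section PickSum.
Variables (R : realType) (N : set nat) (b : nat -> R) (adm : admissible N b).
Local Notation C := R[i].
Local Notation X := (hplane N b).
Local Notation wt := (wt N b).
Local Notation pc := (pc N b).
Local Notation sa := (sigma_a N b).
Hypothesis pcp : forall n, 0 <= pc n.

Lemma kernel_diagP (s : X) : Ccvg (fun M =>
  (\sum_(n < M) wt n * normc (npow n (val s)) ^+ 2)%:C%C) (kernelX s s).
Proof.
apply: eq_Ccvg (kernelXP adm s s) => M; rewrite realC_sum.
by apply: eq_bigr => n _; rewrite mulJc -rmorphM.
Qed.

Lemma kernel_diag_real (s : X) : kernelX s s = (complex.Re (kernelX s s))%:C%C.
Proof. exact: Ccvg_real (kernel_diagP s). Qed.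

Lemma wt_sum_le (s : X) M :
  \sum_(n < M) wt n * normc (npow n (val s)) ^+ 2 <= complex.Re (kernelX s s).
Proof.
apply: (Ccvg_real_ge _ (kernel_diagP s)); exists M => m Mm.
apply: (nonneg_sum_le (u := fun n => wt n * normc (npow n (val s)) ^+ 2)) => // i.
exact: (mulr_ge0 (wt_ge0 adm _) (sqr_ge0 _)).
Qed.

Lemma wt_sum_ge1 (s : X) M : (1 < M)%N ->
  1 <= \sum_(n < M) wt n * normc (npow n (val s)) ^+ 2.
Proof.
move=> M1; rewrite (bigD1 (Ordinal M1))//= (wt1 adm) npow1 Normc.normc1 mul1r expr1n.
rewrite lerDl; apply: sumr_ge0 => i _.
exact: (mulr_ge0 (wt_ge0 adm _) (sqr_ge0 _)).
Qed.

Lemma kernel_diag_ge1 (s : X) : 1 <= complex.Re (kernelX s s).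
Proof. by apply: le_trans (wt_sum_le s 2); exact: wt_sum_ge1. Qed.

(** As c >= 0, the product of the partial sums of c and b below m is part of the sum of c * b <= b
    below m^2, while the factor from b is at least 1. Hence the c-series converges on all of X. *)
Lemma pc_sum_bounded (s : X) M :
  \sum_(n < M) pc n * normc (npow n (val s)) ^+ 2 <= complex.Re (kernelX s s).
Proof.
pose f n : R := normc (npow n (val s)) ^+ 2.
have f0 n : 0 <= f n by exact: sqr_ge0.
have fM m n : (0 < m)%N -> (0 < n)%N -> f (m * n)%N = f m * f n.
  by move=> m0 n0; rewrite /f npowM// Normc.normcM exprMn.
pose m := M.+2; have mp : (M <= m)%N by rewrite /m; lia.
have pf n : 0 <= pc n * f n by rewrite mulr_ge0.
have wf n : 0 <= wt n * f n by rewrite mulr_ge0// (wt_ge0 adm).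
apply: le_trans (nonneg_sum_le pf mp) _.
apply: le_trans (wt_sum_le s (m * m)).
apply: (@le_trans _ _ ((\sum_(n < m) pc n * f n) * (\sum_(n < m) wt n * f n))).
  rewrite ler_peMr ?wt_sum_ge1//; apply: sumr_ge0 => i _; exact: pf.
apply: (@le_trans _ _ (\sum_(n < m * m) dconv pc wt n * f n)); last first.
  apply: ler_sum => n _; rewrite ler_wpM2r// [leRHS](pcP adm) lerDr.
  exact: ler0n.
have hd n : dconv pc wt n * f n = dconv (fun d => pc d * f d) (fun e => wt e * f e) n.
  by rewrite dconv_mull// ?(wt0 adm)// pc0.
under [leRHS]eq_bigr => n _ do rewrite hd.
have p0 : pc 0 * f 0%N = 0 by rewrite pc0 mul0r.
have w0 : wt 0 * f 0%N = 0 by rewrite (wt0 adm) mul0r.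
have := @dconv_sum _ (fun d => pc d * f d) (fun e => wt e * f e)
  (fun n => if (n < m * m)%N then 1 else 0) (m * m) p0 w0.
rewrite (eq_bigr (fun n : 'I_(m * m) =>
  dconv (fun d => pc d * f d) (fun e => wt e * f e) n)); last first.
  by move=> n _; rewrite ltn_ord mulr1.
move=> ->; last by move=> n; rewrite leqNgt => /negbTE ->.
have mm : (m <= m * m)%N by rewrite leq_pmulr.
rewrite (big_ord_widen _ (fun n => pc n * f n) mm).
rewrite (big_ord_widen _ (fun n => wt n * f n) mm) mulr_suml big_mkcond.
apply: ler_sum => d _; case: ifP => [dm|_]; last first.
  apply: sumr_ge0 => e _; case: ifP => _; rewrite ?mulr0// mulr1.
  exact: mulr_ge0.
rewrite mulr_sumr big_mkcond; apply: ler_sum => e _; case: ifP => [em|_].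
  by rewrite ltn_mul ?mulr1.
by case: ifP => _; rewrite ?mulr0// mulr1 mulr_ge0.
Qed.

Lemma pick_sumP (s : X) : Ccvg (fun M =>
    (\sum_(n < M) pc n * normc (npow n (val s)) ^+ 2)%:C%C)
  (1 - (complex.Re (kernelX s s))^-1)%:C%C.
Proof.
have hb := pc_sum_bounded s.
have pf n : 0 <= pc n * normc (npow n (val s)) ^+ 2 by rewrite mulr_ge0 ?sqr_ge0.
have [S hS] : exists S, Ccvg (fun M => \sum_(n < M)
    (pc n * normc (npow n (val s)) ^+ 2)%:C%C) S.
  apply: (@abs_sum_Ccvg _ (fun n => (pc n * normc (npow n (val s)) ^+ 2)%:C%C)
    (complex.Re (kernelX s s))) => M.
  by under eq_bigr => n _ do rewrite normc_pos//.
have hk : kernelX s s = 1 + S * kernelX s s.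
  apply: (kernel_pick adm (A := complex.Re (kernelX s s))).
    by move=> M; under eq_bigr => n _ do rewrite ger0_norm// -expr2.
  apply: eq_Ccvg hS => M; apply: eq_bigr => n _.
  by rewrite mulJc -rmorphM.
have k0 : kernelX s s != 0.
  rewrite kernel_diag_real eq_complex /= eqxx andbT gt_eqF//.
  exact: lt_le_trans (kernel_diag_ge1 s).
suff <- : S = (1 - (complex.Re (kernelX s s))^-1)%:C%C.
  by apply: eq_Ccvg hS => M; rewrite realC_sum.
rewrite rmorphB rmorph1 fmorphV /= -kernel_diag_real.
by apply: (mulIf k0); rewrite mulrBl mul1r mulVf// [X in X - 1]hk addrAC subrr add0r.
Qed.

Definition psum (M : nat) (t : R) : R := \sum_(n < M) pc n * dn n t ^+ 2.

Lemma psumE M t : psum M t = \sum_(n < M) pc n * dn n t ^+ 2.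
Proof. by []. Qed.

(** The sum of the c-series at t in closed form, so that it is defined without a convergence
    proof. *)
Definition pv (t : R) : R :=
  1 - (complex.Re (kernel_at N b (Some t%:C%C) (Some t%:C%C)))^-1.

Lemma psum_le_pv t M : (sa < t%:E)%E -> psum M t <= pv t.
Proof.
move=> h; have hp := pick_sumP (rpoint h).
apply: (@le_trans _ _ (complex.Re (pv t)%:C%C)) => //.
apply: (Ccvg_real_ge _ hp); exists M => m Mm; rewrite /psum.
have -> : \sum_(n < m) pc n * normc (npow n (val (rpoint h))) ^+ 2 =
    \sum_(n < m) pc n * dn n t ^+ 2.
  by apply: eq_bigr => n _; rewrite npow_real normc_pos ?dn_ge0.
apply: (nonneg_sum_le (u := fun n => pc n * dn n t ^+ 2)) => // i.
by rewrite mulr_ge0 ?sqr_ge0.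
Qed.

Lemma pv_le t A : (sa < t%:E)%E -> (forall M, psum M t <= A) -> pv t <= A.
Proof.
move=> h hA; have hp := pick_sumP (rpoint h).
change (complex.Re (pv t)%:C%C <= A).
apply: (Ccvg_real_le _ hp); exists 0%N => m _; apply: le_trans (hA m).
rewrite le_eqVlt; apply/orP; left; apply/eqP.
by apply: eq_bigr => n _; rewrite npow_real normc_pos ?dn_ge0.
Qed.

Lemma pv_lt1 t : (sa < t%:E)%E -> pv t < 1.
Proof.
move=> h; rewrite /pv ltrBlDr ltrDl invr_gt0.
exact: lt_le_trans (kernel_diag_ge1 (rpoint h)).
Qed.

(** 9/8 is the value of k for which 1 - 1/k = 1/9. *)
Lemma kernel_at_pv t : (sa < t%:E)%E ->
  (kernel_at N b (Some t%:C%C) (Some t%:C%C) = 9 / 8 <-> pv t = 1 / 9).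
Proof.
move=> h; have := kernel_diag_real (rpoint h).
have := kernel_diag_ge1 (rpoint h); rewrite /kernelX /= /pv.
set k := kernel_at _ _ _ _ => k1 kr.
have k0 : complex.Re k != 0 by rewrite gt_eqF// (lt_le_trans _ k1).
have e98 : (9 / 8 : R)%:C%C = 9 / 8 :> C.
  by rewrite rmorphM fmorphV !rmorph_nat.
split=> [e|e].
  have -> : complex.Re k = 9 / 8 by apply: (@complexI R); rewrite -kr e e98.
  by field.
rewrite kr -e98; congr (_%:C%C).
have e2 : (complex.Re k)^-1 = 8 / 9 by move: e; set u := _^-1; lra.
by rewrite -[LHS]invrK e2 invf_div.
Qed.

(** If c vanished, then b = delta_1 and [N] would be {1}. *)
Lemma pc_pos_exists : exists2 n, (1 < n)%N & 0 < pc n.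
Proof.
apply: contrapT => hn.
have pz n : pc n = 0.
  have [n1|n1] := ltnP 1 n.
    apply/eqP; rewrite eq_le pcp andbT leNgt; apply/negP => pn.
    by apply: hn; exists n.
  by case: n n1 => [|[|n]] // _; rewrite ?pc0 ?pc1.
apply: (adm_neq adm); apply/seteqP; split => n /=; last first.
  by move=> ->; exact: (adm_one adm).
move=> Nn; have := wt_gt0 adm Nn; rewrite (pcP adm) /dconv big1 ?addr0.
  by case: eqP => // _; rewrite ltxx.
by move=> d _; rewrite big1// => e _; rewrite pz mul0r if_same.
Qed.

Lemma pv_gt0 t : (sa < t%:E)%E -> 0 < pv t.
Proof.
move=> h; have [n n1 pn] := pc_pos_exists.
apply: lt_le_trans (psum_le_pv n.+1 h).
rewrite /psum big_ord_recr /=; apply: ltr_wpDl.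
  by apply: sumr_ge0 => i _; rewrite mulr_ge0 ?sqr_ge0.
by rewrite mulr_gt0// exprn_gt0// dn_gt0.
Qed.

Lemma pc_dn2 (n : nat) (h : R) : 0 <= h -> pc n * dn n h ^+ 2 <= pc n * dn 2 h ^+ 2.
Proof.
move=> h0; have [n1|n1] := ltnP 1 n; last first.
  by case: n n1 => [|[|n]] // _; rewrite ?pc0 ?pc1 !mul0r.
rewrite ler_wpM2l// lerXn2r ?nnegrE ?dn_ge0// /dn ler_expR lerN2 ler_wpM2l//.
by rewrite ler_ln ?posrE ?ltr0n ?ler_nat// (ltn_trans _ n1).
Qed.

(** c lives on n >= 2, and there n^{-2h} <= 2^{-2h}. *)
Lemma psum_shift M t h : 0 <= h -> psum M (t + h) <= dn 2 h ^+ 2 * psum M t.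
Proof.
move=> h0; rewrite /psum mulr_sumr; apply: ler_sum => n _.
rewrite dnD exprMn mulrCA.
rewrite [leRHS](_ : _ = dn n t ^+ 2 * (pc n * dn 2 h ^+ 2)); last by ring.
by rewrite ler_wpM2l ?sqr_ge0// pc_dn2.
Qed.

Lemma pv_shift t h : (sa < t%:E)%E -> 0 <= h -> pv (t + h) <= dn 2 h ^+ 2 * pv t.
Proof.
move=> ht h0; have hth : (sa < (t + h)%:E)%E.
  by apply: lt_le_trans ht _; rewrite lee_fin lerDl.
apply: pv_le => // M; apply: le_trans (psum_shift _ _ h0) _.
by rewrite ler_wpM2l ?sqr_ge0// psum_le_pv.
Qed.

Lemma pv_decr s t : (sa < s%:E)%E -> s < t -> pv t < pv s.
Proof.
move=> hs st; rewrite -(subrKC s t) //.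
apply: le_lt_trans (pv_shift hs _) _; first by rewrite subr_ge0 ltW.
rewrite gtr_pMl ?pv_gt0// -(expr1n _ 2) ltrXn2r ?nnegrE ?dn_ge0//.
by rewrite -[X in _ < X](dn0 R 2) ltr_dn// subr_gt0.
Qed.

Lemma ln_nat_ge0 M : 0 <= ln M%:R :> R.
Proof. by case: M => [|M]; [rewrite ln0 | rewrite ln_ge0// ler1n]. Qed.

(* [exp x >= 1 + x] makes the partial sums lower semicontinuous from the right. *)
Lemma psum_right M t h : 0 <= h ->
  psum M t * (1 - 2 * h * ln M%:R) <= psum M (t + h).
Proof.
move=> h0; rewrite /psum mulr_suml; apply: ler_sum => n _.
rewrite dnD exprMn [leRHS](_ : _ = pc n * dn n t ^+ 2 * dn n h ^+ 2); last by ring.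
rewrite (ler_wpM2l (mulr_ge0 (pcp n) (sqr_ge0 _)))//.
rewrite -dn_mul2 /dn; apply: le_trans (expR_ge1Dx _).
rewrite lerD2l lerN2 ler_wpM2l ?mulr_ge0//.
have [n0|n0] := posnP n; first by rewrite n0 ln0// ln_nat_ge0.
by rewrite ler_ln ?posrE ?ltr0n ?ler_nat ?(ltnW (ltn_ord n))// (leq_ltn_trans _ (ltn_ord n)).
Qed.

(** If the abscissa were -oo, some t would make a single term c_n n^{-2t} equal to 1, against the
    strict bound 1 for the whole sum; t = log c_n / (2 log n) does this. *)
Lemma sigma_a_fin : exists r, sa = r%:E.
Proof.
have := adm_sigma adm; have [n n1 pn] := pc_pos_exists.
case e : sa => [r| |] // _; first by exists r.
pose t := ln (pc n) / (2 * ln n%:R).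
have h : (sa < t%:E)%E by rewrite e ltNyr.
have ln0 : 0 < ln n%:R :> R by rewrite ln_gt0// ltr1n.
have := lt_le_trans (le_lt_trans (psum_le_pv n.+1 h) (pv_lt1 h)) (lexx _).
rewrite ltNge => /negP; case; rewrite /psum big_ord_recr /= -dn_mul2.
rewrite -[leLHS]add0r; apply: lerD.
  by apply: sumr_ge0 => i _; rewrite mulr_ge0 ?sqr_ge0.
rewrite /dn /t (_ : - _ = - ln (pc n)); last by field; rewrite gt_eqF.
by rewrite expRN lnK ?posrE// mulfV// gt_eqF.
Qed.

(** The bound holds to the right of the abscissa, and [psum_right] moves it to the abscissa for each
    finite sum, even if k is infinite there. *)
Lemma psum_le1 r M : sa = r%:E -> psum M r <= 1.
Proof.
move=> e; apply/ler_addgt0Pr => eps eps0.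
have p0 : 0 <= psum M r by apply: sumr_ge0 => i _; rewrite mulr_ge0 ?sqr_ge0.
have l0 : 0 <= ln M%:R :> R.
  exact: ln_nat_ge0.
pose D := 2 * ln M%:R * psum M r + 1.
have D0 : 0 < D by rewrite ltr_wpDl// !mulr_ge0.
pose h := eps / D; have h0 : 0 < h by rewrite divr_gt0.
have hs : (sa < (r + h)%:E)%E by rewrite e lte_fin ltrDl.
have := psum_right M r (ltW h0); have := psum_le_pv M hs; have := pv_lt1 hs.
have : h * D = eps by rewrite divfK// gt_eqF.
by rewrite /D; set x := psum M r; set y := psum M _; nra.
Qed.

Lemma pv_bound r h : sa = r%:E -> 0 < h -> pv (r + h) <= dn 2 h ^+ 2.
Proof.
move=> e h0; apply: pv_le => [|M]; first by rewrite e lte_fin ltrDl.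
apply: le_trans (psum_shift _ _ (ltW h0)) _.
by rewrite ler_piMr ?sqr_ge0// psum_le1.
Qed.

Definition delta0 : R := ln 3 / ln 2.

Lemma delta0_gt0 : 0 < delta0.
Proof. by rewrite divr_gt0// ln_gt0// ltr1n. Qed.

Lemma dn2_delta0 : dn 2 delta0 = 1 / 3.
Proof.
rewrite /dn /delta0 divfK; last by rewrite gt_eqF// ln_gt0// ltr1n.
by rewrite expRN lnK ?posrE// div1r.
Qed.

(** Each n^{-2t} is convex in t. This controls the sums to the left of t, uniformly in M, as
    [psum_right] controls them to the right. *)
Lemma psum_convex M (t eta h : R) : 0 < eta -> 0 <= h -> h <= eta ->
  psum M (t - h) <= (1 - h / eta) * psum M t + h / eta * psum M (t - eta).
Proof.
move=> eta0 h0 heta; rewrite /psum !mulr_sumr -big_split /=; apply: ler_sum => n _.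
have hd (u : R) : dn n (- u) ^+ 2 = expR (2 * u * ln n%:R).
  by rewrite -dn_mul2 /dn; congr expR; ring.
rewrite (dnD n t (- h)) (dnD n t (- eta)) !exprMn (hd h) (hd eta).
have -> (D E x : R) : (1 - x) * (pc n * D) + x * (pc n * (D * E)) =
  pc n * D * ((1 - x) + x * E) by ring.
rewrite [leLHS]mulrA (ler_wpM2l (mulr_ge0 (pcp n) (sqr_ge0 _)))//.
set y := 2 * eta * ln n%:R; set th := h / eta.
(* Convexity of the exponential, from its tangent line at [th * y]. *)
have -> : 2 * h * ln n%:R = th * y.
  by rewrite /th /y; field; rewrite gt_eqF.
have th0 : 0 <= th by rewrite divr_ge0// ltW.
have th1 : th <= 1 by rewrite ler_pdivrMr// mul1r.
have e0 : 0 < expR (th * y) by exact: expR_gt0.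
have h1 : expR (th * y) * (1 - th * y) <= 1.
  apply: (@le_trans _ _ (expR (th * y) * expR (- (th * y)))).
    by rewrite ler_wpM2l ?expR_ge0// expR_ge1Dx.
  by rewrite -expRD subrr expR0.
have h2 : expR (th * y) * (1 + (1 - th) * y) <= expR y.
  apply: (@le_trans _ _ (expR (th * y) * expR ((1 - th) * y))).
    by rewrite ler_wpM2l ?expR_ge0// expR_ge1Dx.
  by rewrite -expRD -mulrDl addrC subrK mul1r.
have h3 : (1 - th) * (expR (th * y) * (1 - th * y)) <= (1 - th) * 1.
  by rewrite ler_wpM2l// subr_ge0.
have h4 : th * (expR (th * y) * (1 + (1 - th) * y)) <= th * expR y.
  by rewrite ler_wpM2l.
have : expR (th * y) = (1 - th) * (expR (th * y) * (1 - th * y)) +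
  th * (expR (th * y) * (1 + (1 - th) * y)) by ring.
by rewrite mulr1 in h3; lra.
Qed.

(** The value 1/9 is attained at the supremum of the points where [pv] exceeds 1/9; the one-sided
    estimates on [psum] stand in for continuity. *)
Lemma critical_exists t : (sa < t%:E)%E -> 1 / 9 < pv t -> exists vs, critical N b vs.
Proof.
move=> ht hpt; have [r er] := sigma_a_fin.
pose E := [set s | r < s /\ 1 / 9 < pv s].
have Et : E t by split => //; rewrite -lte_fin -er.
have Eub s : E s -> s <= r + delta0.
  move=> [rs hs]; rewrite leNgt; apply/negP => hlt; move: hs; apply/negP.
  have rd : (sa < (r + delta0)%:E)%E by rewrite er lte_fin ltrDl delta0_gt0.
  rewrite -leNgt; apply: le_trans (ltW (pv_decr rd hlt)) _.
  apply: le_trans (pv_bound er delta0_gt0) _.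
  by rewrite dn2_delta0; lra.
have hE : has_sup E by split; [exists t | exists (r + delta0) => s /Eub].
have [vs evs] : exists vs, vs = sup E by exists (sup E).
have ubE s : E s -> s <= vs by rewrite evs; apply: ub_le_sup; case: hE.
have tvs : t <= vs by exact: ubE.
have vsd : vs <= r + delta0 by rewrite evs; apply: ge_sup => [|s /Eub//]; exists t.
have rt : r < t by case: Et.
have rvs : r < vs by exact: lt_le_trans tvs.
have svs : (sa < vs%:E)%E by rewrite er lte_fin.
exists vs; split => //.
  by rewrite er -EFinD lee_fin.
apply/(kernel_at_pv svs)/eqP; rewrite eq_le; apply/andP; split.
  apply: pv_le => // M; rewrite leNgt; apply/negP => hM.
  have l0 : 0 <= ln M%:R :> R.
    exact: ln_nat_ge0.
  have x0 : 0 < psum M vs by apply: lt_trans hM; rewrite divr_gt0.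
  have [x ex] : exists x, x = psum M vs by exists (psum M vs).
  rewrite -ex in hM x0; pose D := 2 * ln M%:R * x + 1.
  have D0 : 0 < D by rewrite ltr_wpDl// !mulr_ge0// ltW.
  (* With this h, the loss 2 h x log M from [psum_right] is less than half the excess of x over 1/9,
     so vs + h would still lie in [E]. *)
  pose h := (x - 1 / 9) / (2 * D).
  have h0 : 0 < h by rewrite divr_gt0 ?subr_gt0// mulr_gt0.
  have : E (vs + h).
    have hsv : (sa < (vs + h)%:E)%E by rewrite er lte_fin ltr_wpDr// ltW.
    split; first by rewrite ltr_wpDr// ltW.
    apply: lt_le_trans (psum_le_pv M hsv).
    apply: lt_le_trans (psum_right M vs (ltW h0)); rewrite -ex.
    have hD : h * (2 * D) = x - 1 / 9 by rewrite divfK// gt_eqF// mulr_gt0.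
    move: hD hM l0 h0; rewrite /D; clear; move: h (ln M%:R) => h l hD hM l0 h0.
    have : h * (2 * (2 * l * x + 1)) = 2 * (x * (2 * h * l)) + 2 * h by ring.
    by rewrite hD mulrBr mulr1; lra.
  by move=> /ubE; rewrite leNgt ltrDl h0.
rewrite leNgt; apply/negP => hlt.
have [eta [eta0 eta1]] : exists eta, 0 < eta /\ eta < vs - r.
  exists ((vs - r) / 2); rewrite divr_gt0 ?subr_gt0//.
  by rewrite ltr_pdivrMr// ltr_pMr ?subr_gt0// ltr1n.
(* With g the gap and h = eta g, convexity and pv < 1 at vs - eta give pv(vs - h) <= (1 - g) pv(vs)
   + g < pv(vs) + g = 1/9, although [E] has points within h of vs. *)
have [g eg] : exists g, g = 1 / 9 - pv vs by exists (1 / 9 - pv vs).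
have g0 : 0 < g by rewrite eg subr_gt0.
have g1 : g < 1.
  by rewrite eg ltrBlDr ltr_wpDr ?ltW ?pv_gt0// ltr_pdivrMr// mul1r ltr1n.
have [h eh] : exists h, h = eta * g by exists (eta * g).
have h0 : 0 < h by rewrite eh mulr_gt0.
have heta : h <= eta by rewrite eh ler_piMr// ltW.
have [s Es hs] := sup_adherent h0 hE; rewrite -evs in hs.
have [rs ps] := Es.
have hve : (sa < (vs - eta)%:E)%E by rewrite er lte_fin ltrBrDl -ltrBrDr.
have hvh : (sa < (vs - h)%:E)%E.
  by apply: lt_le_trans hve _; rewrite lee_fin lerD2l lerN2.
have p1 : pv s < pv (vs - h) by exact: pv_decr.
have p2 : pv (vs - h) <= (1 - g) * pv vs + g * 1.
  apply: pv_le => // M; apply: le_trans (psum_convex M vs eta0 (ltW h0) heta) _.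
  have -> : h / eta = g by rewrite eh mulrC mulKf// gt_eqF.
  apply: lerD; first by rewrite ler_wpM2l ?psum_le_pv// subr_ge0 ltW.
  by rewrite ler_wpM2l ?ltW// (le_lt_trans (psum_le_pv M hve) (pv_lt1 hve)).
move: (pv_gt0 svs) p1 p2 ps eg g0; clear.
move: (pv vs) (pv s) (pv (vs - h)) => x y z x0 yz zx y9 eg g0.
have : 0 < g * x by rewrite mulr_gt0.
lra.
Qed.

End PickSum.

(** * The equality case of the bound on the critical abscissa *)

Section Rigidity.
Variables (R : realType) (N : set nat) (b : nat -> R) (adm : admissible N b).
Local Notation C := R[i].
Local Notation X := (hplane N b).
Local Notation pc := (pc N b).
Local Notation pv := (pv N b).
Local Notation psum := (psum N b).
Local Notation sa := (sigma_a N b).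
Local Notation delta0 := (delta0 R).
Hypothesis pcp : forall n, 0 <= pc n.
Variable r : R.
Hypothesis er : sa = r%:E.

Lemma powR2_dn2 : 2 `^ (2 * r) * dn 2 r ^+ 2 = 1 :> R.
Proof.
rewrite -dn_mul2 /dn /powR pnatr_eq0 /= -expRD.
by rewrite subrr expR0.
Qed.

(** From r to r + delta0 each term shrinks at least by the factor 1/9, and only n = 2 shrinks by
    exactly that; a sum at most 1 that becomes 1/9 is carried by n = 2. *)
Lemma extremal_pc : pv (r + delta0) = 1 / 9 ->
  pc 2 = 2 `^ (2 * r) /\ forall n, n != 2%N -> pc n = 0.
Proof.
move=> hpv; have rd : (sa < (r + delta0)%:E)%E by rewrite er lte_fin ltrDl delta0_gt0.
have dn0' n : (1 < n)%N -> dn n delta0 ^+ 2 <= 1 / 9 :> R.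
  move=> n1; rewrite -(_ : dn 2 delta0 ^+ 2 = 1 / 9); last by rewrite dn2_delta0; field.
  rewrite lerXn2r ?nnegrE ?dn_ge0// /dn ler_expR lerN2 ler_wpM2l ?(ltW (delta0_gt0 R))//.
  by rewrite ler_ln ?posrE ?ltr0n ?ler_nat// (ltn_trans _ n1).
have pz n : n != 2%N -> pc n = 0.
  move=> n2; have [n1|n1] := ltnP 1 n; last first.
    by case: n n1 {n2} => [|[|n]] // _; rewrite ?pc0 ?pc1.
  apply/eqP; rewrite eq_le pcp andbT leNgt; apply/negP => pn.
  have n3 : (2 < n)%N by rewrite ltn_neqAle eq_sym n2.
  have dlt : dn n delta0 ^+ 2 < 1 / 9 :> R.
    rewrite -(_ : dn 2 delta0 ^+ 2 = 1 / 9); last by rewrite dn2_delta0; field.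
    rewrite ltrXn2r ?nnegrE ?dn_ge0// /dn ltr_expR ltrN2 ltr_pM2l ?delta0_gt0//.
    by rewrite ltr_ln ?posrE ?ltr0n ?ltr_nat// (ltn_trans _ n1).
  (* The loss below 1/9 that a positive c_n with n > 2 would cause. *)
  pose g := pc n * dn n r ^+ 2 * (1 / 9 - dn n delta0 ^+ 2).
  have g0 : 0 < g by rewrite !mulr_gt0 ?exprn_gt0 ?dn_gt0 ?subr_gt0.
  suff : pv (r + delta0) <= 1 / 9 - g by rewrite hpv; lra.
  apply: (pv_le adm pcp) => // M.
  pose M' := maxn M n.+1.
  have pf i : 0 <= pc i * dn i (r + delta0) ^+ 2 by rewrite mulr_ge0 ?sqr_ge0.
  apply: le_trans (nonneg_sum_le pf (leq_maxl M n.+1)) _; rewrite -/M'.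
  have nM : (n < M')%N by rewrite leq_maxr.
  have : psum M' r <= 1 by exact: psum_le1.
  rewrite psumE (bigD1 (Ordinal nM))//= [X in _ -> X <= _](bigD1 (Ordinal nM))//=.
  set A := \sum_(i < M' | _) _; set B := \sum_(i < M' | _) _ => hA.
  have hB : B <= A * (1 / 9).
    rewrite /A mulr_suml; apply: ler_sum => i _.
    rewrite dnD exprMn mulrA; have [i1|i1] := ltnP 1 i.
      by rewrite ler_wpM2l ?dn0'// mulr_ge0 ?sqr_ge0.
    by move: i1; case: (nat_of_ord i) => [|[|?]] // _; rewrite ?pc0 ?pc1 !mul0r.
  rewrite dnD exprMn mulrA; move: hA hB; rewrite /g.
  by set x := pc n * dn n r ^+ 2; nra.
split=> //.
have ps M t : (2 < M)%N -> psum M t = pc 2 * dn 2 t ^+ 2.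
  move=> M2; rewrite psumE (bigD1 (Ordinal M2))//= big1 ?addr0// => i.
  by rewrite -val_eqE /= => /pz ->; rewrite mul0r.
have pvE : pc 2 * dn 2 (r + delta0) ^+ 2 = 1 / 9.
  rewrite -hpv; apply/eqP; rewrite eq_le; apply/andP; split.
    by rewrite -(ps 3)//; exact: (psum_le_pv adm pcp).
  apply: (pv_le adm pcp) => // M; rewrite -(ps M.+3)//.
  have pf i : 0 <= pc i * dn i (r + delta0) ^+ 2 by rewrite mulr_ge0 ?sqr_ge0.
  by apply: (nonneg_sum_le pf); lia.
have d0 : dn 2 r ^+ 2 != 0 :> R by rewrite gt_eqF// exprn_gt0// dn_gt0.
apply: (mulIf d0); rewrite powR2_dn2.
move: pvE; rewrite dnD dn2_delta0 exprMn; set x := dn 2 r ^+ 2.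
by set y := pc 2; nra.
Qed.

Lemma extremal_kernel : pv (r + delta0) = 1 / 9 -> forall s w : X,
  kernelX s w = 1 / (1 - (2 `^ (2 * r))%:C%C * (npow 2 (val s) * (npow 2 (val w))^*)).
Proof.
move=> /extremal_pc[p2 pz] s w; set u := (_ * _ : C).
have hk : kernelX s w = 1 + u * kernelX s w.
  apply: (kernel_pick adm (A := pc 2 * (normc (npow 2 (val s)) * normc (npow 2 (val w))))).
    move=> M; have pf i : 0 <= `|pc i| * (normc (npow i (val s)) * normc (npow i (val w))).
      by rewrite !mulr_ge0 ?normc_ge0.
    apply: le_trans (nonneg_sum_le (n := M.+3) pf _) _; first lia.
    have M2 : (2 < M.+3)%N by [].
    rewrite (bigD1 (Ordinal M2))//= big1 ?addr0 ?(ger0_norm (pcp _))// => i.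
    by rewrite -val_eqE /= => /pz ->; rewrite normr0 mul0r.
  apply: (@Ccvg_near _ (fun=> u) _ _ 3); last exact: Ccvg_cst.
  move=> M M2; rewrite (bigD1 (Ordinal M2))//= big1 ?addr0 ?p2// => i.
  by rewrite -val_eqE /= => /pz ->; rewrite rmorph0 mul0r.
have h1 : kernelX s w * (1 - u) = 1 by rewrite mulrBr mulr1 {1}hk mulrC addrK.
have u0 : 1 - u != 0.
  by apply/eqP => e; move: h1; rewrite e mulr0 => /eqP; rewrite eq_sym oner_eq0.
by apply: (mulIf u0); rewrite h1 divfK.
Qed.

Lemma extremal_value : (forall s w : X, kernelX s w =
    1 / (1 - (2 `^ (2 * r))%:C%C * (npow 2 (val s) * (npow 2 (val w))^*))) ->
  pv (r + delta0) = 1 / 9.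
Proof.
have rd : (sa < (r + delta0)%:E)%E by rewrite er lte_fin ltrDl delta0_gt0.
move=> hk; apply/(kernel_at_pv adm rd).
rewrite -[LHS]/(kernelX (rpoint rd) (rpoint rd)) hk.
have -> : npow 2 (val (rpoint rd)) = (dn 2 (r + delta0))%:C%C by exact: npow_real.
rewrite conjC_realC -!rmorphM dnD dn2_delta0.
have -> : 2 `^ (2 * r) * (dn 2 r * (1 / 3) * (dn 2 r * (1 / 3))) = 1 / 9 :> R.
  have := powR2_dn2; set x := dn 2 r; set y := 2 `^ _ => h.
  have -> : y * (x * (1 / 3) * (x * (1 / 3))) = (y * x ^+ 2) / 9 by field.
  by rewrite h.
by rewrite rmorphM fmorphV rmorph1 rmorph_nat; field.
Qed.

End Rigidity.

(** * The Bohr inequality *)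

Section DefectForm.
Variables (R : realType) (N : set nat) (b : nat -> R) (adm : admissible N b).
Local Notation C := R[i].
Local Notation wt := (wt N b).
Local Notation pc := (pc N b).
Hypothesis pcp : forall n, 0 <= pc n.
Implicit Types (q x y z : nat -> C).

Variables (M : nat) (a : nat -> C) (c : R).
Hypotheses (M2 : (1 < M)%N) (a0 : a 0%N = 0).

(** In coefficients this is the adjoint of M_phi: the vector with coefficients wt_n conj(q_n) goes
    to the one with wt_e conj(star q e). For [q] supported below M the truncation loses nothing. *)
Definition star q (e : nat) : C := \sum_(d < M) a d * q (d * e)%N.

Definition supported q := q 0%N = 0 /\ forall n, (M <= n)%N -> q n = 0.

(* When [a] is the coefficient sequence of a multiplier [phi], this is the
   quadratic form of [c^2 - M_phi M_phi^*] at [sum_n conj(q_n) wt_n n^{-s}]. *)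
Definition defect q : R :=
  \sum_(e < M) wt e * (c ^+ 2 * normc (q e) ^+ 2 - normc (star q e) ^+ 2).

Hypothesis defect_ge0 : forall q, supported q -> 0 <= defect q.

Lemma eq_defect x y : x =1 y -> defect x = defect y.
Proof. by move=> /funext ->. Qed.

Lemma starD x y (r s : C) e :
  star (fun n => r * x n + s * y n) e = r * star x e + s * star y e.
Proof.
rewrite /star !mulr_sumr -big_split; apply: eq_bigr => d _ /=; ring.
Qed.

Lemma supportedD x y (r s : C) : supported x -> supported y ->
  supported (fun n => r * x n + s * y n).
Proof.
move=> [x0 hx] [y0 hy]; split=> [|n Mn]; first by rewrite x0 y0 !mulr0 addr0.
by rewrite hx// hy// !mulr0 addr0.
Qed.

Lemma defectZ x (r : C) : defect (fun n => r * x n) = normc r ^+ 2 * defect x.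
Proof.
rewrite /defect mulr_sumr; apply: eq_bigr => e _.
have -> : star (fun n => r * x n) e = r * star x e.
  by have := starD x x r 0 e; rewrite mul0r addr0 => <-;
    apply: eq_bigr => d _; rewrite mul0r addr0.
by rewrite !Normc.normcM !exprMn; ring.
Qed.

Lemma defect_parallelogram x y (t : R) : t != 0 ->
  defect (fun n => 1 * x n + 1 * y n) =
  (1 + t^-1) * defect x + (1 + t) * defect y -
    t^-1 * defect (fun n => 1 * x n + (- t)%:C%C * y n).
Proof.
move=> t0; rewrite /defect !mulr_sumr -big_split -sumrB; apply: eq_bigr => e _ /=.
rewrite !starD !mul1r !normcE2 !(ReD, ImD) !ReZ !ImZ; field.
exact: t0.
Qed.

Lemma defectD_le x y (t : R) : 0 < t -> supported x -> supported y ->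
  defect (fun n => 1 * x n + 1 * y n) <= (1 + t^-1) * defect x + (1 + t) * defect y.
Proof.
move=> t0 hx hy; rewrite (defect_parallelogram x y (t := t)) ?gt_eqF//.
rewrite lerBlDr lerDl mulr_ge0 ?invr_ge0 ?(ltW t0)//.
by apply: defect_ge0; exact: supportedD.
Qed.

Definition shift q (d : nat) : nat -> C := fun e => q (d * e)%N.

Lemma supported_shift q d : (0 < d)%N -> supported q -> supported (shift q d).
Proof.
move=> d0 [q0 hq]; rewrite /shift; split=> [|n Mn]; first by rewrite muln0.
by apply: hq; apply: leq_trans Mn _; rewrite leq_pmull.
Qed.

(** [star] commutes with dilations, so the left side is a double sum of c_d b_e G(d e); [dconv_sum]
    collapses it, and delta_1 takes out the term n = 1. *)
Lemma defect_shift_sum q : supported q ->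
  \sum_(d < M) pc d * defect (shift q d) =
  defect q - (c ^+ 2 * normc (q 1%N) ^+ 2 - normc (star q 1) ^+ 2).
Proof.
move=> [q0 hq].
pose G n := c ^+ 2 * normc (q n) ^+ 2 - normc (star q n) ^+ 2.
have hG n : (M <= n)%N -> G n = 0.
  move=> Mn; rewrite /G hq// /star big1 ?Normc.normc0 ?expr0n ?mulr0 ?subr0//.
  move=> d _; have [d0|d0] := posnP d; first by rewrite d0 a0 mul0r.
  by rewrite hq ?mulr0// (leq_trans Mn)// leq_pmull.
have -> : \sum_(d < M) pc d * defect (shift q d) =
    \sum_(d < M) \sum_(e < M) pc d * wt e * G (d * e)%N.
  apply: eq_bigr => d _; rewrite /defect mulr_sumr; apply: eq_bigr => e _.
  rewrite mulrA; congr (_ * (_ - normc _ ^+ 2)).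
  by apply: eq_bigr => f _; rewrite /shift mulnCA.
rewrite -(dconv_sum (pc0 N b) (wt0 adm) hG) /defect.
rewrite (eq_bigr (fun n : 'I_M => wt n * G n - (n == 1%N :> nat)%:R * G n)); last first.
  by move=> n _; rewrite -mulrBl; congr (_ * _); rewrite [wt n in RHS](pcP adm) addrAC subrr add0r.
rewrite sumrB; congr (_ - _).
rewrite (bigD1 (Ordinal M2))//= mul1r big1 ?addr0// => n.
by rewrite -val_eqE /= => /negbTE ->; rewrite mul0r.
Qed.

Variables (w : nat -> R) (p : nat -> C).
Hypotheses (w1 : w 1%N = 1)
  (wM : forall m n, (0 < m)%N -> (0 < n)%N -> w (m * n)%N = w m * w n)
  (ps : supported p) (pw : forall n, (0 < n < M)%N -> normc (p n) = w n)
  (small : \sum_(d < M) pc d * w d ^+ 2 <= 1 / 9).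

Let e1 (n : nat) : C := (n == 1%N)%:R.
Let T1 := defect e1.

Lemma supported_e1 : supported e1.
Proof.
by split=> // n Mn; rewrite /e1 gtn_eqF// (leq_trans M2).
Qed.

Lemma T1_ge0 : 0 <= T1. Proof. exact/defect_ge0/supported_e1. Qed.

(** The dilate of [p] with its value at 1 removed, so that the term c^2 |q_1|^2 of
    [defect_shift_sum] disappears. *)
Let tail (n : nat) : nat -> C := fun e => 1 * shift p n e + (- p n) * e1 e.

Lemma supported_tail n : (0 < n)%N -> supported (tail n).
Proof.
by move=> n0; apply: supportedD; [exact: supported_shift|exact: supported_e1].
Qed.

(** Since the tail vanishes at 1, its defect is at most the c-weighted sum of the defects of its
    dilates. For d > 1 these are plain dilates of [p], and [small] supplies the factor 1/9. *)
Lemma defect_tail n (B : R) : (0 < n)%N ->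
  (forall d, (1 < d)%N -> defect (shift p (n * d)) <= B * w d ^+ 2) -> 0 <= B ->
  defect (tail n) <= B / 9.
Proof.
move=> n0 hB B0.
have := defect_shift_sum (supported_tail n0).
have -> : tail n 1%N = 0 by rewrite /tail /shift /e1 muln1 /= mul1r mulr1 subrr.
rewrite Normc.normc0 expr0n mulr0 sub0r opprK => h.
have : defect (tail n) <= \sum_(d < M) pc d * defect (shift (tail n) d).
  by rewrite h lerDl sqr_ge0.
move/le_trans; apply.
apply: (@le_trans _ _ (\sum_(d < M) B * (pc d * w d ^+ 2))); last first.
  rewrite -mulr_sumr ler_wpM2l//; apply: le_trans small _.
  by rewrite mul1r.
apply: ler_sum => d _; rewrite [leRHS]mulrCA.
have [d1|d1] := ltnP 1 d; last first.
  by move: d1; case: (nat_of_ord d) => [|[|?]] // _; rewrite ?pc0 ?pc1 !mul0r.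
apply: ler_wpM2l => //.
apply: le_trans (hB d d1); rewrite le_eqVlt; apply/orP; left; apply/eqP.
apply: eq_defect => e; rewrite /shift /tail /shift /e1 mul1r.
have -> : (d * e == 1)%N = false.
  by case: e => [|e]; rewrite ?muln0// muln_eq1 (gtn_eqF d1).
by rewrite mulr0 addr0 mulnA.
Qed.

Lemma shift_split n e : shift p n e = 1 * (p n * e1 e) + 1 * tail n e.
Proof. by rewrite /tail; ring. Qed.

(** Splitting off the value at 1 with t = 2 costs 3/2 for that value and 3 * B / 9 for the tail, and
    B = 9/4 reproduces itself; t = 2 makes this fixed point smallest. The induction descends because
    dilates by n >= M vanish. *)
Lemma defect_shift_le n : (0 < n)%N -> defect (shift p n) <= 9 / 4 * w n ^+ 2 * T1.
Proof.
have [k] := ubnP (M - n); elim: k n => // k IH n; rewrite ltnS => Mnk n0.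
have T10 := T1_ge0.
have [Mn|nM] := leqP M n.
  have [p0 hp] := ps.
  have -> : defect (shift p n) = 0.
    rewrite (eq_defect (y := fun i => 0 * p i)) ?defectZ ?Normc.normc0 ?expr0n ?mul0r//.
    move=> e; rewrite mul0r /shift; have [->|e0] := posnP e; first by rewrite muln0.
    by apply: hp; apply: leq_trans Mn _; rewrite leq_pmulr.
  by apply: mulr_ge0 T10; apply: mulr_ge0 (sqr_ge0 _); rewrite divr_ge0.
pose B := 9 / 4 * w n ^+ 2 * T1.
have B0 : 0 <= B.
  by apply: mulr_ge0 T10; apply: mulr_ge0 (sqr_ge0 _); rewrite divr_ge0.
have ht : defect (tail n) <= B / 9.
  apply: defect_tail => // d d1; have d0 : (0 < d)%N by exact: ltnW.
  apply: le_trans (IH (n * d)%N _ _) _; last by rewrite wM// /B exprMn; lra.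
    apply: leq_trans Mnk; apply: ltn_sub2l => //.
    by rewrite -[X in (X < _)%N]muln1 ltn_pmul2l.
  by rewrite muln_gt0 n0.
rewrite (eq_defect (shift_split n)).
have se : supported (fun e => p n * e1 e).
  have := supportedD (p n) 0 supported_e1 supported_e1.
  by congr supported; apply/funext => e; rewrite mul0r addr0.
have two : 0 < 2 :> R by [].
apply: le_trans (defectD_le two se (supported_tail n0)) _.
rewrite defectZ -/T1 pw ?n0//.
move: ht; rewrite /B; move: (defect (tail n)) (w n ^+ 2) T1 => D W t ht.
lra.
Qed.

Theorem star_le : normc (\sum_(n < M) a n * p n) ^+ 2 <= c ^+ 2.
Proof.
have T10 := T1_ge0.
have hd d : (1 < d)%N -> defect (shift p (1 * d)) <= 9 / 4 * T1 * w d ^+ 2.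
  by move=> d1; rewrite mul1n mulrAC; apply: defect_shift_le; exact: ltnW.
have ht : defect (tail 1) <= 9 / 4 * T1 / 9.
  by apply: defect_tail => //; rewrite mulr_ge0.
have p1 : normc (p 1%N) = 1 by rewrite pw.
(* p_1 delta_1 = p - tail with |p_1| = 1; t = 1 and T(tail) <= T1 / 4 give T(p) >= T1 / 4, which
   balances the bound [hs] below. *)
have hT1 : T1 <= 2 * defect p + 2 * defect (tail 1).
  have st := supported_tail (isT : (0 < 1)%N).
  have sn : supported (fun e => -1 * tail 1 e).
    have := supportedD (-1) 0 st st.
    by congr supported; apply/funext => e; rewrite mul0r addr0.
  have := defectD_le ltr01 ps sn; rewrite defectZ normcN Normc.normc1 expr1n mul1r invr1.
  apply: le_trans; rewrite le_eqVlt; apply/orP; left; apply/eqP.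
  rewrite (eq_defect (y := fun e => p 1%N * e1 e)).
    by rewrite defectZ p1 expr1n mul1r.
  by move=> e; rewrite /tail /shift mul1n; ring.
have := defect_shift_sum ps; rewrite p1 expr1n mulr1.
have -> : star p 1 = \sum_(n < M) a n * p n.
  by apply: eq_bigr => n _; rewrite muln1.
have hs : \sum_(d < M) pc d * defect (shift p d) <= 9 / 4 * T1 / 9.
  apply: (@le_trans _ _ (\sum_(d < M) (9 / 4 * T1) * (pc d * w d ^+ 2))).
    apply: ler_sum => d _; rewrite [leRHS]mulrCA.
    have [d1|d1] := ltnP 1 d; last first.
      by move: d1; case: (nat_of_ord d) => [|[|?]] // _; rewrite ?pc0 ?pc1 !mul0r.
    by rewrite ler_wpM2l//; have := hd _ d1; rewrite mul1n.
  rewrite -mulr_sumr ler_wpM2l ?mulr_ge0//.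
  by apply: le_trans small _; rewrite mul1r.
by move=> e; move: hs; rewrite e; lra.
Qed.

End DefectForm.

(** * Multipliers in terms of coefficients *)

Section MultiplierCoefficients.
Variables (R : realType) (N : set nat) (b : nat -> R) (adm : admissible N b).
Local Notation C := R[i].
Local Notation X := (hplane N b).
Local Notation wt := (wt N b).
Local Notation pc := (pc N b).
Variable (H : rkhs (@kernelX R N b)).
Local Notation mem := (rkhs_mem H).
Local Notation dot := (rkhs_dot H).
Local Notation hnorm := (hnorm H).
Local Notation monomial := (@monomial R N b).
Local Notation hcoef := (hcoef H).

Lemma one_mem : mem (fun=> 1).
Proof.
have := rkhs_kernel H (ipoint N b); congr (mem _).
by apply/funext => x; rewrite kernel_ipoint.
Qed.

Lemma multiplier_mem phi : multiplier H phi -> mem phi.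
Proof.
move=> [h _]; have := h _ one_mem; congr (mem _).
by apply/funext => x /=; rewrite mulr1.
Qed.

Lemma hcoef0 f : hcoef f 0 = 0.
Proof. by apply: hcoef_notin => /(adm_pos adm). Qed.

Lemma hcoef_abs_bounded f (x : X) : mem f ->
  exists A, forall M, \sum_(n < M) normc (hcoef f n * npow n (val x)) <= A.
Proof.
move=> hf; have [A hA] := coef_abs_bounded adm (hcoef_notin H f) x
  (fun M => bessel adm M hf).
exists A => M; apply: le_trans (hA M); apply: ler_sum => n _.
by rewrite Normc.normcM.
Qed.

Lemma npow_fM (x : X) m n : (0 < m)%N -> (0 < n)%N ->
  npow (m * n) (val x) = npow m (val x) * npow n (val x).
Proof. exact: npowM. Qed.

Lemma mul_expansion f g (x : X) : mem f -> mem g ->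
  Ccvg (fun M => \sum_(n < M) dconv (hcoef f) (hcoef g) n * npow n (val x))
    (f x * g x).
Proof.
move=> hf hg; have [A hA] := hcoef_abs_bounded x hf.
have [B hB] := hcoef_abs_bounded x hg.
have f0 : hcoef f 0 * npow 0 (val x) = 0 by rewrite hcoef0 mul0r.
have g0 : hcoef g 0 * npow 0 (val x) = 0 by rewrite hcoef0 mul0r.
have := dirichlet_mul (a := fun n => hcoef f n * npow n (val x))
  (b := fun n => hcoef g n * npow n (val x)) f0 g0 hA hB
  (monomial_expansion adm x hf) (monomial_expansion adm x hg).
apply: eq_Ccvg => M; apply: eq_bigr => n _.
by apply: dconv_mull; [exact: hcoef0 | exact: hcoef0 | exact: npow_fM].
Qed.

Lemma dconv_notin (u v : nat -> C) : (forall n, ~ N n -> u n = 0) ->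
  (forall n, ~ N n -> v n = 0) -> forall n, ~ N n -> dconv u v n = 0.
Proof.
move=> hu hv n Nn; rewrite /dconv big1// => d _; rewrite big1// => e _.
case: eqP => // de; have [Nd|Nd] := pselect (N d); last by rewrite hu// mul0r.
have [Ne|Ne] := pselect (N e); last by rewrite hv// mulr0.
by case: Nn; rewrite -de; exact: (adm_mul adm).
Qed.

Lemma hcoef_mul f g : mem f -> mem g -> mem (f \* g) ->
  hcoef (f \* g) =1 dconv (hcoef f) (hcoef g).
Proof.
move=> hf hg hfg; have [s0 h0] := real_point_exists adm.
pose x0 := shift_point h0 0.
have [A hA] := hcoef_abs_bounded x0 hf; have [B hB] := hcoef_abs_bounded x0 hg.
have d0 n : (0 < n)%N -> dn n s0 = normc (npow n (val x0)).
  by move=> n0; rewrite npow_shift// expr0 mulr1 normc_pos ?dn_ge0.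
apply: (hcoef_unique adm (h0 := h0) (A := A * B)) => //.
- by apply: dconv_notin; exact: hcoef_notin.
- move=> M; pose u n := normc (hcoef f n * npow n (val x0)).
  pose v n := normc (hcoef g n * npow n (val x0)).
  have u0 : u 0%N = 0 by rewrite /u hcoef0 mul0r Normc.normc0.
  have v0 : v 0%N = 0 by rewrite /v hcoef0 mul0r Normc.normc0.
  have up n : 0 <= u n by exact: normc_ge0.
  have vp n : 0 <= v n by exact: normc_ge0.
  apply: (@le_trans _ _ (\sum_(n < M) dconv u v n)).
    apply: ler_sum => n _.
    have [n0|n0] := posnP n; first by rewrite n0 !dconv0 ?hcoef0// Normc.normc0 mul0r.
    rewrite d0// -Normc.normcM.
    rewrite -(dconv_mull _ (hcoef0 f) (hcoef0 g) (@npow_fM x0)).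
    exact: normc_dconv.
  apply: le_trans (sum_dconv_le _ _ _ _ _) _ => //.
  by apply: ler_pM => //; apply: sumr_ge0 => n _.
- by move=> j; exact: mul_expansion.
Qed.

Lemma hcoef_dpoly (u : nat -> C) M : (forall n, ~ N n -> u n = 0) ->
  hcoef (dpoly xpredT u M) =1 (fun n => if (n < M)%N then u n else 0).
Proof.
move=> uN n; have [Nn|Nn] := pselect (N n); last first.
  by rewrite hcoef_notin// uN// if_same.
rewrite hcoefE// (dot_dpoly_monomial adm)//=; case: ifP => _; last by rewrite mulr0.
rewrite mulrCA -rmorphM mulfV ?rmorph1 ?mulr1//.
by rewrite gt_eqF// (wt_gt0 adm).
Qed.

(** [f] is the adjoint of M_phi applied to [h], written in coefficients. The inner product of phi f
    with h equals the squared norm of f, so Cauchy-Schwarz and the bound on M_phi give |f| <= c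
    |h|. *)
Lemma multiplier_defect_ge0 phi c M : multiplier H phi -> mult_bound H phi c ->
  forall q, supported M q -> 0 <= defect N b M (hcoef phi) c q.
Proof.
move=> hphi [c0 hc] q [q0 qM].
have mphi := multiplier_mem hphi.
pose a := hcoef phi; pose q' := star M a q.
have cE (t : nat -> C) : (forall n, ~ N n -> (wt n)%:C%C * (t n)^* = 0).
  by move=> n Nn; rewrite (wt_notin b Nn) rmorph0 mul0r.
pose u e := (wt e)%:C%C * (q' e)^*; pose v n := (wt n)%:C%C * (q n)^*.
have uN : forall n, ~ N n -> u n = 0 by exact: cE.
have vN : forall n, ~ N n -> v n = 0 by exact: cE.
have nrm (t : nat -> C) : (forall n, ~ N n -> (wt n)%:C%C * (t n)^* = 0) ->
    hnorm (dpoly xpredT (fun n => (wt n)%:C%C * (t n)^*) M) ^+ 2 =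
    \sum_(e < M) wt e * normc (t e) ^+ 2.
  move=> tN; rewrite (hnorm_dpoly adm)//; apply: eq_bigr => e _.
  rewrite Normc.normcM normcJ2 normc_pos ?(wt_ge0 adm)// exprMn.
  have [Ne|Ne] := pselect (N e); last by rewrite (wt_notin b Ne) !(mul0r, expr0n).
  by field; rewrite gt_eqF// (wt_gt0 adm).
pose f := dpoly xpredT u M : X -> C; pose h := dpoly xpredT v M : X -> C.
have hf : mem f by exact: (dpoly_mem adm).
have hh : mem h by exact: (dpoly_mem adm).
have hpf : mem (phi \* f) by have [+ _] := hphi; apply.
pose Z := \sum_(e < M) wt e * normc (q' e) ^+ 2.
have Z0 : 0 <= Z.
  by apply: sumr_ge0 => e _; exact: (mulr_ge0 (wt_ge0 adm _) (sqr_ge0 _)).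
have fZ : hnorm f ^+ 2 = Z by exact: nrm.
have hZ : hnorm h ^+ 2 = \sum_(e < M) wt e * normc (q e) ^+ 2 by exact: nrm.
have eZ : dot (phi \* f) h = Z%:C%C.
  rewrite (dot_dpoly adm)//=.
  have -> : \sum_(i < M | (i : nat) \in N) (v i)^* * dot (phi \* f) (monomial i) =
      \sum_(i < M) dconv a (hcoef f) i * q i.
    rewrite big_mkcond; apply: eq_bigr => i _; rewrite -hcoef_mul//.
    case: ifPn => [/set_mem Ni|iN]; last by rewrite hcoef_memN// mul0r.
    by rewrite hcoefE// /v rmorphM /= conjC_realC conjCK; ring.
  rewrite (dconv_sum (hcoef0 _) (hcoef0 _) qM) exchange_big realC_sum.
  apply: eq_bigr => e _ /=.
  rewrite hcoef_dpoly// ltn_ord rmorphM /= -mulJc /u.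
  rewrite [q' e]/q' /star mulr_suml mulr_sumr; apply: eq_bigr => d _.
  by rewrite -/a -/(star M a q e) -/q'; ring.
have le1 : Z <= c ^+ 2 * hnorm h ^+ 2.
  rewrite -exprMn; apply: (@sqr_le_of_le_mul _ _ _ (hnorm f)) => //.
  - exact: hnorm_ge0.
  - have := cauchy_schwarz hpf hh; rewrite eZ normc_pos// => /le_trans; apply.
    rewrite mulrAC ler_wpM2r ?hnorm_ge0//; exact: hc.
  - by rewrite fZ.
rewrite /defect (eq_bigr (fun e : 'I_M => c ^+ 2 * (wt e * normc (q e) ^+ 2) -
  wt e * normc (q' e) ^+ 2)); last by move=> e _; rewrite mulrBr mulrCA.
by rewrite sumrB -mulr_sumr -hZ subr_ge0.
Qed.

Hypothesis pcp : forall n, 0 <= pc n.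

Theorem bohr_inequality phi (s : X) : multiplier H phi ->
  (forall M, \sum_(n < M) pc n * normc (npow n (val s)) ^+ 2 <= 1 / 9) ->
  (majorant phi s <= (mult_norm H phi)%:E)%E.
Proof.
move=> hphi small; have mphi := multiplier_mem hphi.
apply/nneseries_le_bound => [n _|M]; first exact: normc_ge0.
apply: mult_normP => // c hc; rewrite (coef_hcoef adm mphi).
set a := hcoef phi; set w := fun n => normc (npow n (val s)).
(* [star_le] needs the index 1 inside the range. *)
pose M' := M.+2.
apply: (@le_trans _ _ (\sum_(n < M') normc (a n) * w n)).
  have pf n : 0 <= normc (a n) * w n by rewrite mulr_ge0 ?normc_ge0.
  have MM' : (M <= M')%N by rewrite /M'; lia.
  apply: le_trans (nonneg_sum_le pf MM').
  by apply: ler_sum => n _; case: ifP => // _; rewrite Normc.normcM.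
(* The phases make each a_n p_n equal to |a_n| w_n; where a_n = 0 the phase is arbitrary, but the
   modulus must still be w_n. *)
pose p n : C := if (0 < n < M')%N then
  (if a n == 0 then (w n)%:C%C else (w n / normc (a n))%:C%C * (a n)^*) else 0.
have an0 n : a n != 0 -> normc (a n) != 0.
  by apply: contra_neq; exact: Normc.eq0_normc.
have w0 n : 0 <= w n by exact: normc_ge0.
have ps : supported M' p.
  split; first by rewrite /p.
  by move=> n Mn; rewrite /p [(n < M')%N]ltnNge Mn andbF.
have pw n : (0 < n < M')%N -> normc (p n) = w n.
  move=> hn; rewrite /p hn; case: eqP => [_|/eqP/an0 a1]; first by rewrite normc_pos.
  by rewrite Normc.normcM normcJ2 normc_pos ?divr_ge0 ?normc_ge0// divfK.
have := star_le adm pcp (isT : (1 < M')%N) (hcoef0 phi)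
  (multiplier_defect_ge0 hphi hc) _ _ ps pw (small M').
have -> : \sum_(n < M') a n * p n = (\sum_(n < M') normc (a n) * w n)%:C%C.
  rewrite realC_sum; apply: eq_bigr => n _.
  have [n0|n0] := posnP n.
    by rewrite n0 /a hcoef0 mul0r Normc.normc0 mul0r rmorph0.
  rewrite /p n0 ltn_ord /=; case: eqP => [->|/eqP/an0 a1].
    by rewrite mul0r Normc.normc0 mul0r rmorph0.
  rewrite mulrCA mulJc -rmorphM; congr (_%:C%C); field; exact: a1.
rewrite normc_pos; last by apply: sumr_ge0 => n _; rewrite mulr_ge0 ?normc_ge0.
have [c0 _] := hc.
rewrite ler_pXn2r ?nnegrE//; last by apply: sumr_ge0 => n _; rewrite mulr_ge0 ?normc_ge0.
apply.
- by rewrite /w npow1 Normc.normc1.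
- by move=> m n m0 n0; rewrite /w npowM// Normc.normcM.
Qed.

End MultiplierCoefficients.

(** * Sharpness *)

Section MoebiusMultiplier.
Variables (R : realType) (T : Type).
Local Notation C := R[i].
Variables (k : T -> T -> C) (H : rkhs k).
Local Notation mem := (rkhs_mem H).
Local Notation hnorm := (hnorm H).
Variables (g : T -> C) (a : R).
Hypotheses (g_mem : forall f, mem f -> mem (fun x => g x * f x))
  (g_le : forall f, mem f -> hnorm (fun x => g x * f x) <= hnorm f)
  (g1 : forall x, normc (g x) <= 1) (a0 : 0 <= a) (a1 : a < 1).

(** Partial sums of the Neumann series for the inverse of 1 - a M_g. *)
Fixpoint neumann (f : T -> C) (J : nat) : T -> C :=
  if J is J'.+1 then fun x => f x + a%:C%C * (g x * neumann f J' x) else fun=> 0.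

Lemma neumann_mem f J : mem f -> mem (neumann f J).
Proof.
move=> hf; elim: J => [|J IH] /=; first exact: rkhs_mem0.
by apply: memD => //; apply: memZ; exact: g_mem.
Qed.

Lemma neumann_le f J : mem f -> hnorm (neumann f J) <= hnorm f / (1 - a).
Proof.
move=> hf; have a1' : 0 < 1 - a by rewrite subr_gt0.
elim: J => [|J IH] /=; first by rewrite hnorm0 divr_ge0 ?hnorm_ge0// ltW.
have hm := neumann_mem J hf.
have := ler_hnormD hf (memZ a%:C%C (g_mem hm)); move/le_trans; apply.
rewrite hnormZ ?normc_pos//; last exact: g_mem.
apply: (@le_trans _ _ (hnorm f + a * (hnorm f / (1 - a)))).
  by rewrite lerD2l ler_wpM2l// (le_trans (g_le hm)).
rewrite le_eqVlt; apply/orP; left; apply/eqP; field.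
by rewrite gt_eqF.
Qed.

Lemma neumann_dist f m p : mem f ->
  hnorm (fun x => neumann f (m + p)%N x - neumann f m x) <= a ^+ m * (hnorm f / (1 - a)).
Proof.
move=> hf; elim: m => [|m IH].
  rewrite add0n expr0 mul1r; apply: le_trans (neumann_le p hf).
  by rewrite le_eqVlt; apply/orP; left; apply/eqP; congr hnorm;
    apply/funext => x; rewrite /= subr0.
have hd : mem (fun x => neumann f (m + p)%N x - neumann f m x).
  by apply: memB; exact: neumann_mem.
rewrite addSn /= (_ : (fun x => _) = (fun x => a%:C%C * (g x *
  (neumann f (m + p)%N x - neumann f m x)))); last first.
  by apply/funext => x; ring.
rewrite hnormZ ?normc_pos//; last exact: g_mem.
rewrite exprS -mulrA ler_wpM2l//; apply: le_trans IH; exact: g_le.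
Qed.

Lemma neumann_limit f : mem f ->
  exists2 F, mem F & forall x, F x = f x + a%:C%C * (g x * F x).
Proof.
move=> hf; have hm J := neumann_mem J hf.
have [|F hF cF] := hcauchy_cvg hm.
  move=> e e0; have [K hK] := exp_small (hnorm f / (1 - a)) a0 a1 e0.
  exists K => m n /andP[Km mn]; rewrite -(subnKC mn).
  by apply: le_lt_trans (neumann_dist m (n - m) hf) _; rewrite mulrC hK.
exists F => // x; have hx := hcvg_eval x hm hF cF.
apply: Ccvg_unique (Ccvg_sub (s := S) leqnSn hx) _.
by apply: CcvgD (Ccvg_cst _) _; do 2 apply: CcvgZ.
Qed.

Lemma moebius_den x : 1 - a%:C%C * g x != 0.
Proof.
apply/eqP => /eqP; rewrite subr_eq0 => /eqP h.
have : normc (a%:C%C * g x) < 1.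
  rewrite Normc.normcM normc_pos//; apply: le_lt_trans a1.
  by rewrite ler_piMr.
by rewrite -h Normc.normc1 ltxx.
Qed.

Definition moebius (x : T) : C := (a%:C%C - g x) / (1 - a%:C%C * g x).

(** Write f = F - a g F, so that the product with f is a F - g F. The difference of the squared
    norms is (1 - a^2)(|F|^2 - |g F|^2), nonnegative because g acts as a contraction. *)
Lemma moebius_mult_bound : multiplier H moebius /\ mult_bound H moebius 1.
Proof.
have key f : mem f -> mem (moebius \* f) /\ hnorm (moebius \* f) <= hnorm f.
  move=> hf; have [F hF eF] := neumann_limit hf.
  pose G x := g x * F x; have hG : mem G by exact: g_mem.
  have GF : hnorm G <= hnorm F by exact: g_le.
  have haG := memZ a%:C%C hG; have haF := memZ a%:C%C hF.
  have ef : f = (fun x => F x - a%:C%C * G x).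
    by apply/funext => x; rewrite {1}eF addrK.
  have em : moebius \* f = (fun x => a%:C%C * F x - G x).
    apply/funext => x; rewrite /= ef /moebius /G.
    by have := moebius_den x; set u := g x; set v := F x => d0; field.
  have hm : mem (moebius \* f) by rewrite em; exact: memB.
  split=> //; rewrite -(ler_pXn2r (n := 2)) ?nnegrE ?hnorm_ge0//.
  have hm1 := memB hF haG; have hm2 := memB haF hG.
  rewrite [in leRHS]ef em !hnorm_sqr//.
  rewrite !dotBl// ?dotBr// ?dotZl// ?dotZr//.
  rewrite !conjC_realC !ReB !ReZ.
  rewrite -!hnorm_sqr// (rkhs_dotC hF hG) ReJ.
  have h : 0 <= (1 - a ^+ 2) * (hnorm F ^+ 2 - hnorm G ^+ 2).
    rewrite mulr_ge0// subr_ge0; first by rewrite exprn_ile1// ltW.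
    by rewrite lerXn2r ?nnegrE ?hnorm_ge0.
  by rewrite -subr_ge0; apply: le_trans h _; rewrite le_eqVlt; apply/orP; left;
    apply/eqP; ring.
split; last first.
  by split=> // f /key[_]; rewrite mul1r.
split; first by move=> f /key[].
by exists 1; split=> // f /key[_]; rewrite mul1r.
Qed.

End MoebiusMultiplier.

Section WeightedCauchySchwarz.
Variable R : realType.
Local Notation C := R[i].

Lemma weighted_cs (I : finType) (w x : I -> R) : (forall i, 0 <= w i) ->
  (\sum_i w i * x i) ^+ 2 <= (\sum_i w i) * (\sum_i w i * x i ^+ 2).
Proof.
move=> w0; set W := \sum_i w i; set Y := \sum_i w i * x i.
have W0 : 0 <= W by apply: sumr_ge0.
have [We|Wn] := eqVneq W 0.
  have wz i : w i = 0 by have := psumr_eq0P (fun i _ => w0 i) We; apply.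
  by rewrite /Y big1 ?expr0n ?We ?mul0r// => i _; rewrite wz mul0r.
have Wp : 0 < W by rewrite lt_def Wn.
rewrite -subr_ge0 -(pmulr_rge0 _ Wp).
have -> : W * (W * (\sum_i w i * x i ^+ 2) - Y ^+ 2) = \sum_i w i * (W * x i - Y) ^+ 2.
  rewrite [RHS](eq_bigr (fun i => W ^+ 2 * (w i * x i ^+ 2) - (2 * W * Y) * (w i * x i) +
    Y ^+ 2 * w i)); last by move=> i _; ring.
  by rewrite big_split sumrB -!mulr_sumr -/Y -/W /=; ring.
by apply: sumr_ge0 => i _; exact: (mulr_ge0 (w0 i) (sqr_ge0 _)).
Qed.

(** Cauchy-Schwarz over the factorizations d e = n, with weights p_d q_e. *)
Lemma dconv_cs (p q : nat -> R) (x y : nat -> C) n :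
  (forall i, 0 <= p i) -> (forall i, 0 <= q i) ->
  normc (dconv (fun d => (p d)%:C%C * x d) (fun e => (q e)%:C%C * y e) n) ^+ 2 <=
  dconv p q n *
  dconv (fun d => p d * normc (x d) ^+ 2) (fun e => q e * normc (y e) ^+ 2) n.
Proof.
move=> p0 q0; rewrite /dconv !pair_big /=.
pose w (i : 'I_n.+1 * 'I_n.+1) := if (i.1 * i.2 == n)%N then p i.1 * q i.2 else 0.
have w0 i : 0 <= w i by rewrite /w; case: ifP => // _; exact: mulr_ge0.
pose v (i : 'I_n.+1 * 'I_n.+1) := normc (x i.1) * normc (y i.2).
have h := weighted_cs v w0.
apply: (@le_trans _ _ ((\sum_i w i * v i) ^+ 2)).
  have wx0 : 0 <= \sum_i w i * v i.
    by apply: sumr_ge0 => i _; rewrite !mulr_ge0 ?normc_ge0.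
  rewrite lerXn2r ?nnegrE ?normc_ge0//.
  apply: le_trans (normc_sum _ _ _) _; apply: ler_sum => i _.
  rewrite /w /v; case: ifP => _; last by rewrite Normc.normc0 mul0r.
  by rewrite !Normc.normcM !normc_pos//; rewrite le_eqVlt; apply/orP; left; apply/eqP; ring.
apply: le_trans h _; rewrite ler_wpM2l ?sumr_ge0//.
apply: ler_sum => i _; rewrite /w /v; case: ifP => _; last by rewrite mul0r.
by rewrite le_eqVlt; apply/orP; left; apply/eqP; ring.
Qed.

End WeightedCauchySchwarz.

(** * The multiplier that violates the Bohr inequality *)

Section ExtremalMultiplier.
Variables (R : realType) (N : set nat) (b : nat -> R) (adm : admissible N b).
Local Notation C := R[i].
Local Notation X := (hplane N b).
Local Notation wt := (wt N b).
Local Notation pc := (pc N b).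
Variable (H : rkhs (@kernelX R N b)).
Local Notation mem := (rkhs_mem H).
Local Notation hnorm := (hnorm H).
Local Notation hcoef := (hcoef H).
Hypothesis pcp : forall n, 0 <= pc n.

(** c_n is the term d = n, e = 1 of c * b. So c vanishes outside [N] and the generator below has
    finite norm. *)
Lemma pc_le_wt n : pc n <= wt n.
Proof.
case: n => [|n]; first by rewrite pc0 (wt0 adm).
rewrite (pcP adm) /dconv (bigD1 ord_max)//= (bigD1 (Ordinal (isT : (1 < n.+2)%N)))//=.
rewrite muln1 eqxx (wt1 adm) mulr1 addrCA -addrA lerDl !addr_ge0//.
  by apply: sumr_ge0 => e _; case: ifP => // _; rewrite mulr_ge0 ?(wt_ge0 adm).
apply: sumr_ge0 => d _; apply: sumr_ge0 => e _.
by case: ifP => // _; rewrite mulr_ge0 ?(wt_ge0 adm).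
Qed.

Variables (s : X) (r : R).
Hypotheses (r0 : 0 < r)
  (sP : Ccvg (fun M => (\sum_(n < M) pc n * normc (npow n (val s)) ^+ 2)%:C%C)
     (r ^+ 2)%:C%C).

(** The kernel function at [s] for the kernel sum_n c_n n^{-x - conj s}, divided by its norm [r]. *)
Definition gcoef (n : nat) : C := (pc n)%:C%C * ((npow n (val s))^* / r%:C%C).

Lemma normc_gfactor n :
  normc ((npow n (val s))^* / r%:C%C) ^+ 2 = normc (npow n (val s)) ^+ 2 / r ^+ 2.
Proof.
by rewrite Normc.normcM normcJ2 Normc.normcV normc_pos ?(ltW r0)// expr_div_n.
Qed.

Lemma gfactor_sum M :
  \sum_(n < M) pc n * normc ((npow n (val s))^* / r%:C%C) ^+ 2 <= 1.
Proof.
rewrite (eq_bigr (fun n : 'I_M => (pc n * normc (npow n (val s)) ^+ 2) / r ^+ 2)).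
  rewrite -mulr_suml ler_pdivrMr ?exprn_gt0// mul1r.
  apply: (@Ccvg_real_ge _ (fun M => \sum_(n < M) pc n * normc (npow n (val s)) ^+ 2)
    (r ^+ 2)%:C%C) sP.
  exists M => m Mm; apply: (nonneg_sum_le (u := fun n =>
    pc n * normc (npow n (val s)) ^+ 2)) => // i.
  exact: (mulr_ge0 (pcp _) (sqr_ge0 _)).
by move=> n _; rewrite normc_gfactor mulrA.
Qed.

Lemma gcoef_notin n : ~ N n -> gcoef n = 0.
Proof.
move=> Nn; rewrite /gcoef (_ : pc n = 0) ?rmorph0 ?mul0r//.
by apply/eqP; rewrite eq_le pcp -(wt_notin b Nn) pc_le_wt.
Qed.

Lemma div_wt_le (u v : R) n : 0 <= v -> u <= wt n * v -> u / wt n <= v.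
Proof.
move=> v0; have [->|w0] := eqVneq (wt n) 0; first by rewrite invr0 mulr0.
by move=> h; rewrite ler_pdivrMr 1?mulrC// lt_def w0 (wt_ge0 adm).
Qed.

Lemma gcoef_norm M : \sum_(n < M) normc (gcoef n) ^+ 2 / wt n <= 1.
Proof.
apply: le_trans (gfactor_sum M); apply: ler_sum => n _.
have h0 : 0 <= pc n * normc ((npow n (val s))^* / r%:C%C) ^+ 2.
  exact: (mulr_ge0 (pcp _) (sqr_ge0 _)).
apply: div_wt_le => //.
rewrite /gcoef Normc.normcM exprMn normc_pos// expr2 -mulrA.
by apply: ler_wpM2r => //; exact: pc_le_wt.
Qed.

Lemma extremal_generator : exists g : X -> C, [/\ mem g, hcoef g =1 gcoef,
  forall x, Ccvg (fun M => \sum_(n < M) gcoef n * npow n (val x)) (g x)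
  & forall x, normc (g x) <= 1].
Proof.
have [g [hg _ _ gx]] := synthesis adm H gcoef_notin gcoef_norm.
exists g; split=> //.
  exact: (synthesis_hcoef adm gcoef_notin gcoef_norm hg gx).
move=> x; apply: (Ccvg_normc_le _ (gx x)); exists 0%N => M _.
apply: le_trans (normc_sum _ _ _) _.
have px : \sum_(n < M) pc n * normc (npow n (val x)) ^+ 2 <= 1.
  apply: (@le_trans _ _ (1 - (complex.Re (kernelX x x))^-1)); last first.
    rewrite gerBl invr_ge0; exact: le_trans (kernel_diag_ge1 adm x).
  apply: (Ccvg_real_ge _ (pick_sumP adm pcp x)); exists M => m Mm.
  apply: (nonneg_sum_le (u := fun n => pc n * normc (npow n (val x)) ^+ 2)) => // i.
  exact: (mulr_ge0 (pcp _) (sqr_ge0 _)).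
(* The inequality 2 u v <= u^2 + v^2 bounds |g(x)| by the mean of two c-sums, each at most 1. *)
apply: (@le_trans _ _ (\sum_(n < M) (pc n * normc ((npow n (val s))^* / r%:C%C) ^+ 2 +
    pc n * normc (npow n (val x)) ^+ 2) / 2)).
  apply: ler_sum => n _; rewrite /gcoef !Normc.normcM normc_pos//.
  rewrite -Normc.normcM -mulrDr -mulrA -mulrA; apply: ler_wpM2l => //.
  set u := normc _; set v := normc _.
  by have := sqr_ge0 (u - v); rewrite sqrrB; lra.
rewrite -mulr_suml big_split /=; have := gfactor_sum M; lra.
Qed.

(** [dconv_cs] bounds |u_n|^2 by (c * b)_n times a convolution [dconv P Q n]. As (c * b)_n <= b_n,
    dividing by b_n leaves that convolution, whose sum is at most 1 times the squared norm of
    [f]. *)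
Lemma extremal_generator_mul g f : mem g -> hcoef g =1 gcoef -> mem f ->
  mem (fun x => g x * f x) /\ hnorm (fun x => g x * f x) <= hnorm f.
Proof.
move=> hg /funext eg hf.
pose u := dconv (hcoef g) (hcoef f).
have uN : forall n, ~ N n -> u n = 0.
  by apply: (dconv_notin adm); exact: hcoef_notin.
pose y n := hcoef f n / (wt n)%:C%C.
have ef : hcoef f = (fun e => (wt e)%:C%C * y e).
  apply/funext => e; rewrite /y; have [Ne|Ne] := pselect (N e).
    by rewrite mulrC divfK// eq_complex /= eqxx andbT gt_eqF// (wt_gt0 adm).
  by rewrite hcoef_notin// mul0r mulr0.
have ny e : wt e * normc (y e) ^+ 2 = normc (hcoef f e) ^+ 2 / wt e.
  have [Ne|Ne] := pselect (N e); last first.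
    by rewrite hcoef_notin// (wt_notin b Ne) Normc.normc0 expr0n !mul0r.
  have w0 := wt_gt0 adm Ne.
  rewrite /y Normc.normcM Normc.normcV normc_pos ?(ltW w0)// expr_div_n.
  by field; rewrite gt_eqF.
have hu M : \sum_(n < M) normc (u n) ^+ 2 / wt n <= hnorm f ^+ 2.
  pose P d := pc d * normc ((npow d (val s))^* / r%:C%C) ^+ 2.
  pose Q e := wt e * normc (y e) ^+ 2.
  have P0 d : 0 <= P d by exact: (mulr_ge0 (pcp _) (sqr_ge0 _)).
  have Q0 d : 0 <= Q d by exact: (mulr_ge0 (wt_ge0 adm _) (sqr_ge0 _)).
  apply: (@le_trans _ _ (\sum_(n < M) dconv P Q n)).
    apply: ler_sum => n _.
    have c0 : 0 <= dconv P Q n.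
      apply: sumr_ge0 => d _; apply: sumr_ge0 => e _; case: ifP => // _.
      exact: mulr_ge0.
    apply: div_wt_le => //.
    rewrite /u eg ef; apply: le_trans (dconv_cs _ _ _ pcp (wt_ge0 adm)) _.
    by apply: ler_wpM2r => //; rewrite [leRHS](pcP adm) lerDr.
  apply: le_trans (sum_dconv_le _ P0 Q0 _ _) _.
  - by rewrite /P pc0 mul0r.
  - by rewrite /Q (wt0 adm) mul0r.
  apply: (@le_trans _ _ (1 * \sum_(e < M) Q e)).
    by apply: ler_wpM2r; [exact: sumr_ge0 | exact: gfactor_sum].
  rewrite mul1r (eq_bigr (fun e : 'I_M => normc (hcoef f e) ^+ 2 / wt e)).
    exact: (bessel adm).
  by move=> e _; exact: ny.
have [F [hF _ nF Fx]] := synthesis adm H uN hu.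
have eF : F = (fun x => g x * f x).
  by apply/funext => x; apply: Ccvg_unique (Fx x) _; exact: (mul_expansion adm).
rewrite -eF; split=> //.
by rewrite -(ler_pXn2r (n := 2)) ?nnegrE ?hnorm_ge0.
Qed.

Theorem bohr_failure : 1 / 3 < r -> r < 1 ->
  exists2 phi, multiplier H phi & ~ (majorant phi s <= (mult_norm H phi)%:E)%E.
Proof.
move=> r3 r1; have [g [hg eg gx g1]] := extremal_generator.
have gm f (hf : mem f) := (extremal_generator_mul hg eg hf).1.
have gl f (hf : mem f) := (extremal_generator_mul hg eg hf).2.
(* This is a = (r + 1)/(4 r), for which r (1 + 2 a) = (3 r + 1)/2 exceeds 1 exactly when r > 1/3. *)
pose a := 1 - (3 * r - 1) / (4 * r).
have q0 : 0 < (3 * r - 1) / (4 * r) by rewrite divr_gt0// ?mulr_gt0//; lra.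
have q1 : (3 * r - 1) / (4 * r) <= 1 by rewrite ler_pdivrMr ?mulr_gt0//; lra.
have a0 : 0 <= a by rewrite subr_ge0.
have a1 : a < 1 by rewrite ltrBlDr ltrDl.
have ra : 1 < r * (1 + 2 * a).
  have -> : r * (1 + 2 * a) = (3 * r + 1) / 2 by rewrite /a; field; rewrite gt_eqF.
  by rewrite ltr_pdivlMr//; lra.
have [mphi bphi] := moebius_mult_bound gm gl g1 a0 a1.
exists (moebius g a) => // hle.
have {}hle : (majorant (moebius g a) s <= 1%:E)%E.
  by apply: le_trans hle _; rewrite lee_fin; exact: mult_norm_le.
have memphi := multiplier_mem adm mphi.
have h0 n : N n -> 0 <= normc (coef (moebius g a) n * npow n (val s)).
  by move=> _; exact: normc_ge0.
have {}hle := (nneseries_le_bound _ h0).1 hle.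
rewrite (coef_hcoef adm memphi) in hle.
set al := hcoef (moebius g a) in hle.
have hle' M : \sum_(n < M) normc (al n * npow n (val s)) <= 1.
  apply: le_trans (hle M); apply: ler_sum => n _.
  by case: ifPn => // nN; rewrite /al hcoef_memN// mul0r Normc.normc0.
have gs : g s = r%:C%C.
  apply: Ccvg_unique (gx s) _.
  have -> : r%:C%C = r%:C%C^-1 * (r ^+ 2)%:C%C :> C.
    by rewrite -fmorphV -rmorphM; congr (_%:C%C); field; rewrite gt_eqF.
  apply: eq_Ccvg (CcvgZ _ sP) => M; rewrite realC_sum mulr_sumr.
  by apply: eq_bigr => n _; rewrite /gcoef rmorphM /= -mulJc; ring.
have gi : g (ipoint N b) = 0.
  apply: Ccvg_unique (gx _) _; apply: eq_Ccvg (Ccvg_cst 0) => M.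
  rewrite big1// => n _ /=; case: eqP => [->|_]; last by rewrite mulr0.
  by rewrite /gcoef pc1 rmorph0 !mul0r.
have al1 : al 1%N = a%:C%C.
  have -> : a%:C%C = moebius g a (ipoint N b).
    by rewrite /moebius gi mulr0 !subr0 divr1.
  apply: Ccvg_unique (monomial_expansion adm (ipoint N b) memphi).
  apply: (@Ccvg_near _ (fun=> al 1%N) _ _ 2); last exact: Ccvg_cst.
  move=> M M1; rewrite (bigD1 (Ordinal M1))//= mulr1 big1 ?addr0// => i.
  by rewrite -val_eqE /= => /negbTE ->; rewrite mulr0.
(* The first coefficient is a, so a majorant at most 1 leaves 1 - a for the rest of the series. But
   the value at s differs from a by (1 - a^2) r / (1 - a r), and comparing the two gives r (1 + 2 a)
   <= 1. *)
have hms : normc (moebius g a s - al 1%N) <= 1 - a.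
  have := CcvgB (monomial_expansion adm s memphi) (Ccvg_cst (al 1%N)).
  apply: Ccvg_normc_le; exists 2 => M M1.
  have := hle' M; rewrite (bigD1 (Ordinal M1))//= npow1 mulr1 al1 normc_pos// => h.
  rewrite -/al (bigD1 (Ordinal M1))//= npow1 mulr1 al1 addrAC subrr add0r.
  by apply: le_trans (normc_sum _ _ _) _; rewrite lerBrDl.
move: hms; rewrite al1 /moebius gs.
have d0 : 0 < 1 - a * r by rewrite subr_gt0; apply: le_lt_trans r1; rewrite ler_piMl// ltW.
have -> : (a%:C%C - r%:C%C) / (1 - a%:C%C * r%:C%C) - a%:C%C =
    (- ((1 - a ^+ 2) * r / (1 - a * r)))%:C%C :> C.
  rewrite -rmorphM -(rmorph1 (real_complex R)) -!rmorphB -fmorphV -rmorphM -rmorphB.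
  by congr (_%:C%C); field; rewrite gt_eqF.
rewrite normc_real normrN ger0_norm; last first.
  by rewrite divr_ge0 ?(ltW d0)// mulr_ge0 ?(ltW r0)// subr_ge0 exprn_ile1 ?(ltW a1).
rewrite ler_pdivrMr// => h.
have : (1 - a) * (1 - r * (1 + 2 * a)) >= 0.
  by move: h; nra.
rewrite pmulr_rge0 ?subr_gt0//; lra.
Qed.

End ExtremalMultiplier.

(** * The Bohr set as a sublevel set of 1 - 1/k *)

Section BohrSet.
Variables (R : realType) (N : set nat) (b : nat -> R) (adm : admissible N b).
Local Notation X := (hplane N b).
Local Notation pc := (pc N b).
Local Notation pv := (pv N b).
Local Notation sa := (sigma_a N b).
Variable (H : rkhs (@kernelX R N b)).
Hypothesis pcp : forall n, 0 <= pc n.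

Lemma bohr_setP (s : X) :
  bohr_set H s <-> 1 - (complex.Re (kernelX s s))^-1 <= 1 / 9.
Proof.
have hS := pick_sumP adm pcp s; have k1 := kernel_diag_ge1 adm s.
move: hS; set S := 1 - _ => hS.
have S1 : S < 1 by rewrite ltrBlDr ltrDl invr_gt0; exact: lt_le_trans k1.
split=> [hs|S9 phi hphi]; last first.
  apply: (bohr_inequality adm pcp hphi) => M; apply: le_trans S9.
  apply: (Ccvg_real_ge _ hS); exists M => m Mm.
  apply: (nonneg_sum_le (u := fun n => pc n * normc (npow n (val s)) ^+ 2)) => // i.
  exact: (mulr_ge0 (pcp _) (sqr_ge0 _)).
rewrite leNgt; apply/negP => S9.
have S0 : 0 <= S by apply: ltW; apply: lt_trans S9; rewrite divr_gt0.
have hS' := hS; rewrite -(sqr_sqrtr S0) in hS'.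
have r0 : 0 < Num.sqrt S by rewrite sqrtr_gt0; apply: lt_trans S9; rewrite divr_gt0.
have [||phi hphi] := bohr_failure adm H pcp r0 hS'.
- rewrite -(ltr_pXn2r (n := 2)) ?nnegrE ?sqrtr_ge0 ?divr_ge0// sqr_sqrtr//.
  by apply: le_lt_trans S9; rewrite expr_div_n expr1n -natrX.
- by rewrite -(ltr_pXn2r (n := 2)) ?nnegrE ?sqrtr_ge0// sqr_sqrtr// expr1n.
- by apply; exact: hs.
Qed.

Lemma bohr_set_infty (s : X) : val s = None -> bohr_set H s.
Proof.
move=> e; apply/bohr_setP.
have -> : s = ipoint N b by exact: val_inj.
by rewrite (kernel_ipoint adm) /= invr1 subrr divr_ge0.
Qed.

(** k(s, s) involves only the moduli of n^{-s}, hence only the real part of s. *)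
Lemma bohr_set_finite (s : X) z : val s = Some z ->
  bohr_set H s <-> pv (complex.Re z) <= 1 / 9.
Proof.
move=> e; have h : (sa < (complex.Re z)%:E)%E.
  by have [e'|[z' e' h']] := hplane_cases s; move: e'; rewrite e// => -[->].
suff ek : kernelX s s = kernelX (rpoint h) (rpoint h).
  by split=> [/bohr_setP|h9]; [rewrite ek | apply/bohr_setP; rewrite ek].
apply: Ccvg_unique (kernel_diagP adm s) _.
apply: eq_Ccvg (kernel_diagP adm (rpoint h)) => M; congr (_%:C%C).
by apply: eq_bigr => n _; rewrite e !normc_npow.
Qed.

End BohrSet.

Theorem corollary6 (R : realType) (N : set nat) (b : nat -> R)
  (N_pos : forall n, N n -> (0 < n)%N)
  (N_one : N 1%N)
  (N_mul : forall m n, N m -> N n -> N (m * n)%N)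
  (N_neq : N <> [set 1%N])
  (b_one : b 1%N = 1)
  (b_pos : forall n, N n -> 0 < b n)
  (sigma_a_lt : (sigma_a N b < +oo)%E)
  (H : rkhs (@kernelX R N b))
  (pick : complete_pick H) :
  [/\ forall s1 s2 : R, critical N b s1 -> critical N b s2 -> s1 = s2,
      forall vs : R, critical N b vs ->
        bohr_set H = [set s | (vs%:E <= re_point (val s))%E],
      ~ (exists vs : R, critical N b vs) -> bohr_set H = [set: hplane N b]
    & (exists vs : R, critical N b vs /\
         vs%:E = (sigma_a N b + (ln 3 / ln 2)%:E)%E) <->
      (forall s w : hplane N b,
         kernelX s w =
         1 / (1 - (2 `^ (2 * fine (sigma_a N b)))%:C%C *
                  (npow 2 (val s) * (npow 2 (val w))^*)))].
Proof.
have adm := Admissible N_pos N_one N_mul N_neq b_one b_pos sigma_a_lt.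
have pcp := pc_ge0 adm pick.
have [r er] := sigma_a_fin adm pcp.
have crit vs : critical N b vs -> (sigma_a N b < vs%:E)%E /\ pv N b vs = 1 / 9.
  by move=> [h _ hk]; split=> //; exact/(kernel_at_pv adm h).
have decr := pv_decr adm pcp.
split.
- move=> s1 s2 /crit[h1 p1] /crit[h2 p2].
  have [lt|gt|//] := ltgtP s1 s2.
    by have := decr _ _ h1 lt; rewrite p1 p2 ltxx.
  by have := decr _ _ h2 gt; rewrite p1 p2 ltxx.
- move=> vs /crit[hvs pvs]; apply/seteqP; split=> s /=.
    have [->|[z e hz]] := hplane_cases s; first by rewrite leey.
    move=> /(bohr_set_finite adm H pcp e) h9; rewrite e /= lee_fin leNgt.
    by apply/negP => /(decr _ _ hz); rewrite pvs ltNge h9.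
  have [e|[z e hz]] := hplane_cases s; first by move=> _; exact: (bohr_set_infty adm pcp e).
  rewrite e /= lee_fin le_eqVlt => h; apply/(bohr_set_finite adm H pcp e).
  case/predU1P: h => [<-|/(decr _ _ hvs)/ltW]; first by rewrite pvs.
  by rewrite pvs.
(* A point outside the Bohr set has [pv] above 1/9 at its real part, and [critical_exists] then
   produces a critical value. *)
- move=> ncrit; apply/seteqP; split=> // s _.
  have [e|[z e hz]] := hplane_cases s; first exact: (bohr_set_infty adm pcp e).
  apply/(bohr_set_finite adm H pcp e); rewrite leNgt; apply/negP => h9.
  exact/ncrit/(critical_exists adm pcp hz).
- have d0 : (sigma_a N b < (r + delta0 R)%:E)%E by rewrite er lte_fin ltrDl delta0_gt0.
  rewrite er /=; split=> [[vs [/crit[_ pvs]]]|hk].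
    rewrite -EFinD => -[evs]; rewrite evs in pvs.
    exact: (extremal_kernel adm pcp er).
  exists (r + delta0 R); split; last by rewrite -EFinD.
  split=> //; first by rewrite er -EFinD lexx.
  by apply/(kernel_at_pv adm d0); exact: (extremal_value adm er).
Qed.
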